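(* The general tiling problem for the hyperbolic plane is undecidable. That is, there is no algorithm which, given as input a finite set $\mathcal{T}$ of prototiles à la Wang on the ternary heptagrid $\{7,3\}$ together with a distinguished subset $\mathcal{K}\subseteq\mathcal{T}$ (the skeleton), decides whether there exists a tiling of the hyperbolic plane by copies of elements of $\mathcal{T}$ in which every element of $\mathcal{K}$ is used infinitely many times.
   Context: The ternary heptagrid $\{7,3\}$ is the tessellation of the hyperbolic plane generated by the regular heptagon with vertex angle $\frac{2\pi}{3}$ by reflections in its edges and, recursively, of the images in their edges. A prototile à la Wang is a copy of this regular heptagon with a colour (from a finite alphabet) assigned to each of its seven edges. A tiling by a finite set $\mathcal{T}$ of prototiles assigns to each heptagon of $\{7,3\}$ a copy of an element of $\mathcal{T}$, such that the two copies sharing an edge have the same colour on that edge. Copies are obtained by direct isometries (translations and rotations); reflected copies are not allowed. The general tiling problem is distinguished from the partial problem. In the partial problem, at least one tile is fixed in the initial set and must be used, but at most finitely many times. In the general problem, there is a subset of the initial set of prototiles, called the skeleton, whose elements must all be used infinitely many times in the tiling. A decision problem is undecidable if no Turing machine solves it on all inputs. *)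

(* Defs.v *)
From HB Require Import structures.
From mathcomp Require Import all_boot all_order all_algebra.
From mathcomp Require Import mathcomp_extra boolp classical_sets functions.
From mathcomp Require Import cardinality reals normedtype sequences exp trigo.
From mathcomp Require Import ring lra.

Set Implicit Arguments.
Unset Strict Implicit.
Unset Printing Implicit Defensive.

Import Order.TTheory GRing.Theory Num.Theory.

Local Open Scope ring_scope.
Local Open Scope classical_set_scope.

(** * Turing machines and undecidability *)

Inductive move := MoveLeft | MoveRight | Stay.

(* Deterministic one-tape machines over the input alphabet [S]; the tape
   alphabet contains (a copy of) [S] and a blank that is not an input letter. *)
Record turing_machine (S : finType) := TuringMachine {
  state : finType;
  symbol : finType;
  blank : symbol;
  input : S -> symbol;
  start : state;
  accept : state;
  reject : state;
  delta : state -> symbol -> state * symbol * move;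
  input_inj : injective input;
  input_blank : forall a, input a != blank;
  accept_reject : accept != reject
}.

Section Run.
Variables (S : finType) (M : turing_machine S).

(* The tape is two-way infinite, with cells indexed by [int]. *)
Record config := Config {
  cstate : state M;
  ctape : int -> symbol M;
  chead : int
}.

Definition shift (d : move) (i : int) : int :=
  match d with MoveLeft => i - 1 | MoveRight => i + 1 | Stay => i end.

Definition step (c : config) : config :=
  if (cstate c == accept M) || (cstate c == reject M) then c else
  let: (q, a, d) := delta (cstate c) (ctape c (chead c)) in
  Config q (fun i => if i == chead c then a else ctape c i) (shift d (chead c)).

(* The word is written on the cells [0 .. size w - 1], the head is on cell 0. *)
Definition init (w : seq S) : config :=
  Config (start M)
    (fun i => match i with
              | Posz n => nth (blank M) (map (input M) w) n
              | Negz _ => blank M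
              end)
    0.

Definition accepts (w : seq S) : Prop :=
  exists n, cstate (iter n step (init w)) = accept M.

Definition rejects (w : seq S) : Prop :=
  exists n, cstate (iter n step (init w)) = reject M.

End Run.

Definition solves (S : finType) (I : Type) (enc : I -> seq S) (P : I -> Prop)
    (M : turing_machine S) : Prop :=
  forall i, (P i -> accepts M (enc i)) /\ (~ P i -> rejects M (enc i)).

Definition undecidable (S : finType) (I : Type) (enc : I -> seq S)
    (P : I -> Prop) : Prop :=
  ~ exists M : turing_machine S, solves enc P M.

(** * Instances of the tiling problem, and their encoding as words *)

(* The colours of the seven edges, listed counterclockwise.  Colours are natural
   numbers; a finite set of prototiles only uses finitely many of them. *)
Definition prototile := 7.-tuple nat.

Record instance := Instance {
  tiles : seq prototile;
  skeleton : seq prototile;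
  tiles_uniq : uniq tiles;
  skeleton_uniq : uniq skeleton;
  skeleton_sub : {subset skeleton <= tiles}
}.

(* A three-letter alphabet: a tally mark, an end-of-colour mark, and a separator
   between the prototiles and the skeleton.  Colours are written in unary. *)
Definition letter : finType := option bool.
Definition tally : letter := Some true.
Definition comma : letter := Some false.
Definition bar : letter := None.

Definition encode_colour (c : nat) : seq letter := rcons (nseq c tally) comma.

Definition encode_tile (t : prototile) : seq letter :=
  flatten (map encode_colour t).

Definition encode_tiles (s : seq prototile) : seq letter :=
  flatten (map encode_tile s).

Definition encode (i : instance) : seq letter :=
  encode_tiles (tiles i) ++ bar :: encode_tiles (skeleton i).

(** * The hyperbolic plane (hyperboloid model) and the heptagrid {7,3} *)

Section Hyperbolic.
Variable R : realType.

Local Notation vec := 'rV[R]_3.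
Local Notation x0 := (0 : 'I_3).
Local Notation x1 := (1 : 'I_3).
Local Notation x2 := (2%:R : 'I_3).

Definition mink (u v : vec) : R :=
  - (u 0 x0 * v 0 x0) + u 0 x1 * v 0 x1 + u 0 x2 * v 0 x2.

Definition hplane : set vec := [set x | mink x x = -1 /\ 0 < x 0 x0].

(* Matrices act on row vectors, on the right. *)
Definition act (A : 'M[R]_3) (x : vec) : vec := x *m A.

(* Orientation-preserving isometries of [hplane]. *)
Definition direct_isometry (A : 'M[R]_3) : Prop :=
  [/\ forall u v, mink (act A u) (act A v) = mink u v,
      forall x, hplane x -> hplane (act A x)
    & \det A = 1].

(* The reflection in the line [mink x n = 0], for a unit vector [n]. *)
Definition reflection (n x : vec) : vec := x - (2 * mink x n) *: n.

(* A heptagon is given by the outward unit normals of its sides. *)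
Definition normals := 'I_7 -> vec.

Definition polygon (n : normals) : set vec :=
  [set x | hplane x /\ forall k, mink x (n k) <= 0].

Definition edge (n : normals) (k : 'I_7) : set vec :=
  polygon n `&` [set x | mink x (n k) = 0].

(* Inradius r of the regular heptagon with vertex angle 2 pi / 3: the right
   triangle formed by the centre, the midpoint of a side and an endpoint of that
   side has angles pi / 7 and pi / 3, so cosh r = cos (pi / 3) / sin (pi / 7). *)
Definition cosh_inradius : R := cos (pi / 3) / sin (pi / 7).
Definition sinh_inradius : R := Num.sqrt (cosh_inradius ^+ 2 - 1).

(* Centre (1, 0, 0); the k-th side is the one in direction 2 pi k / 7. *)
Definition regular_normals : normals := fun k =>
  \row_(j < 3)
    if j == x0 then sinh_inradius
    else if j == x1 then cosh_inradius * cos (2 * pi * k%:R / 7)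
    else cosh_inradius * sin (2 * pi * k%:R / 7).

Definition regular_heptagon : set vec := polygon regular_normals.
Definition regular_edge (k : 'I_7) : set vec := edge regular_normals k.

(* The regular heptagon, its images under the reflections in its sides, the
   images of these under the reflections in their own sides, and so on. *)
Inductive generated : normals -> Prop :=
| generated_base : generated regular_normals
| generated_reflect (n : normals) (k : 'I_7) :
    generated n -> generated (fun j => reflection (n k) (n j)).

Definition heptagrid : set (set vec) :=
  [set h | exists2 n, generated n & h = polygon n].

(** * Tilings *)

(* The heptagon [h] receives the copy of the prototile [tile h] obtained by the
   direct isometry [place h]; the [i]-th edge of that copy is the image of
   [regular_edge i] and has colour [tnth (tile h) i]. *)
Definition is_tiling (T : seq prototile)
    (tile : set vec -> prototile) (place : set vec -> 'M[R]_3) : Prop :=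
  (forall h, heptagrid h ->
     [/\ tile h \in T, direct_isometry (place h)
       & act (place h) @` regular_heptagon = h]) /\
  (forall h h' i j, heptagrid h -> heptagrid h' ->
     act (place h) @` regular_edge i = act (place h') @` regular_edge j ->
     tnth (tile h) i = tnth (tile h') j).

Definition tileable_with_skeleton (I : instance) : Prop :=
  exists (tile : set vec -> prototile) (place : set vec -> 'M[R]_3),
    is_tiling (tiles I) tile place /\
    forall t, t \in skeleton I ->
      infinite_set [set h | heptagrid h /\ tile h = t].

(** * The sides of the regular heptagon are unit and meet at angle 2 pi / 3 *)

Let sin_pi7_gt0 : 0 < sin (pi / 7) :> R.
Proof. by apply: sin_gt0_pi; have := pi_gt0 R; lra. Qed.

Let cos_pi3 : cos (pi / 3) = 1 / 2 :> R.
Proof.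
have c0 : 0 < cos (pi / 3) :> R.
  by apply: cos_gt0_pihalf; have := pi_gt0 R; lra.
have e : cos (pi / 3 *+ 2) = - cos (pi / 3) :> R.
  rewrite (_ : pi / 3 *+ 2 = - (pi / 3) + pi); last by rewrite mulr2n; field.
  by rewrite cosDpi cosN.
move: e; rewrite cos_mulr2n mulr2n => e.
have : (cos (pi / 3) + 1) * (2 * cos (pi / 3) - 1) = 0 :> R.
  by move: e; rewrite expr2 => e; rewrite mulrDl mulrBr; lra.
by move/eqP; rewrite mulf_eq0 => /orP[] /eqP; lra.
Qed.

Let sinh2 : sinh_inradius ^+ 2 = cosh_inradius ^+ 2 - 1.
Proof.
rewrite sqr_sqrtr// subr_ge0 -[1](expr1n _ 2).
have p0 := pi_gt0 R.
rewrite lerXn2r// ?nnegrE//;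
  first by rewrite divr_ge0 ?(ltW sin_pi7_gt0)// cos_pi3; lra.
rewrite /cosh_inradius ler_pdivlMr// mul1r.
rewrite (_ : pi / 3 = pi / 2 - pi / 6); last by field.
rewrite cosB cos_pihalf sin_pihalf mul0r add0r mul1r ltW//.
by rewrite ltr_sin ?in_itv/=; lra.
Qed.

Lemma mink_regular_normals (k l : 'I_7) :
  mink (regular_normals k) (regular_normals l) =
  1 - cosh_inradius ^+ 2 * (1 - cos (2 * pi * k%:R / 7 - 2 * pi * l%:R / 7)).
Proof.
rewrite /mink !mxE/= cosB.
by have := sinh2; rewrite !expr2 => ->; ring.
Qed.

Lemma regular_normals_unit (k : 'I_7) :
  mink (regular_normals k) (regular_normals k) = 1.
Proof. by rewrite mink_regular_normals subrr cos0 subrr mulr0 subr0. Qed.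

(* Outward unit normals m, n of two sides meeting at an interior angle a
   satisfy mink m n = - cos a. *)
Lemma regular_normals_angle (k : 'I_7) :
  mink (regular_normals k) (regular_normals (ordS k)) = - cos (2 * pi / 3).
Proof.
rewrite mink_regular_normals.
have -> : cos (2 * pi * k%:R / 7 - 2 * pi * (ordS k)%:R / 7) =
          cos (pi / 7 *+ 2) :> R.
  rewrite -[RHS]cosN /=; have [k6|k6] := eqVneq (k : nat) 6%N.
    by rewrite k6 modnn -[RHS]cosD2pi; congr cos; rewrite !mulr2n; field.
  rewrite modn_small; last by rewrite ltn_neqAle eqSS k6 ltn_ord.
  by congr cos; rewrite -natr1 mulr2n; field.
have s0 : sin (pi / 7) != 0 :> R by rewrite gt_eqF.
rewrite (_ : 2 * pi / 3 = pi / 3 *+ 2); last by rewrite mulr2n; field.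
rewrite !cos_mulr2n cos_pi3 /cosh_inradius cos_pi3.
have -> : cos (pi / 7) ^+ 2 = 1 - sin (pi / 7) ^+ 2 :> R.
  by have := cos2Dsin2 (pi / 7 : R); lra.
by rewrite !mulr2n; field.
Qed.

End Hyperbolic.

(* Main.v *)
From HB Require Import structures.
From mathcomp Require Import all_boot all_order all_algebra.
From mathcomp Require Import boolp classical_sets.
From mathcomp Require Import cardinality reals trigo.
From mathcomp Require Import ring lra zify.
Require Import Defs.

(* Given a machine M that supposedly decides the problem, we build an instance
   that is tileable exactly when M does not accept its encoding.

   A seed tile forces a tree of heptagons around it.  Level n of the tree, read
   from left to right, contains columns numbered - n, ..., n - 1, separated by
   filler heptagons; column x carries the content of the tape cell x at time
   n - 2, and the right border of the tree writes the input, which is hard-wired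
   in the tiles.  So a single seed forces the whole space-time diagram of a
   machine.  No tile carries an accepting state: if the machine accepts, no tiling
   contains a seed; otherwise the trees of infinitely many disjoint seeds,
   surrounded by blank tiles, make a tiling.

   The hard-wired input w encodes the tiles that do not depend on w.  The other
   tiles form a chain: the j-th one carries the j-th letter of w, and apart from
   the chain colours j and j + 1 it only uses a few fixed colours.  The simulated
   machine can therefore complete w into the encoding of the whole instance, by
   sweeping over w to count in unary, and then it runs M on the result.

   Words over the branches of the tree reach distinct heptagons because the three
   branches map a cone of the hyperboloid into disjoint subcones. *)

Set Implicit Arguments.
Unset Strict Implicit.
Unset Printing Implicit Defensive.

Import Order.TTheory GRing.Theory Num.Theory.

(** * The tree grown from a dart *)

(** Diagonalising against [M] itself, instead of reducing from a halting problem, requires an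
    instance that contains its own encoding, and this raises a circularity. The colours record the
    states of the simulated machine, the machine writes codes of colours in unary, and its finite
    control must hold the words that it writes. Only twelve colours occur in these words; they
    receive the first odd codes, below 24, so a bound chosen before the machine covers all the
    words. The even codes are left to the chain colours, whose unary lengths are produced by
    counting and never stored in the control. On the geometric side, tiles may be rotated but not
    reflected, so the colours have to force the rotation of every tile around the seed. Two
    cyclically consecutive colours at a known place suffice for this, helped at a few vertices by
    the third tile meeting there. A level has one more column on each side than the level above it,
    so the head, which idles for one step, never catches up with the borders. Halted configurations
    are stationary: a rejecting run gives a diagram that continues forever without an accepting
    cell. *)

(* [KL] and [KR] are the two borders of a level, [KC x] is the column of the tape
   cell [x]; [KW x] and [KB x] are fillers between the columns [x] and [x + 1], with
   one and with two parents. *)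
Inductive kind := KL | KR | KC of int | KW of int | KB of int.

Definition isB k := if k is KB _ then true else false.
Definition iscol k := match k with KW _ | KB _ => false | _ => true end.

Definition idx (n : nat) k : int :=
  match k with KL => - n%:Z | KR => n%:Z - 1 | KC x | KW x | KB x => x end%R.

(* The edges of a heptagon are numbered from 0, the edge shared with its (left)
   parent; [child n k d] is the kind of the heptagon across edge [d] of a heptagon
   of kind [k] in level [n]. *)
Definition child (n : nat) (k : kind) (d : nat) : option kind :=
  match k, d with
  | KL, 3 => Some KL | KL, 4 => Some (KC (- n%:Z)%R) | KL, 5 => Some (KB (- n%:Z)%R)
  | KR, 3 => Some (KC (n%:Z - 1)%R) | KR, 4 => Some KR
  | KC x, 3 => Some (KC x) | KC x, 4 => Some (KW x) | KC x, 5 => Some (KB x)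
  | KW x, 3 => Some (KW x) | KW x, 4 => Some (KW x) | KW x, 5 => Some (KB x)
  | KB x, 3 => Some (KW x) | KB x, 4 => Some (KB x)
  | _, _ => None
  end.

Definition lastd k := if isB k then 4 else 5.

(* A dart is a heptagon with a distinguished edge: [r] passes to the next edge of
   the heptagon and [t] to the same edge seen from the other side.  The relation
   [rt3] holds because three heptagons meet at each vertex. *)
Section Action.
Variables (X : Type) (r t : X -> X).
Hypothesis r7 : forall x, iter 7 r x = x.
Hypothesis tK : involutive t.
Hypothesis rt3 : forall x, t (r (t (r (t (r x))))) = x.

Definition mv d x := t (iter d r x).
(* The right neighbour in the same level; [b] tells whether [x] has two parents. *)
Definition rgt (b : bool) x := iter 6 r (t (iter (if b then 5 else 6) r x)).

Lemma r_inj : injective r.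
Proof. by move=> x y h; rewrite -(r7 x) -(r7 y) !iterSr h. Qed.

(** [iter 6 r] inverts [r], so this is the vertex relation [rt3] solved for one backward turn
    between two crossings. All the neighbour computations below reduce to it. *)
Lemma tr6t x : t (iter 6 r (t x)) = r (t (r x)).
Proof.
apply: (can_inj tK); rewrite tK; apply: r_inj.
by rewrite -iterS r7 -[in LHS](rt3 x) tK.
Qed.

Lemma tr5t x : t (iter 5 r (t x)) = r (t (r (r (t (r x))))).
Proof.
have -> : iter 5 r (t x) = iter 6 r (iter 6 r (t x)).
  by rewrite -iterD (iterD 5 7) r7.
by rewrite -{1}(tK (iter 6 r (t x))) !tr6t.
Qed.

Lemma rgt_mv3 a : rgt false (mv 3 a) = mv 4 a.
Proof. by rewrite /rgt /mv tr6t -iterSr r7 -iterS. Qed.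

Lemma rgt_mv4 a : rgt false (mv 4 a) = mv 5 a.
Proof. by rewrite /rgt /mv tr6t -iterSr r7 -iterS. Qed.

Lemma iter3_iter6 x : iter 3 r (iter 6 r x) = r (r x).
Proof. by rewrite -iterD (iterD 2 7) r7. Qed.

(** At the end of a family the level continues with the first child of the parent's right neighbour.
    The child in between is shared by the two parents, so two vertices are passed and [tr5t]
    replaces [tr6t]. *)
Lemma rgt_mv5 a : rgt true (mv 5 a) = mv 3 (rgt false a).
Proof. by rewrite /rgt /mv tr5t -iterSr r7 iter3_iter6 -iterS. Qed.

Lemma rgt_mv4B a : rgt true (mv 4 a) = mv 3 (rgt true a).
Proof. by rewrite /rgt /mv tr5t -iterSr r7 iter3_iter6 -iterS. Qed.

(* The second parent of a node with two parents is reached through edge 6. *)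
Lemma second_parent b a : t (iter 6 r (mv (if b then 4 else 5) a)) = r (r (rgt b a)).
Proof. by rewrite /mv tr6t /rgt -!iterS (iterD 1 7) r7; case: b. Qed.

Lemma rgt_left b a : t (r (rgt b a)) = iter (if b then 5 else 6) r a.
Proof. by rewrite /rgt -iterS r7 tK. Qed.

Section Sector.
Variable a0 : X.

Inductive node : nat -> X -> kind -> Prop :=
| node1L : node 1 a0 KL
| node1R : node 1 (rgt false a0) KR
| nodeS n a k d k' : node n a k -> child n k d = Some k' -> node n.+1 (mv d a) k'.

(** Adjacency in a level is defined along the tree, so that the kinds of both neighbours come with
    it; [nxt_rgt] identifies it with the geometric neighbour [rgt]. *)
Inductive nxt : nat -> X -> kind -> X -> kind -> Prop :=
| nxt1 : nxt 1 a0 KL (rgt false a0) KR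
| nxt_in n a k d k1 k2 : node n a k -> child n k d = Some k1 ->
    child n k d.+1 = Some k2 -> nxt n.+1 (mv d a) k1 (mv d.+1 a) k2
| nxt_across n a k b k' k1 k2 : nxt n a k b k' ->
    child n k (lastd k) = Some k1 -> child n k' 3 = Some k2 ->
    nxt n.+1 (mv (lastd k) a) k1 (mv 3 b) k2.

Lemma node_level n a k : node n a k -> 0 < n.
Proof. by elim. Qed.

Lemma node1 a k : node 1 a k -> (a = a0 /\ k = KL) \/ (a = rgt false a0 /\ k = KR).
Proof.
move=> h; inversion h as [| |n a' k' d k'' h1]; [by left|by right|].
by have := node_level h1.
Qed.

Lemma nodeS_inv n b k' : 0 < n -> node n.+1 b k' ->
  exists a k d, [/\ node n a k, child n k d = Some k' & b = mv d a].
Proof.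
move=> n0 h; inversion h; subst => //.
by exists a, k, d.
Qed.

Lemma nxt_node n a k b k' : nxt n a k b k' -> node n a k /\ node n b k'.
Proof.
elim=> [|{}n {}a {}k d k1 k2 h h1 h2|{}n {}a {}k {}b {}k' k1 k2 _ [h h'] h1 h2].
- by split; [exact: node1L|exact: node1R].
- by split; apply: nodeS; eassumption.
- by split; apply: nodeS; eassumption.
Qed.

Lemma child_d n k d k' : child n k d = Some k' -> 3 <= d <= lastd k.
Proof. by case: k => [||x|x|x]; case: d => [|[|[|[|[|[|d]]]]]]. Qed.

Lemma child_isB n k d k1 k2 : child n k d = Some k1 -> child n k d.+1 = Some k2 ->
  isB k1 = false /\ d <> 5.
Proof. by case: k => [||x|x|x]; case: d => [|[|[|[|[|[|d]]]]]] //= [<-]. Qed.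

Lemma lastd_isB n k k' : child n k (lastd k) = Some k' -> isB k' = true.
Proof. by case: k => [||x|x|x] //= [<-]. Qed.

Lemma nxt_rgt n a k b k' : nxt n a k b k' -> b = rgt (isB k) a.
Proof.
elim=> [//|{}n {}a {}k d k1 k2 h h1 h2|{}n {}a {}k {}b {}k' k1 k2 _ -> h1 h2].
  have [-> d5] := child_isB h1 h2; have := child_d h2; have := child_d h1.
  have [->|->] : d = 3 \/ d = 4; last by rewrite rgt_mv4.
    by move: d5 (child_d h1); rewrite /lastd; case: isB; lia.
  by rewrite rgt_mv3.
rewrite (lastd_isB h1) /lastd; case: (isB k); first by rewrite rgt_mv4B.
by rewrite rgt_mv5.
Qed.

Lemma nxt_not n a k b k' : nxt n a k b k' -> k <> KR /\ k' <> KL.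
Proof.
elim=> [//|{}n {}a {}k d k1 k2 h h1 h2|{}n {}a {}k {}b {}k' k1 k2 _ [hR hL] h1 h2].
  by move: h1 h2; case: k h => [||x|x|x] h; case: d => [|[|[|[|[|[|d]]]]]] //= [<-] [<-].
by move: h1 h2; case: k hR => [||x|x|x] // hR; case: k' hL => [||y|y|y] //= hL [<-] [<-].
Qed.

Lemma nxt_idx n a k b k' : nxt n a k b k' -> idx n k' = (idx n k + iscol k' :> int)%R.
Proof.
elim=> [//|{}n {}a {}k d k1 k2 h h1 h2|{}n {}a {}k {}b {}k' k1 k2 hn e h1 h2].
  move: h1 h2; case: k h => [||x|x|x] h; case: d => [|[|[|[|[|[|d]]]]]] //= [<-] [<-] /=; lia.
have [hR hL] := nxt_not hn.
clear hn; move: h1 h2 e; case: k hR => [||x|x|x] // hR; case: k' hL => [||y|y|y] //= hL [<-] [<-] /=; lia.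
Qed.

Lemma succ_node n a k : node n a k -> k = KR \/ exists b k', nxt n a k b k'.
Proof.
elim=> [||{}n {}a {}k d k' h IH hc].
- by right; exists (rgt false a0), KR; exact: nxt1.
- by left.
have [e|[k2 hk2]] : child n k d.+1 = None \/ exists k2, child n k d.+1 = Some k2.
  by case: (child n k d.+1) => [k2|]; [right; exists k2|left].
  case: IH => [kR|[b [k'' hn]]].
    by left; move: hc e; rewrite kR; case: d => [|[|[|[|[|[|d]]]]]] //= [<-].
  right; have [hR hL] := nxt_not hn.
  have dE : d = lastd k.
    by move: hc e; case: (k) hR => [||x|x|x] // _; case: d => [|[|[|[|[|[|d]]]]]].
  have [k2 hk2] : exists k2, child n k'' 3 = Some k2 by case: k'' {hn hL} => [||x|x|x]; eexists.
  exists (mv 3 b), k2; rewrite dE; apply: nxt_across hn _ hk2.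
  by rewrite -dE.
by right; exists (mv d.+1 a), k2; apply: nxt_in h hc hk2.
Qed.

Lemma pred_node n b k' : node n b k' -> k' = KL \/ exists a k, nxt n a k b k'.
Proof.
elim=> [||{}n {}b {}k' d k2 h IH hc].
- by left.
- by right; exists a0, KL; exact: nxt1.
have d3 := child_d hc; case: d hc d3 => [//|d] hc d3.
have [e|[k1 hk1]] : child n k' d = None \/ exists k1, child n k' d = Some k1.
  by case: (child n k' d) => [k1|]; [right; exists k1|left].
  have d2 : d = 2.
    by move: hc e; case: (k') => [||x|x|x]; case: (d) => [|[|[|[|[|[|d']]]]]].
  rewrite d2 in hc *; case: IH => [kL|[a [k hn]]].
    by left; move: hc; rewrite kL => -[<-].
  right; have [hR hL] := nxt_not hn.
  have [k1 hk1] : exists k1, child n k (lastd k) = Some k1.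
    by case: (k) hR => [||x|x|x] // _; eexists.
  by exists (mv (lastd k) a), k1; apply: nxt_across hn hk1 hc.
by right; exists (mv d b), k1; apply: nxt_in h hk1 hc.
Qed.

(** In the induction on [n], [P] is replaced by the predicate that all children satisfy [P]: a sweep
    of one level becomes a sweep of the level above. *)
Lemma level_ind n (P : X -> kind -> Prop) :
  (forall a, node n a KL -> P a KL) ->
  (forall a k b k', nxt n a k b k' -> P a k -> P b k') ->
  forall a k, node n a k -> P a k.
Proof.
case: n => [|n]; first by move=> _ _ a k /node_level.
elim: n P => [|n IH] P P0 PS a k h.
  case: (node1 h) => -[-> ->]; first exact: P0 node1L.
  exact: PS nxt1 (P0 _ node1L).
have [p [kp [d [h1 hc ->]]]] := nodeS_inv (ltn0Sn n) h.
have inner b k0 : node n.+1 b k0 ->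
    (forall k1, child n.+1 k0 3 = Some k1 -> P (mv 3 b) k1) ->
    forall d k1, child n.+1 k0 d = Some k1 -> P (mv d b) k1.
  move=> hb h3 d0; elim: d0 => [|d0 IHd] k1 hk1; first by have := child_d hk1.
  have [d2|d2] := eqVneq d0 2; first by rewrite d2 in hk1 *; exact: h3.
  have [k2 hk2] : exists k2, child n.+1 k0 d0 = Some k2.
    by move: hk1 d2; case: (k0) => [||x|x|x]; case: (d0) => [|[|[|[|[|[|d']]]]]] // _ _; eexists.
  by apply: PS (nxt_in hb hk2 hk1) (IHd _ hk2).
apply: (IH (fun a k => forall d k', child n.+1 k d = Some k' -> P (mv d a) k') _ _ _ _ h1) (hc).
  move=> b hb; apply: inner => // k1 [<-].
  by apply: P0; apply: nodeS hb _.
move=> b k0 b' k0' hn Pb; have [hb hb'] := nxt_node hn; have [hR hL] := nxt_not hn.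
apply: inner => // k1 hk1.
have [k2 hk2] : exists k2, child n.+1 k0 (lastd k0) = Some k2.
  by case: (k0) hR => [||x|x|x] // _; eexists.
exact: PS (nxt_across hn hk2 hk1) (Pb _ _ hk2).
Qed.

Lemma level_ind_rev n (P : X -> kind -> Prop) :
  (forall a, node n a KR -> P a KR) ->
  (forall a k b k', nxt n a k b k' -> P b k' -> P a k) ->
  forall a k, node n a k -> P a k.
Proof.
case: n => [|n]; first by move=> _ _ a k /node_level.
elim: n P => [|n IH] P P0 PS a k h.
  case: (node1 h) => -[-> ->]; last exact: P0 node1R.
  exact: PS nxt1 (P0 _ node1R).
have [p [kp [d [h1 hc ->]]]] := nodeS_inv (ltn0Sn n) h.
have inner b k0 : node n.+1 b k0 ->
    (forall d k1, child n.+1 k0 d = Some k1 -> child n.+1 k0 d.+1 = None -> P (mv d b) k1) ->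
    forall d k1, child n.+1 k0 d = Some k1 -> P (mv d b) k1.
  move=> hb hlast d0 k1; elim: {d0}(5 - d0) {-2}d0 (erefl (5 - d0)) k1 => [|m IHm] d0 e k1 hk1.
    apply: (hlast _ _ hk1); have := child_d hk1; have : lastd k0 <= 5 by rewrite /lastd; case: isB.
    by move=> h5 /andP[_ h5']; have -> : d0 = 5 by [lia]; case: (k0).
  case e2 : (child n.+1 k0 d0.+1) => [k2|]; last exact: hlast hk1 e2.
  by apply: PS (nxt_in hb hk1 e2) (IHm _ _ _ e2); lia.
apply: (IH (fun a k => forall d k', child n.+1 k d = Some k' -> P (mv d a) k') _ _ _ _ h1) (hc).
  move=> b hb; apply: inner => // d0 k1 hk1 e.
  have hkR : k1 = KR by move: hk1 e; case: d0 => [|[|[|[|[|[|d']]]]]] //= [<-].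
  by rewrite hkR in hk1 *; apply: P0; apply: nodeS hb hk1.
move=> b k0 b' k0' hn Pb; have [hb hb'] := nxt_node hn; have [hR hL] := nxt_not hn.
apply: inner => // d0 k1 hk1 e.
have d0E : d0 = lastd k0.
  by move: hk1 e; case: (k0) hR => [||x|x|x] // _; case: (d0) => [|[|[|[|[|[|d']]]]]].
have [k2 hk2] : exists k2, child n.+1 k0' 3 = Some k2.
  by case: (k0') => [||x|x|x]; eexists.
rewrite d0E in hk1 *; exact: PS (nxt_across hn hk1 hk2) (Pb _ _ hk2).
Qed.

End Sector.
End Action.

(** * The tiles *)

(** [LC] runs down the left border, [Ch] and [REnd] down the right one, and [Vc] carries a cell
    content down its column. [VW] and [VB] lead to fillers, [VL] to a second parent. [Hh u v]
    travels along a level and shows the contents of the nearest columns on both sides; [HR] replaces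
    it just before the right border. [Seam] joins the two heptagons of level 1. *)
Inductive colour (S : Type) :=
| Blank | LC | REnd | VW | VB | VL | Seam | HR
| Vc of S | Hh of option S & S | Ch of nat.
Arguments Blank {S}. Arguments LC {S}. Arguments REnd {S}. Arguments VW {S}.
Arguments VB {S}. Arguments VL {S}. Arguments Seam {S}. Arguments HR {S}.
Arguments Ch {S}.

Section Tiles.
Variables (S : Type) (f : option S -> S -> option S -> S) (ok : S -> bool).
Variables (bl : S) (init : nat -> S) (N : nat).
Local Notation colour := (colour S).

(** Next to the right border the content on the left is forgotten. The border tiles thus meet the
    single colour [HR], and there is one chain tile per letter rather than one per letter and cell
    content. *)
Definition Hc (u v : option S) : colour := if v is Some v' then Hh u v' else HR.

Inductive tileP : seq colour -> Prop :=
| TBlank : tileP [:: Blank; Blank; Blank; Blank; Blank; Blank; Blank]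
| TL g : tileP [:: LC; Blank; Blank; LC; Vc bl; VB; Hh None g]
| TL1 : tileP [:: Blank; Blank; Blank; LC; Vc bl; VB; Seam]
| TR1 : tileP [:: Blank; Seam; VL; Vc (init 0); Ch 0; Blank; Blank]
| TD j : j < N -> tileP [:: Ch j; HR; VL; Vc (init j.+1); Ch j.+1; Blank; Blank]
| TDN : tileP [:: Ch N; HR; VL; Vc bl; REnd; Blank; Blank]
| TRE : tileP [:: REnd; HR; VL; Vc bl; REnd; Blank; Blank]
| TC u s v : ok s ->
    tileP [:: Vc s; Hh u s; VL; Vc (f u s v); VW; VB; Hc (Some s) v]
| TW u v : tileP [:: VW; Hh u v; VL; VW; VW; VB; Hh u v]
| TB u v : tileP [:: VB; Hh u v; VL; VW; VB; Hh u v; VL].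

Hypothesis init_bl : forall j, N < j -> init j = bl.

Variable st : nat -> int -> S.

(* [st n x] is the content of the column [x] of level [n]; the two border columns
   show no state to their neighbours. *)
Definition est n (x : int) : option S :=
  if (x == - n%:Z)%R || (x == n%:Z - 1)%R then None else Some (st n x).

Definition hh n (x : int) : colour :=
  if n == 1 then Seam else Hc (est n x) (est n (x + 1)%R).

Definition rchain j : colour := if j <= N then Ch j else REnd.

(* The colours of a heptagon of kind [k] in level [n]. *)
Definition tc n (k : kind) : seq colour :=
  match k with
  | KL => [:: if n == 1 then Blank else LC; Blank; Blank; LC; Vc bl; VB; hh n (- n%:Z)%R]
  | KR => [:: if n == 1 then Blank else rchain n.-2; hh n (n%:Z - 2)%R; VL; Vc (init n.-1);
              rchain n.-1; Blank; Blank]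
  | KC x => [:: Vc (st n x); hh n (x - 1)%R; VL; Vc (st n.+1 x); VW; VB; hh n x]
  | KW x => [:: VW; hh n x; VL; VW; VW; VB; hh n x]
  | KB x => [:: VB; hh n x; VL; VW; VB; hh n x; VL]
  end.

Hypothesis st_right : forall n, st n.+2 n%:Z = init n.
Hypothesis st_left : forall n, st n.+2 (- (n.+1)%:Z)%R = bl.
Hypothesis st_step : forall n (x : int), (- n.+2%:Z < x < n.+1%:Z)%R ->
  st n.+3 x = f (est n.+2 (x - 1)%R) (st n.+2 x) (est n.+2 (x + 1)%R).

(** * A seed forces the colours of its whole tree *)

Section Forced.
Variables (X : Type) (r t : X -> X).
Hypothesis r7 : forall x, iter 7 r x = x.
Hypothesis tK : involutive t.
Hypothesis rt3 : forall x, t (r (t (r (t (r x))))) = x.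
Variable col : X -> colour.
Hypothesis col_t : forall x, col (t x) = col x.
Hypothesis col_tile : forall x, exists l e, [/\ tileP l, e < 7 &
  forall i, i < 7 -> col (iter i r x) = nth Blank l ((i + e) %% 7)].
Variable a0 : X.
Hypothesis seed : forall i, i < 7 ->
  col (iter i r a0) = nth Blank [:: Blank; Blank; Blank; LC; Vc bl; VB; Seam] i.

Definition shows (x : X) (l : seq colour) := forall i, i < 7 -> col (iter i r x) = nth Blank l i.

Lemma pair_tile x : exists l e, [/\ tileP l, e < 7, col x = nth Blank l e,
  col (r x) = nth Blank l (e.+1 %% 7) &
  forall i, i < 7 -> col (iter i r x) = nth Blank l ((i + e) %% 7)].
Proof.
have [l [e [tl e7 h]]] := col_tile x; exists l, e; split=> //.
  by rewrite (h 0)// modn_small.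
by rewrite (h 1).
Qed.

(* Rotating so that position [e] of the tile comes first at [x]. *)
Lemma shows_rot x l e : e < 7 ->
  (forall i, i < 7 -> col (iter i r x) = nth Blank l ((i + e) %% 7)) ->
  shows (iter (7 - e) r x) l.
Proof.
move=> e7 h i i7; rewrite -iterD.
have -> : iter (i + (7 - e)) r x = iter ((i + (7 - e)) %% 7) r x.
  have [lt|ge] := ltnP (i + (7 - e)) 7; first by rewrite modn_small.
  rewrite -{1}(subnK ge) iterD r7 -[in RHS](subnK ge) modnDr modn_small//; lia.
rewrite h ?ltn_mod//; congr nth.
by rewrite modnDml -addnA subnK ?(ltnW e7)// modnDr modn_small.
Qed.

(** Since rotations are free, a tile is recognised by two consecutive colours. The lemmas below scan
    the tiles cyclically for one given pair, which occurs at a single place or nowhere. *)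
Lemma pair_cases x A B : col x = A -> col (r x) = B ->
  exists l e, [/\ tileP l, e < 7, A = nth Blank l e, B = nth Blank l (e.+1 %% 7) &
    shows (iter (7 - e) r x) l].
Proof.
move=> h1 h2; have [l [e [tl e7 c1 c2 h]]] := pair_tile x.
exists l, e; split=> //; [by rewrite -h1|by rewrite -h2|exact: shows_rot].
Qed.

Ltac pair_cases h1 h2 :=
  let e := fresh "e" in let c1 := fresh in let c2 := fresh in let hs := fresh in
  let e7 := fresh in
  destruct (pair_cases h1 h2) as [? [e [[] e7 c1 c2 hs]]];
  do 7 (try destruct e as [|e]); simpl in c1, c2, hs; try discriminate e7;
  try match type of c1 with context [Hc (Some _) ?w] => destruct w; simpl in c1 end;
  try match type of c2 with context [Hc (Some _) ?w] => destruct w; simpl in c2 end;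
  try discriminate c1; try discriminate c2; move: c1 c2 hs.

Lemma pair_VL_VB x : col x = VL -> col (r x) = VB ->
  exists u v, shows (r x) [:: VB; Hh u v; VL; VW; VB; Hh u v; VL].
Proof.
by move=> h1 h2; pair_cases h1 h2 => _ _ h; do 2 eexists; exact: h.
Qed.

Lemma pair_VW_Hc x u g : col x = VW -> col (r x) = Hc u g ->
  exists2 v, g = Some v & shows x [:: VW; Hh u v; VL; VW; VW; VB; Hh u v].
Proof.
by case: g => [v|] h1 h2; pair_cases h1 h2 => _ [-> ->] h; eexists; first by []; rewrite -(r7 x); exact: h.
Qed.

Lemma pair_Vc_Hc x s u g : col x = Vc s -> col (r x) = Hc u g ->
  [/\ g = Some s, ok s & exists w,
    shows x [:: Vc s; Hh u s; VL; Vc (f u s w); VW; VB; Hc (Some s) w]].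
Proof.
by case: g => [v|] h1 h2; pair_cases h1 h2 => [[->]] [-> ->] h; split=> //; eexists;
  rewrite -(r7 x); exact: h.
Qed.

(** A chain colour followed by a horizontal one occurs only at the top of a right border tile, and
    there the horizontal colour is [HR]. Past [N] the chain stays at [REnd], in accordance with
    [init_bl]. *)
Lemma pair_rchain_Hc x j u g : col x = rchain j -> col (r x) = Hc u g ->
  g = None /\ shows x [:: rchain j; HR; VL; Vc (init j.+1); rchain j.+1; Blank; Blank].
Proof.
move=> h1; case: g => [v|] h2.
  by exfalso; move: h1 h2; rewrite /rchain; case: ifP => _ h1 h2; pair_cases h1 h2.
split=> //; move: h1; rewrite /rchain; case: (ltngtP j N) => [jN|jN|->] h1.
- pair_cases h1 h2 => -[e] _ h; last by rewrite e ltnn in jN.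
  by rewrite e -(r7 x); exact: h.
- by rewrite init_bl 1?ltnW//; pair_cases h1 h2 => _ _ h; rewrite -(r7 x); exact: h.
- rewrite init_bl//; pair_cases h1 h2 => c _ h; last by rewrite -(r7 x).
  by exfalso; case: c; lia.
Qed.

Lemma pair_Vc_Blank x s : col x = Vc s -> col (r x) = Blank -> False.
Proof. by move=> h1 h2; pair_cases h1 h2. Qed.

Lemma pair_Blank_VB x : col x = Blank -> col (r x) = VB -> False.
Proof. by move=> h1 h2; pair_cases h1 h2. Qed.

Lemma tile_with x A : col x = A ->
  exists l e, [/\ tileP l, e < 7, A = nth Blank l e & shows (iter (7 - e) r x) l].
Proof.
move=> h1; have [l [e [tl e7 h]]] := col_tile x.
by exists l, e; split=> //; [rewrite -h1 (h 0)// modn_small|exact: shows_rot].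
Qed.

Ltac tile_with_cases h1 :=
  let e := fresh "e" in let c1 := fresh in let hs := fresh in let e7 := fresh in
  destruct (tile_with h1) as [? [e [[] e7 c1 hs]]];
  do 7 (try destruct e as [|e]); simpl in c1, hs; try discriminate e7;
  try match type of c1 with context [Hc (Some _) ?w] => destruct w; simpl in c1 end;
  try discriminate c1; move: c1 hs.

(* Around the vertex shared by [x] and [t x], the third tile sees consecutively
   the edge following [t x] and the edge preceding [x]. *)
Lemma third_tile x A B : col (r (t x)) = A -> col (iter 6 r x) = B ->
  exists z, col z = A /\ col (r z) = B.
Proof.
move=> h1 h2; exists (t (r (t x))); split; first by rewrite col_t.
have := tr6t r7 tK rt3 (t x); rewrite tK => <-.
by rewrite col_t.
Qed.

(** [LC] also occurs at position 3, of a left tile or of a seed. With that rotation, the third tile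
    at the vertex would show some [Vc] followed by [Blank], which no tile does. *)
Lemma border_left x : col x = LC -> col (iter 6 r x) = Blank ->
  exists g, shows (t x) [:: LC; Blank; Blank; LC; Vc bl; VB; Hh None g].
Proof.
move=> h1 h2; have h3 : col (t x) = LC by rewrite col_t.
have no s : col (r (t x)) <> Vc s.
  by move=> /third_tile/(_ h2)[z [z1 z2]]; exact: pair_Vc_Blank z1 z2.
tile_with_cases h3 => _ h.
- by exists g; rewrite -(r7 (t x)); exact: h.
- by case: (no bl); rewrite -(r7 (t x)); exact: (h 4 isT).
- by case: (no bl); rewrite -(r7 (t x)); exact: (h 4 isT).
Qed.

(** The alternative is a second seed glued to the first along its seam by a half-turn; the third
    tile at the vertex would then show [Blank] followed by [VB]. *)
Lemma seam_right x : col x = Seam -> col (iter 6 r x) = VB ->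
  shows (iter 6 r (t x)) [:: Blank; Seam; VL; Vc (init 0); Ch 0; Blank; Blank].
Proof.
move=> h1 h2; have h3 : col (t x) = Seam by rewrite col_t.
have no : col (r (t x)) <> Blank.
  by move=> /third_tile/(_ h2)[z [z1 z2]]; exact: pair_Blank_VB z1 z2.
tile_with_cases h3 => _ h; last exact: h.
by case: no; exact: (h 0 isT).
Qed.

(* As [tc], as long as the content [g] of the next column is not known. *)
Definition tcg n k (g : option S) : seq colour :=
  match k with
  | KL => [:: LC; Blank; Blank; LC; Vc bl; VB; Hc None g]
  | KR => tc n KR
  | KC x => [:: Vc (st n x); hh n (x - 1)%R; VL; Vc (f (est n (x - 1)%R) (st n x) g);
                VW; VB; Hc (Some (st n x)) g]
  | KW x => [:: VW; Hc (est n x) g; VL; VW; VW; VB; Hc (est n x) g]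
  | KB x => [:: VB; Hc (est n x) g; VL; VW; VB; Hc (est n x) g; VL]
  end.

Definition rpos k := if isB k then 5 else 6.

Lemma Hc_inj u v v' : Hc u v = Hc u v' -> v = v'.
Proof. by case: v => [v|]; case: v' => [v'|] //= [->]. Qed.

Local Notation node := (node r t a0).
Local Notation nxt := (nxt r t a0).

Lemma node_range n a k : node n a k ->
  match k with
  | KC x => (- n%:Z < x < n%:Z - 1)%R
  | KW x | KB x => (- n%:Z < x < n%:Z - 2)%R
  | _ => True
  end.
Proof.
elim=> [//|//|{}n {}a {}k d k' h IH hc]; have n0 := node_level h.
by move: IH hc; case: k h => [||x|x|x] h IH; case: d => [|[|[|[|[|[|d]]]]]] //= [<-] //; lia.
Qed.

Lemma est_in n x : (- n%:Z < x < n%:Z - 1)%R -> est n x = Some (st n x).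
Proof. by rewrite /est; case: eqP => [->|_]; case: eqP => [->|_] //=; lia. Qed.

Definition vcol n k : colour :=
  match k with
  | KL => LC | KR => rchain n.-2 | KC x => Vc (st n x) | KW _ => VW | KB _ => VB
  end.

Lemma child_vcol n k d k' : 0 < n -> child n k d = Some k' ->
  nth Blank (tc n k) d = vcol n.+1 k'.
Proof.
case: n => // n _; case: k => [||x|x|x]; case: d => [|[|[|[|[|[|d]]]]]] //= [<-] //=.
- by rewrite st_left.
- by rewrite (_ : (n.+1%:Z - 1 = n%:Z)%R) ?st_right//; lia.
Qed.

Lemma child_col n a k d k' : 0 < n -> shows a (tc n k) -> child n k d = Some k' ->
  col (mv r t d a) = vcol n.+1 k'.
Proof.
move=> n0 h hc; rewrite /mv col_t -(child_vcol n0 hc) h//.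
have := child_d hc; have : lastd k <= 5 by rewrite /lastd; case: isB.
by lia.
Qed.

Lemma estL n : est n (- n%:Z)%R = None.
Proof. by rewrite /est eqxx. Qed.

Lemma estR n : est n (n%:Z - 1)%R = None.
Proof. by rewrite /est eqxx orbT. Qed.

Lemma hhE n x : hh n.+2 x = Hc (est n.+2 x) (est n.+2 (x + 1)%R).
Proof. by []. Qed.

Lemma tcg_right n a k g : node n a k -> k <> KR ->
  nth Blank (tcg n k g) (rpos k) = Hc (est n (idx n k)) g.
Proof.
move=> /node_range; case: k => [||x|x|x] //= h _; first by rewrite estL.
by rewrite est_in.
Qed.

Lemma tc_left n k : k <> KL -> nth Blank (tc n k) 1 = hh n (idx n k - (iscol k : int))%R.
Proof. by case: k => [||x|x|x] //= _; rewrite ?subr0 -?addrA. Qed.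

Lemma tcgE n a k : node n.+2 a k -> tcg n.+2 k (est n.+2 (idx n.+2 k + 1)%R) = tc n.+2 k.
Proof.
move=> /node_range; case: k => [||x|x|x] //= h; first by rewrite !hhE estL.
by rewrite !hhE (est_in h) st_step//; lia.
Qed.

Lemma nxt_col n a k b k' g : nxt n a k b k' -> shows a (tcg n k g) ->
  col (r b) = Hc (est n (idx n k)) g.
Proof.
move=> hn ha; have [na _] := nxt_node hn; have [kR _] := nxt_not hn.
rewrite -(tcg_right g na kR) -col_t (nxt_rgt r7 tK rt3 hn) (rgt_left r7 tK).
by rewrite /rpos; case: (isB k); exact: ha.
Qed.

(** The sweep from left to right: edge 0 is known from the level above and edge 1 from the left
    neighbour, which fixes the tile and its rotation. Only the content of the next column on the
    right remains open, hence [g]. *)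
Lemma forced_step n : (forall a k, node n.+1 a k -> shows a (tc n.+1 k)) ->
  forall b k, node n.+2 b k -> exists g, shows b (tcg n.+2 k g).
Proof.
move=> IH; apply: (level_ind (P := fun b k => exists g, shows b (tcg n.+2 k g))).
  move=> b /(nodeS_inv (ltn0Sn n))[p [kp [d [np hc ->]]]].
  have [{}hc dE] : kp = KL /\ d = 3.
    by move: hc; case: (kp) => [||x|x|x]; case: d => [|[|[|[|[|[|d]]]]]].
  have h := IH _ _ np; rewrite hc in h.
  have [|g hg] := @border_left (iter 3 r p) (h 3 isT); last first.
    by exists (Some g); rewrite dE; exact: hg.
  by rewrite -iterD (iterD 2 7) r7; exact: (h 2 isT).
move=> a k b k' hn [g ha]; have [_ nb] := nxt_node hn; have [_ kL] := nxt_not hn.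
have hl := nxt_col hn ha; have hi := nxt_idx hn.
have [p [kp [d [np hc bE]]]] := nodeS_inv (ltn0Sn n) nb.
have hp := IH _ _ np.
have hb : col b = vcol n.+2 k' by rewrite bE (child_col _ hp hc).
move: (idx n.+2 k) hi hl => e hi hl; have rg := node_range nb.
case: k' => [||x|x|x] // in hn nb kL hi hc hb rg *.
- have [_ h] := pair_rchain_Hc hb hl; exists None.
  by rewrite /= hhE (_ : (n.+2%:Z - 2 + 1 = n.+2%:Z - 1)%R) ?estR//; lia.
- have [_ _ [w h]] := pair_Vc_Hc hb hl; exists w.
  have eE : e = (x - 1)%R by rewrite /= in hi; lia.
  by rewrite /= hhE subrK (est_in rg) -eE.
- have [v gE h] := pair_VW_Hc hb hl; exists (Some v).
  by rewrite /= (_ : x = e)//; rewrite /= in hi; lia.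
- have xe : x = e by rewrite /= in hi; lia.
  have [kpR|[q [kq hq]]] := succ_node np.
    by move: hc; rewrite kpR; case: d {bE} => [|[|[|[|[|[|d]]]]]].
  have [_ nq] := nxt_node hq; have [_ kqL] := nxt_not hq.
  have dE : d = if isB kp then 4 else 5.
    by move: hc; case: (kp) => [||y|y|y]; case: d {bE} => [|[|[|[|[|[|d]]]]]].
  (* [VB] followed by a horizontal colour occurs at several positions, even twice in the same tile.
     The edge to the second parent removes the ambiguity: [VL] followed by [VB] occurs only once. *)
  have h6 : col (iter 6 r b) = VL.
    rewrite -col_t bE dE (second_parent r7 tK rt3) -(nxt_rgt r7 tK rt3 hq).
    have := IH _ _ nq 2 isT; rewrite /= => ->.
    by case: (kq) kqL.
  have [u [v h]] := pair_VL_VB h6 (etrans (congr1 col (r7 b)) hb).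
  have hb' : shows b [:: VB; Hh u v; VL; VW; VB; Hh u v; VL] by rewrite -(r7 b); exact: h.
  have := hb' 1 isT; rewrite /= hl; case: (g) => [v'|] // [eu ev].
  by exists (Some v'); rewrite /= xe eu ev.
Qed.

(** A second sweep, from right to left, closes what [forced_step] leaves open: edge 1 of a known
    node reveals the [g] of its left neighbour. It starts at the right border, where [tcg] does not
    depend on [g]. *)
Theorem forced n a k : node n a k -> shows a (tc n k).
Proof.
case: n => [|n]; first by move=> h; have := node_level h.
elim: n a k => [|n IH] a k.
  move=> h; have [[-> ->]|[-> ->]] := node1 h; first by move=> i i7; rewrite seed.
  have h6 : col (iter 6 r (iter 6 r a0)) = VB.
    by rewrite -iterD (iterD 5 7) r7; exact: (seed (isT : 5 < 7)).
  exact: seam_right (seed (isT : 6 < 7)) h6.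
apply: (level_ind_rev (P := fun (a : X) (k : kind) => shows a (tc n.+2 k))) a k => [b|a k b k' hn hb].
  by move=> /(forced_step IH)[g].
have [na nb] := nxt_node hn; have [_ kL] := nxt_not hn.
have [g ha] := forced_step IH na.
have := nxt_col hn ha; have := hb 1 isT; rewrite /= (tc_left _ kL) (nxt_idx hn).
rewrite addrK hhE => -> /Hc_inj gE.
by rewrite -(tcgE na) gE.
Qed.

Lemma forced_ok n a x : node n.+2 a (KC x) -> ok (st n.+2 x).
Proof.
move=> na; have h := forced na; have rg := node_range na.
by have [_ //] := @pair_Vc_Hc a _ _ _ (h 0 isT) (h 1 isT).
Qed.

Lemma column_node n (x : int) : (- n.+2%:Z < x < n.+1%:Z)%R -> exists a, node n.+2 a (KC x).
Proof.
elim: n x => [|n IH] x hx; last first.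
  have [h|[h|h]] : (- n.+2%:Z < x < n.+1%:Z)%R \/ x = (- n.+2%:Z)%R \/ x = (n.+1%:Z)%R by lia.
  - by have [a ha] := IH _ h; exists (mv r t 3 a); apply: nodeS ha _.
  - have [a ha] : exists a, node n.+2 a KL.
      elim: (n.+1) => [|m [a ha]]; first by exists a0; exact: node1L.
      by exists (mv r t 3 a); apply: nodeS ha _.
    by exists (mv r t 4 a); apply: nodeS ha _; rewrite /= h.
  - have [a ha] : exists a, node n.+2 a KR.
      elim: (n.+1) => [|m [a ha]]; first by exists (rgt r t false a0); exact: node1R.
      by exists (mv r t 4 a); apply: nodeS ha _.
    by exists (mv r t 3 a); apply: nodeS ha _; rewrite /= h; congr (Some (KC _)); lia.
have [->|->] : x = (-1)%R \/ x = 0%R by lia.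
- by exists (mv r t 4 a0); apply: nodeS (node1L r t a0) _.
- by exists (mv r t 3 (rgt r t false a0)); apply: nodeS (node1R r t a0) _.
Qed.

Theorem forced_all_ok n (x : int) : (- n.+2%:Z < x < n.+1%:Z)%R -> ok (st n.+2 x).
Proof. by move=> /column_node[a]; exact: forced_ok. Qed.

End Forced.

(** * Disjoint trees on a blank background satisfy the matching rules *)

Section Colouring.
Variables (X : Type) (r t : X -> X).
Hypothesis r7 : forall x, iter 7 r x = x.
Hypothesis tK : involutive t.
Hypothesis rt3 : forall x, t (r (t (r (t (r x))))) = x.
Variable seeds : nat -> X.
Hypothesis node_inj : forall i i' n n' a a' k k' e e',
  node r t (seeds i) n a k -> node r t (seeds i') n' a' k' -> e < 7 -> e' < 7 ->
  iter e r a = iter e' r a' -> [/\ n = n', k = k' & e = e'].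
Hypothesis ok_st : forall n (x : int), (- n.+2%:Z < x < n.+1%:Z)%R -> ok (st n.+2 x).

Definition at_node x n k e :=
  exists i a, [/\ node r t (seeds i) n a k, e < 7 & x = iter e r a].

Definition colouring x : colour :=
  if pselect (exists nke : nat * kind * nat, at_node x nke.1.1 nke.1.2 nke.2) is left h
  then nth Blank (tc (projT1 (cid h)).1.1 (projT1 (cid h)).1.2) (projT1 (cid h)).2
  else Blank.

Lemma colouring_at x n k e : at_node x n k e -> colouring x = nth Blank (tc n k) e.
Proof.
move=> hx; rewrite /colouring; case: pselect => [h|[]]; last by exists (n, k, e).
case: (cid h) => -[[n' k'] e'] /= [i [a [na e7 xa]]].
have [i' [a' [na' e7' xa']]] := hx.
by have [<- <- <-] := node_inj na na' e7 e7' (etrans (esym xa) xa').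
Qed.

Lemma colouring_out x : (forall n k e, ~ at_node x n k e) -> colouring x = Blank.
Proof.
move=> hx; rewrite /colouring; case: pselect => [[[[n k] e] h]|//].
by case: (hx n k e).
Qed.

Lemma at_node_child x n a k d k' i : node r t (seeds i) n a k -> child n k d = Some k' ->
  x = mv r t d a -> at_node x n.+1 k' 0.
Proof. by move=> na hc ->; exists i, (mv r t d a); split=> //; apply: nodeS na hc. Qed.

Lemma right_colour n i a k b k' : nxt r t (seeds i) n a k b k' ->
  nth Blank (tc n k) (rpos k) = nth Blank (tc n k') 1.
Proof.
move=> hn; have [kR kL] := nxt_not hn; rewrite (tc_left _ kL) (nxt_idx hn) addrK.
by case: (k) kR => [||?|?|?].
Qed.

Lemma colour_child n i a k d k' : node r t (seeds i) n a k -> child n k d = Some k' ->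
  nth Blank (tc n k) d = nth Blank (tc n.+1 k') 0.
Proof.
move=> na hc; have n0 := node_level na; rewrite (child_vcol n0 hc).
by case: n n0 {na hc} => // n _; case: k'.
Qed.

(** Blank edges are excluded because they may lead out of the tree. Every other edge leads to a
    child, a parent, a neighbour in the level, or links a second parent with the shared child. *)
Lemma at_node_t x n k e : at_node x n k e -> nth Blank (tc n k) e <> Blank ->
  exists n' k' e', at_node (t x) n' k' e' /\ nth Blank (tc n' k') e' = nth Blank (tc n k) e.
Proof.
move=> [i [a [na e7 ->]]] nB; have n0 := node_level na.
have child_edge d k' : child n k d = Some k' -> e = d ->
    exists n' k' e', at_node (t (iter e r a)) n' k' e' /\
      nth Blank (tc n' k') e' = nth Blank (tc n k) e.
  move=> hc ed; exists n.+1, k', 0; split; last by rewrite ed (colour_child na hc).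
  by apply: (at_node_child na hc); rewrite ed.
have right_edge : k <> KR -> e = rpos k ->
    exists n' k' e', at_node (t (iter e r a)) n' k' e' /\
      nth Blank (tc n' k') e' = nth Blank (tc n k) e.
  move=> kR ek; have [//|[b [k' hn]]] := succ_node na; have [_ nb] := nxt_node hn.
  exists n, k', 1; rewrite -(right_colour hn) -ek; split=> //; exists i, b; split=> //.
  rewrite /= -[RHS]tK (nxt_rgt r7 tK rt3 hn) (rgt_left r7 tK) ek /rpos.
  by case: (isB k).
have left_edge : k <> KL -> e = 1 ->
    exists n' k' e', at_node (t (iter e r a)) n' k' e' /\
      nth Blank (tc n' k') e' = nth Blank (tc n k) e.
  move=> kL ->; have [//|[b [k' hn]]] := pred_node na; have [nb _] := nxt_node hn.
  exists n, k', (rpos k'); rewrite (right_colour hn); split=> //; exists i, b.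
  split=> //; first by rewrite /rpos; case: isB.
  rewrite /= (nxt_rgt r7 tK rt3 hn) (rgt_left r7 tK) /rpos.
  by case: (isB k').
have parent_edge : e = 0 ->
    exists n' k' e', at_node (t (iter e r a)) n' k' e' /\
      nth Blank (tc n' k') e' = nth Blank (tc n k) e.
  move=> e0; rewrite e0 in nB *.
  case: (n) na n0 nB {child_edge right_edge left_edge} => [|[|m]] na n0 nB //.
    by case: (node1 na) nB => -[_ ->].
  have [p [kp [d [np hc aE]]]] := nodeS_inv (ltn0Sn m) na.
  exists m.+1, kp, d; split; last by rewrite (colour_child np hc).
  exists i, p; split=> //; last by rewrite /= aE /mv tK.
  by have := child_d hc; rewrite /lastd; case: isB; lia.
have second_edge : k <> KL -> e = 2 ->
    exists n' k' e', at_node (t (iter e r a)) n' k' e' /\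
      nth Blank (tc n' k') e' = nth Blank (tc n k) e.
  move=> kL e2; have [//|[b [k' hn]]] := pred_node na; have [nb _] := nxt_node hn.
  have [kR' _] := nxt_not hn.
  have [k2 hk2] : exists k2, child n k' (lastd k') = Some k2.
    by case: (k') kR' => [||?|?|?] // _; eexists.
  exists n.+1, k2, 6; split; last first.
    by have := lastd_isB hk2; case: k2 hk2 => //= y _ _; rewrite e2; case: (k) kL.
  exists i, (mv r t (lastd k') b); split=> //; first exact: nodeS nb hk2.
  rewrite e2 /lastd -[RHS]tK (second_parent r7 tK rt3).
  by rewrite -(nxt_rgt r7 tK rt3 hn).
have sixth_edge y : k = KB y -> e = 6 ->
    exists n' k' e', at_node (t (iter e r a)) n' k' e' /\
      nth Blank (tc n' k') e' = nth Blank (tc n k) e.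
  move=> kB e6.
  case: (n) na n0 {nB child_edge right_edge left_edge second_edge parent_edge}
    => [|[|m]] na n0 //; first by have [[_]|[_]] := node1 na; rewrite kB.
  have [p [kp [d [np hc aE]]]] := nodeS_inv (ltn0Sn m) na.
  have dE : d = if isB kp then 4 else 5.
    by move: hc; rewrite kB; case: (kp) => [||z|z|z]; case: d {aE} => [|[|[|[|[|[|d]]]]]].
  have [kpR|[q [kq hq]]] := succ_node np.
    by move: hc; rewrite kpR kB; case: d {aE dE} => [|[|[|[|[|[|d]]]]]].
  have [_ nq] := nxt_node hq; have [_ kqL] := nxt_not hq.
  exists m.+1, kq, 2; split; last by rewrite kB e6 /=; case: (kq) kqL.
  exists i, q; split=> //; rewrite e6 aE dE (second_parent r7 tK rt3).
  by rewrite -(nxt_rgt r7 tK rt3 hq).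
clear na; case: k nB child_edge right_edge left_edge parent_edge second_edge sixth_edge
  => [||y|y|y] nB child_edge right_edge left_edge parent_edge second_edge sixth_edge;
  (do 7 (try destruct e as [|e])) => //.
all: try exact: (left_edge _ erefl).
all: try exact: (right_edge _ erefl).
all: try exact: (second_edge _ erefl).
all: try exact: (child_edge 3 _ erefl erefl).
all: try exact: (child_edge 4 _ erefl erefl).
all: try exact: (child_edge 5 _ erefl erefl).
all: try exact: (sixth_edge _ erefl erefl).
all: try exact: (parent_edge erefl).
Qed.

Lemma colouring_coloured x : colouring x <> Blank ->
  exists n k e, at_node x n k e /\ nth Blank (tc n k) e <> Blank.
Proof.
have [[[[n k] e] h]|no] := pselect (exists nke : nat * kind * nat, at_node x nke.1.1 nke.1.2 nke.2).
  by rewrite (colouring_at h) => nB; exists n, k, e.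
by rewrite colouring_out// => n k e h; apply: no; exists (n, k, e).
Qed.

(** [at_node_t] settles an edge as soon as one of its two sides is not blank, since [t] is
    involutive; otherwise both sides are blank. *)
Lemma colouring_t x : colouring (t x) = colouring x.
Proof.
have main y : colouring y <> Blank -> colouring (t y) = colouring y.
  move=> /colouring_coloured[n [k [e [hy nB]]]].
  have [n' [k' [e' [hy' e2]]]] := at_node_t hy nB.
  by rewrite (colouring_at hy) (colouring_at hy').
have [hx|/main//] := pselect (colouring x = Blank).
have [hy|hy] := pselect (colouring (t x) = Blank); first by rewrite hx.
by have := main _ hy; rewrite tK.
Qed.

Lemma iter_r_mod i x : iter (i %% 7) r x = iter i r x.
Proof.
rewrite {2}(divn_eq i 7) addnC iterD; congr (iter _ r _).
by elim: (i %/ 7) => [//|q IH]; rewrite mulSn iterD r7.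
Qed.

Lemma at_node_iter x n k e i : at_node x n k e -> at_node (iter i r x) n k ((i + e) %% 7).
Proof.
move=> [j [a [na e7 ->]]]; exists j, a; split=> //; first by rewrite ltn_mod.
by rewrite iter_r_mod iterD.
Qed.

Lemma tc_tile i n a k : node r t (seeds i) n a k -> tileP (tc n k).
Proof.
case: n => [|n] na; first by have := node_level na.
have rg := node_range na; case: n na rg => [|n] na.
  case: (node1 na) => -[_ ->] _; [exact: TL1|exact: TR1].
case: k na => [||x|x|x] na rg.
- rewrite /= hhE estL (@est_in n.+2 (- n.+2%:Z + 1)%R); last by lia.
  exact: TL.
- rewrite /= hhE (_ : (n.+2%:Z - 2 + 1 = n.+2%:Z - 1)%R); last by lia.
  rewrite estR /= /rchain; have [jN|jN|->] := ltngtP n N.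
  + exact: TD.
  + by rewrite init_bl; [exact: TRE|exact: ltnW].
  + by rewrite init_bl//; exact: TDN.
- have hx : (- n.+2%:Z < x < n.+1%:Z)%R by lia.
  by rewrite /tc !hhE st_step// subrK (est_in rg); exact: TC (ok_st hx).
- rewrite /= hhE (@est_in _ (x + 1)%R); last by lia.
  exact: TW.
- rewrite /= hhE (@est_in _ (x + 1)%R); last by lia.
  exact: TB.
Qed.

Lemma colouring_tile x : exists l e, [/\ tileP l, e < 7 &
  forall i, i < 7 -> colouring (iter i r x) = nth Blank l ((i + e) %% 7)].
Proof.
have [[[[n k] e] h]|no] := pselect (exists nke : nat * kind * nat, at_node x nke.1.1 nke.1.2 nke.2).
  have [j [a [na e7 _]]] := h; exists (tc n k), e; split=> //; first exact: tc_tile na.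
  by move=> i _; rewrite (colouring_at (at_node_iter i h)).
exists (nseq 7 Blank), 0; split=> //; first exact: TBlank.
move=> i i7; rewrite nth_nseq if_same colouring_out// => n k e h; apply: no.
exists (n, k, (7 - i + e) %% 7) => /=.
by have := at_node_iter (7 - i) h; rewrite -iterD subnK ?(ltnW i7)// r7.
Qed.

Lemma colouring_seed j i : i < 7 -> colouring (iter i r (seeds j)) =
  nth Blank [:: Blank; Blank; Blank; LC; Vc bl; VB; Seam] i.
Proof.
move=> i7; rewrite (@colouring_at _ 1 KL i)//.
by exists j, (seeds j); split=> //; exact: node1L.
Qed.

End Colouring.
End Tiles.

(** * A machine completing its input before running M *)

Section Absorb.
Variables (S : finType) (M : turing_machine S).

Lemma step_halted (c : config M) : (cstate c == accept M) || (cstate c == reject M) ->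
  step c = c.
Proof. by rewrite /step => ->. Qed.

Lemma iter_halted n (c : config M) : (cstate c == accept M) || (cstate c == reject M) ->
  iter n (@step S M) c = c.
Proof. by move=> h; elim: n => //= n ->; exact: step_halted. Qed.

Lemma accept_not_reject (c : config M) n m :
  cstate (iter n (@step S M) c) = accept M -> cstate (iter m (@step S M) c) = reject M -> False.
Proof.
have ne := accept_reject M; move=> ha hr.
have [nm|/ltnW mn] := leqP n m.
  move: hr; rewrite -(subnK nm) iterD iter_halted ha ?eqxx// => e.
  by rewrite e eqxx in ne.
move: ha; rewrite -(subnK mn) iterD iter_halted hr ?eqxx ?orbT// => e.
by rewrite e eqxx in ne.
Qed.
End Absorb.

(* The marks of the letters of the hard-wired word; a sweep turns [A] into [B],
   or [B] into [A], one letter at a time. *)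
Inductive mark := MU | MA | MB.

Definition mark_code m := match m with MU => None | MA => Some true | MB => Some false end.
Definition mark_decode o := match o with None => MU | Some true => MA | Some false => MB end.
Lemma mark_codeK : cancel mark_code mark_decode. Proof. by case. Qed.
HB.instance Definition _ := Finite.copy mark (can_type mark_codeK).

Inductive action := Tick of bool | Got of letter | Again | Fin.

Definition action_code a : bool + letter + bool :=
  match a with
  | Tick b => inl (inl b) | Got l => inl (inr l) | Again => inr true | Fin => inr false
  end.
Definition action_decode a :=
  match a with
  | inl (inl b) => Tick b | inl (inr l) => Got l | inr true => Again | inr false => Fin
  end.
Lemma action_codeK : cancel action_code action_decode. Proof. by case. Qed.
HB.instance Definition _ := Finite.copy action (can_type action_codeK).

Section Prep.
Variables (M : turing_machine letter) (bound : nat) (word : action -> seq letter).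
Hypothesis word_bound : forall a, size (word a) < bound.

Inductive psym := Plain of symbol M | Cell of letter & mark | Edge.

Definition psym_code s : symbol M + letter * mark + unit :=
  match s with Plain g => inl (inl g) | Cell l m => inl (inr (l, m)) | Edge => inr tt end.
Definition psym_decode s :=
  match s with inl (inl g) => Plain g | inl (inr (l, m)) => Cell l m | inr tt => Edge end.
Lemma psym_codeK : cancel psym_code psym_decode. Proof. by case. Qed.
HB.instance Definition _ := Finite.copy psym (can_type psym_codeK).

Inductive pstate :=
| Run of state M | Wait | Back of bool | Srch of bool | Carry of action
| Write of action & 'I_bound | Clean.

Definition pstate_code q : state M + bool + bool + bool + action + action * 'I_bound :=
  match q with
  | Run q => inl (inl (inl (inl (inl q))))
  | Wait => inl (inl (inl (inl (inr true))))
  | Clean => inl (inl (inl (inl (inr false))))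
  | Back b => inl (inl (inl (inr b)))
  | Srch b => inl (inl (inr b))
  | Carry a => inl (inr a)
  | Write a i => inr (a, i)
  end.
Definition pstate_decode q :=
  match q with
  | inl (inl (inl (inl (inl q)))) => Run q
  | inl (inl (inl (inl (inr true)))) => Wait
  | inl (inl (inl (inl (inr false)))) => Clean
  | inl (inl (inl (inr b))) => Back b
  | inl (inl (inr b)) => Srch b
  | inl (inr a) => Carry a
  | inr (a, i) => Write a i
  end.
Lemma pstate_codeK : cancel pstate_code pstate_decode. Proof. by case. Qed.
HB.instance Definition _ := Finite.copy pstate (can_type pstate_codeK).

Definition after a : pstate :=
  match a with Tick b => Back b | Got _ => Back true | Again => Back false | Fin => Clean end.

Definition pin l : psym := Plain (input M l).
Definition pblank : psym := Plain (blank M).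

Lemma bound_gt0 : 0 < bound.
Proof. exact: leq_ltn_trans (leq0n _) (word_bound Fin). Qed.

Definition at_pos (i : nat) : 'I_bound := insubd (Ordinal bound_gt0) i.

(* [Carry a] walks to the end of the tape, where [Write a] appends [word a].  A
   sweep appends two tallies for each letter marked so far, so that the round of
   the [j]-th letter writes the unary codes [2 * j] and [2 * j.+1]. *)
Definition pdelta (q : pstate) (s : psym) : pstate * psym * move :=
  match q, s with
  | Run q, Plain g => let: (q', g', d) := delta q g in (Run q', Plain g', d)
  | Run q, _ => (Run q, s, Stay)
  | Wait, _ => (Back false, s, Stay)
  | Back b, Edge => (Srch b, s, MoveRight)
  | Back b, _ => (Back b, s, MoveLeft)
  | Srch false, Cell l MB => (Srch false, s, MoveRight)
  | Srch false, Cell l MA => (Carry (Tick false), Cell l MB, MoveRight)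
  | Srch false, Cell l MU => (Carry (Got l), Cell l MB, MoveRight)
  | Srch false, _ => (Carry Fin, s, Stay)
  | Srch true, Cell l MA => (Srch true, s, MoveRight)
  | Srch true, Cell l MB => (Carry (Tick true), Cell l MA, MoveRight)
  | Srch true, _ => (Carry Again, s, Stay)
  | Carry a, Plain g => if g == blank M then (Write a (at_pos 0), s, Stay)
                        else (Carry a, s, MoveRight)
  | Carry a, _ => (Carry a, s, MoveRight)
  | Write a i, _ =>
      if i < size (word a) then (Write a (at_pos i.+1), pin (nth tally (word a) i), MoveRight)
      else (after a, s, Stay)
  | Clean, Cell l _ => (Clean, pin l, MoveLeft)
  | Clean, Edge => (Run (start M), pblank, MoveRight)
  | Clean, _ => (Clean, s, MoveLeft)
  end.

Lemma pin_inj : injective pin.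
Proof. by move=> l l' [/input_inj]. Qed.

Lemma pin_blank l : pin l != pblank.
Proof. by apply/eqP => -[e]; have := input_blank M l; rewrite e eqxx. Qed.

Lemma run_accept_reject : Run (accept M) != Run (reject M).
Proof. by apply/eqP => -[e]; have := accept_reject M; rewrite e eqxx. Qed.

Definition prep_machine : turing_machine letter :=
  @TuringMachine letter pstate psym pblank pin Wait (Run (accept M)) (Run (reject M))
    pdelta pin_inj pin_blank run_accept_reject.
Local Notation P := prep_machine.
Local Notation stepP := (@step letter P).

(** The head is on the first symbol of [v], or on the blank that follows [u] if [v] is empty.
    Everything left of cell 0 is blank: the walks to the left stop at the [Edge] kept in cell 0. *)
Definition lconf (q : pstate) (u v : seq psym) : config P :=
  @Config letter P q (fun i => if i is Posz k then nth pblank (u ++ v) k else pblank)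
    (Posz (size u)).

Definition runs (c c' : config P) := exists n, iter n stepP c = c'.

Lemma runs0 c : runs c c. Proof. by exists 0. Qed.

Lemma runs1 c c' : stepP c = c' -> runs c c'. Proof. by exists 1. Qed.

Lemma runs_trans c2 c1 c3 : runs c1 c2 -> runs c2 c3 -> runs c1 c3.
Proof. by move=> [n <-] [m <-]; exists (m + n); rewrite iterD. Qed.

Definition running (q : pstate) := if q is Run _ then false else true.

Lemma tape_set (u v : seq psym) s' i :
  (if i == Posz (size u) then s' else if i is Posz k then nth pblank (u ++ v) k else pblank) =
  if i is Posz k then nth pblank (u ++ s' :: behead v) k else pblank.
Proof.
case: i => [k|k] //; rewrite !nth_cat; have [e|ne] := eqVneq (Posz k) (Posz (size u)).
  by case: e => ->; rewrite ltnn subnn.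
have [//|ge] := ltnP k (size u).
have : 0 < k - size u by rewrite subn_gt0 ltn_neqAle ge andbT; apply: contra ne => /eqP->.
by case: (k - size u) => // j _; rewrite /= nth_behead.
Qed.

Lemma step_lconf q u v q' s' d : running q ->
  pdelta q (head pblank v) = (q', s', d) ->
  stepP (lconf q u v) =
  @Config letter P q' (fun i => if i is Posz k then nth pblank (u ++ s' :: behead v) k else pblank)
    (shift d (Posz (size u))).
Proof.
move=> rq h; rewrite /step /= (_ : (_ || _) = false); last by case: q rq {h}.
rewrite nth_cat ltnn subnn nth0 h; congr Config.
by apply/funext => i; exact: tape_set.
Qed.

Lemma stepR q u v q' s' : running q -> pdelta q (head pblank v) = (q', s', MoveRight) ->
  stepP (lconf q u v) = lconf q' (rcons u s') (behead v).
Proof.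
move=> rq h; rewrite (step_lconf u rq h) /lconf size_rcons cat_rcons; congr Config.
by rewrite /=; lia.
Qed.

Lemma stepS q u v q' s' : running q -> pdelta q (head pblank v) = (q', s', Stay) ->
  stepP (lconf q u v) = lconf q' u (s' :: behead v).
Proof. by move=> rq h; rewrite (step_lconf u rq h). Qed.

Lemma stepL q u x v q' s' : running q -> pdelta q (head pblank v) = (q', s', MoveLeft) ->
  stepP (lconf q (rcons u x) v) = lconf q' u (x :: s' :: behead v).
Proof.
move=> rq h; rewrite (step_lconf _ rq h) /lconf size_rcons cat_rcons; congr Config.
by rewrite /=; lia.
Qed.

Lemma lconf_blank q u : lconf q u [:: pblank] = lconf q u [::].
Proof.
congr Config; apply/funext => -[k|//]; rewrite cats0 nth_cat.
have [//|ge] := ltnP k (size u).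
by rewrite [RHS]nth_default//; case: (k - size u) => [|[|j]].
Qed.

Definition inner s := s != Edge.
Definition busy s := inner s && (s != pblank).

Lemma runs_carry a u v : all busy v -> runs (lconf (Carry a) u v) (lconf (Carry a) (u ++ v) [::]).
Proof.
elim: v u => [|s v IH] u /=; first by rewrite cats0 => _; exact: runs0.
move=> /andP[hs hv]; rewrite -cat_rcons; apply: runs_trans (IH _ hv).
apply/runs1/stepR => //; case: s hs => [g|l m|] //=.
by rewrite /busy /= => /eqP ne; case: eqP => // e; rewrite e in ne.
Qed.

Lemma at_posE i : i < bound -> at_pos i = i :> nat.
Proof. by move=> h; rewrite val_insubd h. Qed.

Lemma runs_write a u i : i <= size (word a) ->
  runs (lconf (Write a (at_pos i)) u [::])
       (lconf (after a) (u ++ map pin (drop i (word a))) [::]).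
Proof.
move=> le; have := subnK le; move: (size (word a) - i) => m; elim: m i u {le} => [|m IH] i u e.
  rewrite drop_oversize ?cats0 -?e//; apply: runs1.
  rewrite (@stepS _ _ _ (after a) pblank)// ?lconf_blank//=.
  by rewrite at_posE -?e ?add0n ?ltnn// -[i]add0n e.
have ib : i < size (word a) by rewrite -e; lia.
rewrite (drop_nth tally ib) map_cons -cat_rcons.
apply: runs_trans (IH i.+1 _ _); last by rewrite addnS.
apply/runs1/stepR => //=.
by rewrite at_posE ?ib//; apply: ltn_trans ib _.
Qed.

Lemma runs_append a u v : all busy v ->
  runs (lconf (Carry a) u v) (lconf (after a) (u ++ v ++ map pin (word a)) [::]).
Proof.
move=> bv; apply: runs_trans (runs_carry a u bv) _.
apply: (@runs_trans (lconf (Write a (at_pos 0)) (u ++ v) [::])).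
  rewrite -(lconf_blank (Carry a)) -(lconf_blank (Write _ _)).
  by apply/runs1/stepS => //=; rewrite eqxx.
by have := @runs_write a (u ++ v) 0 isT; rewrite drop0 catA.
Qed.

Lemma runs_back b u v : all inner u -> inner (head pblank v) ->
  runs (lconf (Back b) (Edge :: u) v) (lconf (Srch b) [:: Edge] (u ++ v)).
Proof.
elim/last_ind: u v => [|u x IH] v.
  move=> _ hv; apply: (@runs_trans (lconf (Back b) [::] (Edge :: v))); last first.
    by apply/runs1/(@stepR (Back b) [::] (Edge :: v)).
  apply: runs1; rewrite (@stepL (Back b) [::] Edge v (Back b) (head pblank v))//.
    case: v hv => [|s v] //= _; congr Config; apply/funext => -[[|[|k]]|k] //=.
    by rewrite nth_nil.
  by case: (head _ _) hv.
rewrite all_rcons => /andP[hx hu] hv; rewrite -rcons_cons cat_rcons.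
apply: runs_trans (IH (x :: v) hu hx); apply: runs1.
rewrite (@stepL (Back b) (Edge :: u) x v (Back b) (head pblank v))//.
  case: v hv => [|s v] //= _; congr Config; apply/funext => -[k|//] /=.
  rewrite -!cat_cons !nth_cat; case: ltnP => // _.
  by case: (k - _) => [|[|j]] //; rewrite /= nth_nil.
by case: (head _ _) hv.
Qed.

Lemma all_inner_busy v : all busy v -> all inner v.
Proof. by apply: sub_all => s /andP[]. Qed.

Lemma busy_pin w : all busy (map pin w).
Proof. by apply/allP => _ /mapP[l _ ->]; rewrite /busy pin_blank andbT. Qed.

Lemma runs_sweep a b u v : after a = Back b -> all busy u -> all busy v ->
  runs (lconf (Carry a) (Edge :: u) v) (lconf (Srch b) [:: Edge] (u ++ v ++ map pin (word a))).
Proof.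
move=> ab bu bv; apply: runs_trans (runs_append a _ bv) _; rewrite ab.
rewrite cat_cons; have := @runs_back b (u ++ v ++ map pin (word a)) [::].
rewrite cats0; apply=> //.
by rewrite !all_cat !all_inner_busy// busy_pin.
Qed.

Definition cells m (w : seq letter) : seq psym := map (fun l => Cell l m) w.

Lemma busy_cells m w : all busy (cells m w).
Proof. by apply/allP => _ /mapP[l _ ->]. Qed.

Definition pass_mark (b : bool) := if b then MA else MB.
Definition turn_mark (b : bool) := if b then MB else MA.

Lemma runs_pass b w u v :
  runs (lconf (Srch b) u (cells (pass_mark b) w ++ v))
       (lconf (Srch b) (u ++ cells (pass_mark b) w) v).
Proof.
elim: w u => [|l w IH] u; first by rewrite cats0; exact: runs0.
rewrite /= -cat_rcons; apply: runs_trans (IH _).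
by apply/runs1/stepR => //; case: (b).
Qed.

Lemma runs_tick b w l v : all busy v ->
  runs (lconf (Srch b) [:: Edge] (cells (pass_mark b) w ++ Cell l (turn_mark b) :: v))
       (lconf (Srch b) [:: Edge]
          (cells (pass_mark b) (rcons w l) ++ v ++ map pin (word (Tick b)))).
Proof.
move=> bv; apply: runs_trans (runs_pass _ _ _ _) _.
apply: (@runs_trans (lconf (Carry (Tick b)) (Edge :: cells (pass_mark b) (rcons w l)) v)).
  by rewrite /cells map_rcons -rcons_cons; apply/runs1/stepR => //; case: (b).
by apply: runs_sweep => //; exact: busy_cells.
Qed.

Lemma runs_ticks b w w' v : word (Tick b) = [:: tally; tally] -> all busy v ->
  runs (lconf (Srch b) [:: Edge] (cells (pass_mark b) w ++ cells (turn_mark b) w' ++ v))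
       (lconf (Srch b) [:: Edge]
          (cells (pass_mark b) (w ++ w') ++ v ++ map pin (nseq (2 * size w') tally))).
Proof.
move=> wt; elim: w' w v => [|l w' IH] w v bv.
  by rewrite /= !cats0; exact: runs0.
apply: runs_trans (runs_tick _ _ _ _) _.
  by rewrite all_cat busy_cells.
rewrite -catA wt -cat_rcons; apply: runs_trans (IH _ _ _) _.
  by rewrite all_cat bv (busy_pin [:: tally; tally]).
rewrite -!catA [size _]/= mulnS; exact: runs0.
Qed.

Hypothesis word_tick : forall b, word (Tick b) = [:: tally; tally].

Definition round_word j l :=
  nseq (2 * j) tally ++ word (Got l) ++ nseq (2 * j.+1) tally ++ word Again.

(** Between rounds the letters already treated carry [MA]. The first sweep turns them into [MB] and
    counts [size w]; the letter [l] is then marked [MB] as well, so the sweep back to [MA] counts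
    one more. *)
Lemma runs_round w l w' o :
  runs (lconf (Srch false) [:: Edge] (cells MA w ++ cells MU (l :: w') ++ map pin o))
       (lconf (Srch false) [:: Edge] (cells MA (rcons w l) ++ cells MU w' ++
          map pin (o ++ round_word (size w) l))).
Proof.
have h1 := @runs_ticks false [::] w (cells MU (l :: w') ++ map pin o) (word_tick _).
apply: runs_trans (h1 _) _; first by rewrite all_cat busy_cells busy_pin.
rewrite /= -!catA; set n1 := map pin (nseq _ _).
apply: runs_trans (runs_pass _ _ _ _) _.
apply: (@runs_trans (lconf (Carry (Got l)) (Edge :: cells MB (rcons w l))
   (cells MU w' ++ map pin o ++ n1))).
  by rewrite /cells map_rcons -rcons_cons; apply/runs1/stepR.
have bv : all busy (cells MU w' ++ map pin o ++ n1) by rewrite !all_cat busy_cells !busy_pin.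
apply: runs_trans (runs_sweep (b := true) _ (busy_cells _ _) bv) _ => //.
have h2 := @runs_ticks true [::] (rcons w l)
  ((cells MU w' ++ map pin o ++ n1) ++ map pin (word (Got l))) (word_tick _).
apply: runs_trans (h2 _) _; first by rewrite all_cat bv busy_pin.
rewrite /= size_rcons; set n2 := map pin (nseq (2 * (size w).+1) _).
apply: runs_trans (runs_pass _ _ _ _) _.
set v := (_ ++ n2); have bv2 : all busy v by rewrite /v !all_cat busy_cells !busy_pin.
apply: (@runs_trans (lconf (Carry Again) (Edge :: cells MA (rcons w l)) v)).
  (* The sweep stops because the head meets neither [MA] nor [MB]: it is on an unmarked letter, on a
     symbol written before, or at worst on the tallies [n2], of which there are at least two. *)
  have [s [v' [vE hs]]] : exists s v', v = s :: v' /\ pdelta (Srch true) s = (Carry Again, s, Stay).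
    rewrite /v; case: (w') => [|l2 w2]; last by do 2 eexists; split; first by [].
    case: (o) => [|l2 o2]; last by do 2 eexists; split; first by [].
    rewrite /n1; case: (size w) => [|m]; last by rewrite mulnS; do 2 eexists; split; first by [].
    case: (word (Got l)) => [|l2 w2]; last by do 2 eexists; split; first by [].
    by do 2 eexists; split; first by [].
  by rewrite vE; apply/runs1/stepS.
apply: runs_trans (runs_sweep (b := false) _ (busy_cells _ _) bv2) _ => //.
rewrite /v /n1 /n2 /round_word !map_cat -!catA; exact: runs0.
Qed.

Fixpoint rounds_word j w :=
  if w is l :: w' then round_word j l ++ rounds_word j.+1 w' else [::].

Lemma runs_rounds w w' o :
  runs (lconf (Srch false) [:: Edge] (cells MA w ++ cells MU w' ++ map pin o))
       (lconf (Srch false) [:: Edge] (cells MA (w ++ w') ++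
          map pin (o ++ rounds_word (size w) w'))).
Proof.
elim: w' w o => [|l w' IH] w o; first by rewrite !cats0; exact: runs0.
apply: runs_trans (runs_round _ _ _ _) _; apply: runs_trans (IH _ _) _.
by rewrite cat_rcons size_rcons -catA; exact: runs0.
Qed.

Definition tidy s := if s is Cell l _ then pin l else s.
Definition tidy_head v := if v is s :: v' then tidy s :: v' else [::].

Lemma runs_clean u v : all inner u -> inner (head pblank v) ->
  runs (lconf Clean (Edge :: u) v)
       (lconf (Run (start M)) [:: pblank] (map tidy u ++ tidy_head v)).
Proof.
have left_step u' x v' : inner (head pblank v') ->
    stepP (lconf Clean (rcons u' x) v') = lconf Clean u' (x :: tidy_head v').
  case: v' => [|s v'] hs; last by apply: stepL => //; case: s hs.
  rewrite (@stepL Clean u' x [::] Clean pblank)//.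
  congr Config; apply/funext => -[k|//]; rewrite !nth_cat; case: ltnP => // _.
  by case: (k - _) => [|[|j]] //; rewrite /= nth_nil.
elim/last_ind: u v => [|u x IH] v.
  move=> _ hv; apply: (@runs_trans (lconf Clean [::] (Edge :: tidy_head v))).
    by apply: runs1; apply: (left_step [::] Edge v).
  by apply/runs1/(@stepR Clean [::] (Edge :: tidy_head v)).
rewrite all_rcons => /andP[hx hu] hv; rewrite -rcons_cons map_rcons cat_rcons.
apply: runs_trans (IH (x :: tidy_head v) hu hx); apply: runs1.
exact: (left_step (Edge :: u) x v).
Qed.

Definition output w := w ++ rounds_word 0 w ++ nseq (2 * size w) tally ++ word Fin.

Definition prep_start w := lconf Wait [::] (Edge :: cells MU w).

Lemma step_prep_start w : stepP (prep_start w) = lconf (Back false) [::] (Edge :: cells MU w).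
Proof. exact: stepS. Qed.

Lemma runs_prep w : runs (prep_start w) (lconf (Run (start M)) [:: pblank] (map pin (output w))).
Proof.
apply: runs_trans (runs1 (step_prep_start w)) _.
apply: (@runs_trans (lconf (Srch false) [:: Edge] (cells MU w))).
  by apply/runs1/(@stepR (Back false) [::] (Edge :: cells MU w)).
have h1 := @runs_rounds [::] w [::]; rewrite /= !cats0 in h1.
apply: runs_trans h1 _; rewrite /output; move: (rounds_word 0 w) => o.
have h2 := @runs_ticks false [::] w (map pin o) (word_tick _) (busy_pin _).
apply: runs_trans h2 _; rewrite /= -map_cat; apply: runs_trans (runs_pass false _ _ _) _.
have -> : w ++ o ++ nseq (2 * size w) tally ++ word Fin =
  w ++ (o ++ nseq (2 * size w) tally) ++ word Fin by rewrite -!catA.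
move: (o ++ nseq _ _) => {}o.
apply: (@runs_trans (lconf (Carry Fin) ([:: Edge] ++ cells MB w) (map pin o))).
  case: o => [|l o].
    by rewrite -!(lconf_blank _ ([:: Edge] ++ _)); apply/runs1/stepS.
  by apply/runs1/stepS.
apply: runs_trans (runs_append Fin _ (busy_pin o)) _.
have := @runs_clean (cells MB w ++ map pin (o ++ word Fin)) [::].
have -> : map tidy (cells MB w ++ map pin (o ++ word Fin)) = map pin (w ++ o ++ word Fin).
  by rewrite map_cat [in RHS]map_cat /cells -!map_comp.
rewrite /= cats0 map_cat; apply=> //.
by rewrite all_cat -map_cat !all_inner_busy ?busy_cells ?busy_pin.
Qed.

(** Shifted by one cell: cell 0 held [Edge] and is blank when [M] starts, so the input of [M] begins
    in cell 1. *)
Definition embed (c : config M) : config P :=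
  @Config letter P (Run (cstate c)) (fun i => Plain (ctape c (i - 1)%R)) (chead c + 1)%R.

Lemma embed_init w : lconf (Run (start M)) [:: pblank] (map pin w) = embed (init M w).
Proof.
congr Config; apply/funext => -[[|k]|k]; [by []| |by []].
have -> : (Posz k.+1 - 1 = Posz k)%R by lia.
have [kw|wk] := ltnP k (size w).
  by rewrite /= (nth_map tally)// (nth_map tally).
by rewrite /= !nth_default ?size_map.
Qed.

Lemma embed_step c : stepP (embed c) = embed (step c).
Proof.
rewrite /step /=.
have -> q q' : (Run q == Run q') = (q == q').
  by apply/eqP/eqP => [[]|->].
case: ifP => // _; rewrite addrK.
case: (delta _ _) => -[q g] d /=; congr Config.
  by apply/funext => i /=; rewrite (_ : (i == chead c + 1)%R = (i - 1 == chead c)%R); [case: eqP|lia].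
by case: d => /=; lia.
Qed.

Lemma embed_iter n c : iter n stepP (embed c) = embed (iter n (@step letter M) c).
Proof. by elim: n => //= n ->; rewrite embed_step. Qed.

Lemma prep_accepts w : accepts M (output w) ->
  exists n, cstate (iter n stepP (prep_start w)) = accept P.
Proof.
have [m hm] := runs_prep w.
move=> [n hn]; exists (n + m); rewrite iterD hm embed_init embed_iter /=.
by rewrite hn.
Qed.

Lemma prep_rejects w : rejects M (output w) ->
  exists n, cstate (iter n stepP (prep_start w)) = reject P.
Proof.
have [m hm] := runs_prep w.
move=> [n hn]; exists (n + m); rewrite iterD hm embed_init embed_iter /=.
by rewrite hn.
Qed.

End Prep.

(** * Space-time diagrams as a local rule on cells *)

Section Cells.
Variables (S : finType) (M : turing_machine S).
Local Notation cell_t := (symbol M * option (state M))%type.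

Definition cell (c : config M) (x : int) : cell_t :=
  (ctape c x, if x == chead c then Some (cstate c) else None).

(** [delta] is arbitrary on the halting states; staying put there agrees with [step] and continues
    the diagram after halting. *)
Definition trans q g :=
  if (q == accept M) || (q == reject M) then (q, g, Stay) else delta q g.

Definition leaves (d : move) (s : option cell_t) : option (state M) :=
  if s is Some (g, Some q) then
    let: (q', _, d') := trans q g in
    match d, d' with
    | MoveLeft, MoveLeft | MoveRight, MoveRight | Stay, Stay => Some q'
    | _, _ => None
    end
  else None.

Definition next_cell (l : option cell_t) (s : cell_t) (r : option cell_t) : cell_t :=
  (if s.2 is Some q then (trans q s.1).1.2 else s.1,
   if leaves Stay (Some s) is Some q then Some q
   else if leaves MoveRight l is Some q then Some q else leaves MoveLeft r).

Lemma stepE (c : config M) : step c =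
  let: (q, a, d) := trans (cstate c) (ctape c (chead c)) in
  Config q (fun i => if i == chead c then a else ctape c i) (shift d (chead c)).
Proof.
rewrite /step /trans; case: ifP => // _.
by case: c => q tp h; congr Config; apply/funext => i /=; case: eqP => [->|].
Qed.

(** A missing neighbour acts as a cell without the head. This is what a border column shows, and it
    is harmless as long as the head is not in that column. *)
Lemma cell_step (c : config M) x l r :
  (l = Some (cell c (x - 1)%R) \/ l = None /\ chead c <> (x - 1)%R) ->
  (r = Some (cell c (x + 1)%R) \/ r = None /\ chead c <> (x + 1)%R) ->
  cell (step c) x = next_cell l (cell c x) r.
Proof.
move=> hl hr; rewrite stepE /cell /next_cell /=.
have lE : leaves MoveRight l = if chead c == (x - 1)%R then
    leaves MoveRight (Some (cell c (x - 1)%R)) else None.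
  case: hl => [->|[-> ne]]; last by case: eqP.
  by case: eqP => // ne; rewrite /= eq_sym; case: eqP.
have rE : leaves MoveLeft r = if chead c == (x + 1)%R then
    leaves MoveLeft (Some (cell c (x + 1)%R)) else None.
  case: hr => [->|[-> ne]]; last by case: eqP.
  by case: eqP => // ne; rewrite /= eq_sym; case: eqP.
rewrite lE rE {lE rE hl hr} /leaves /cell.
case E : (trans (cstate c) (ctape c (chead c))) => [[q g] d] /=.
have neq (y z : int) : y <> z -> (y == z) = false by move=> ne; apply/eqP.
have [xh|xh] := eqVneq x (chead c).
  rewrite xh E (neq (chead c) (chead c - 1)%R); last by lia.
  rewrite (neq (chead c) (chead c + 1)%R); last by lia.
  by case: d {E} => /=; rewrite ?eqxx// neq//; lia.
move: xh => /eqP xh; congr pair.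
have [h1|h1] := eqVneq (chead c) (x - 1)%R.
  rewrite -h1 ?eqxx E (neq _ (x + 1)%R); last by lia.
  case: d {E} => /=.
  - by rewrite neq//; lia.
  - by rewrite (_ : x == _) //; apply/eqP; lia.
  - by rewrite neq.
have [h2|h2] := eqVneq (chead c) (x + 1)%R.
  rewrite -h2 ?eqxx E.
  case: d {E} => /=.
  - by rewrite (_ : x == _) //; apply/eqP; lia.
  - by rewrite neq//; lia.
  - by rewrite neq.
by case: d {E} => /=; rewrite neq//; lia.
Qed.

Section Space.
Variable c0 : config M.
Local Notation stepM := (@step S M).
Local Notation run n := (iter n stepM c0).
Hypothesis head0 : chead c0 = 0%R.
(* The border of level [n.+2] writes column [n] as in the initial configuration, so
   the head must not be there at time [n]. *)
Hypothesis head1 : chead (step c0) = 0%R.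

Lemma head_bound n : (`|chead (run n)| <= n.-1%:Z)%R.
Proof.
case: n => [|n]; first by rewrite /= head0.
elim: n => [|n IH]; first by rewrite /= head1.
have -> : run n.+2 = step (run n.+1) by [].
rewrite stepE; case: trans => -[q g] d; rewrite [chead (Config _ _ _)]/=; move: IH.
by move: (chead (run n.+1)) => h; case: d => /=; lia.
Qed.

Lemma untouched n x : (n%:Z <= `|x|)%R -> x <> 0%R -> ctape (run n) x = ctape c0 x.
Proof.
move=> h x0; elim: n h => [//|n IH] h; have -> : run n.+1 = step (run n) by [].
rewrite stepE.
have hb := head_bound n; case: trans => -[q g] d /=.
rewrite (_ : (x == _) = false); first by apply: IH; lia.
by apply/eqP; lia.
Qed.

Definition space_time (n : nat) (x : int) : cell_t := cell (run n.-2) x.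

Lemma space_time_frontier n (x : int) : (n%:Z <= `|x|)%R -> x <> 0%R ->
  space_time n.+2 x = cell c0 x.
Proof.
move=> h x0; rewrite /space_time (_ : n.+2.-2 = n)// /cell untouched//; congr pair.
have hb := head_bound n; rewrite head0.
rewrite (_ : (x == chead (run n)) = false); last first.
  by apply/eqP; move: hb; move: (chead (run n)) => y; lia.
by rewrite (_ : (x == 0%R) = false)//; apply/eqP.
Qed.

Lemma space_time_step n (x : int) (l r : option cell_t) :
  (l = Some (space_time n.+2 (x - 1)%R) \/ l = None /\ (n%:Z < `|x - 1|)%R) ->
  (r = Some (space_time n.+2 (x + 1)%R) \/ r = None /\ (n%:Z < `|x + 1|)%R) ->
  space_time n.+3 x = next_cell l (space_time n.+2 x) r.
Proof.
move=> hl hr; have hb := head_bound n.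
apply: cell_step; [case: hl|case: hr]; (try by left); move=> [-> h]; right; split=> //;
  move: hb h; move: (chead (run n)) => y; lia.
Qed.

End Space.
End Cells.

(** * The heptagrid in the hyperboloid model *)

Section Constants.
Local Open Scope ring_scope.
Local Open Scope classical_set_scope.
Variable R : realType.

Local Notation c := (cosh_inradius R).
Local Notation s := (sinh_inradius R).

Definition central_angle : R := 2 * pi / 7.
Definition two_cos : R := 2 * cos central_angle.

Lemma cosh_inradius_gt0 : 0 < c.
Proof.
have p0 := pi_gt0 R.
apply: divr_gt0; first by apply: cos_gt0_pihalf; lra.
by apply: sin_gt0_pi; lra.
Qed.

(** This is the vertex angle: normals of adjacent sides have product
    [- cos (2 * pi / 3) = 1 / 2]. *)
Lemma cosh_inradius_lam : c ^+ 2 * (2 - two_cos) = 1.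
Proof.
have h := regular_normals_angle R ord0.
rewrite mink_regular_normals in h.
have e : cos (2 * pi / 3) = - (1/2) :> R.
  rewrite (_ : 2 * pi / 3 = pi / 3 *+ 2); last by rewrite mulr2n; field.
  have c0 : 0 < cos (pi / 3) :> R.
    by apply: cos_gt0_pihalf; have := pi_gt0 R; lra.
  have e : cos (pi / 3 *+ 2) = - cos (pi / 3) :> R.
    rewrite (_ : pi / 3 *+ 2 = - (pi / 3) + pi); last by rewrite mulr2n; field.
    by rewrite cosDpi cosN.
  move: (e); rewrite cos_mulr2n mulr2n expr2 => e2.
  have : (cos (pi / 3) + 1) * (2 * cos (pi / 3) - 1) = 0 :> R.
    by rewrite mulrDl mulrBr; lra.
  by move/eqP; rewrite mulf_eq0 => /orP[] /eqP; lra.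
rewrite e /= in h.
rewrite (_ : 2 * pi * 0%:R / 7 - 2 * pi * 1%:R / 7 = - central_angle) in h;
  last by rewrite /central_angle; field.
rewrite cosN in h.
rewrite /two_cos; nra.
Qed.

Lemma sinh_inradius_sq : s ^+ 2 = c ^+ 2 - 1.
Proof.
have := regular_normals_unit R ord0.
rewrite /mink !mxE /= -![s * s]expr2 => h.
have e : 2 * pi * 0%:R / 7 = 0 :> R by rewrite mulr0 mul0r.
rewrite e cos0 sin0 in h; rewrite expr2 in h *.
rewrite expr2; lra.
Qed.

Lemma sin_angle_gt0 : 0 < sin central_angle.
Proof. by have p0 := pi_gt0 R; apply: sin_gt0_pi; rewrite /central_angle; lra. Qed.

Lemma lam_gt0 : 0 < two_cos.
Proof.
have p0 := pi_gt0 R.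
by rewrite mulr_gt0// cos_gt0_pihalf// /central_angle; apply/andP; split; lra.
Qed.

(** Four and three times the central angle add up to [2 * pi], so their cosines agree. As
    polynomials in the cosine their difference has the factor [2 * cos central_angle - 2], which is
    not zero; the cofactor is the polynomial of the statement. *)
Lemma lam_root : two_cos ^+ 3 + two_cos ^+ 2 - 2 * two_cos - 1 = 0.
Proof.
have h : cos (central_angle *+ 2 + central_angle *+ 2) = cos (central_angle *+ 2 + central_angle) :> R.
  rewrite (_ : central_angle *+ 2 + central_angle *+ 2 = - (central_angle *+ 2 + central_angle) + pi *+ 2).
    by rewrite cosD2pi cosN.
  by rewrite /central_angle !mulr2n; field.
rewrite [LHS]cosD [RHS]cosD cos_mulr2n sin_mulr2n !mulr2n in h.
have s1 : sin central_angle ^+ 2 = 1 - cos central_angle ^+ 2 :> R.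
  by have := cos2Dsin2 central_angle; lra.
have c1 : cos central_angle < 1 :> R.
  have := sin_angle_gt0; have := cos2Dsin2 central_angle; nra.
have : (2 * cos central_angle - 2) *
       (two_cos ^+ 3 + two_cos ^+ 2 - 2 * two_cos - 1) = 0 :> R.
  move: h s1; rewrite /two_cos.
  set x := cos central_angle; set y := sin central_angle => h s1.
  have h2 : (x * y + x * y) * y = 2 * x * (1 - x ^+ 2) by rewrite -s1; ring.
  have h3 : (x * y + x * y) * (x * y + x * y) = 4 * x ^+ 2 * (1 - x ^+ 2).
    by rewrite -s1; ring.
  move: h; rewrite h2 h3 => /eqP; rewrite -subr_eq0 => /eqP h.
  by rewrite -[RHS](mulr0 2) -h; ring.
move/eqP; rewrite mulf_eq0 => /orP[] /eqP //; lra.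
Qed.

(** The cubic has a single positive root, about 1.24698. This interval is narrow enough for all the
    sign checks on coefficients below. *)
Lemma lam_bounds : 1246 / 1000 < two_cos < 1248 / 1000.
Proof.
have := lam_gt0; have := lam_root; set l := two_cos => e l0.
apply/andP; split; rewrite ltNge; apply/negP => h; nra.
Qed.

Lemma sinh_inradius_gt0 : 0 < s.
Proof.
have := cosh_inradius_lam; have := lam_bounds; have := cosh_inradius_gt0.
move=> c0 /andP[l1 l2] e; rewrite /sinh_inradius sqrtr_gt0.
nra.
Qed.

End Constants.

(** * Side normals, the rotation of the heptagon and the half-turn about a side *)

Section Vectors.
Local Open Scope ring_scope.
Local Open Scope classical_set_scope.
Variable R : realType.
Local Notation vec := 'rV[R]_3.
Local Notation x0 := (0 : 'I_3).
Local Notation x1 := (1 : 'I_3).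
Local Notation x2 := (2%:R : 'I_3).
Local Notation c := (cosh_inradius R).
Local Notation s := (sinh_inradius R).
Local Notation angle := (central_angle R).
Local Notation lam := (two_cos R).
Implicit Types (n u v w : vec) (A B : 'M[R]_3).

Definition row3 (a b d : R) : vec :=
  \row_(j < 3) if j == x0 then a else if j == x1 then b else d.

Definition mx3 u v w : 'M[R]_3 :=
  \matrix_(i < 3, j < 3)
    if i == x0 then u 0 j else if i == x1 then v 0 j else w 0 j.

Lemma I3_case (P : 'I_3 -> Prop) : P x0 -> P x1 -> P x2 -> forall i, P i.
Proof.
move=> h0 h1 h2 [[|[|[|//]]] hi]; [apply: eq_ind h0 _ _|apply: eq_ind h1 _ _|apply: eq_ind h2 _ _];
  exact/val_inj.
Qed.

Lemma row3E (v : vec) : v = row3 (v 0 x0) (v 0 x1) (v 0 x2).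
Proof. by apply/rowP; apply: I3_case; rewrite mxE. Qed.

Lemma row3_0 a b d : row3 a b d 0 x0 = a. Proof. by rewrite mxE. Qed.
Lemma row3_1 a b d : row3 a b d 0 x1 = b. Proof. by rewrite mxE. Qed.
Lemma row3_2 a b d : row3 a b d 0 x2 = d. Proof. by rewrite mxE. Qed.

Lemma sum3 (F : 'I_3 -> R) : \sum_i F i = F x0 + F x1 + F x2.
Proof.
rewrite !big_ord_recl big_ord0 addr0 addrA; congr (_ + F _ + F _); exact/val_inj.
Qed.

Lemma mul_mx3 x u v w :
  x *m mx3 u v w = (x 0 x0) *: u + (x 0 x1) *: v + (x 0 x2) *: w.
Proof. by apply/rowP => j; rewrite mxE sum3 !mxE. Qed.

Lemma act_inj_mx A B : (forall v : vec, v *m A = v *m B) -> A = B.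
Proof.
by move=> h; apply/row_matrixP => i; rewrite !rowE h.
Qed.

Lemma minkC u v : mink u v = mink v u.
Proof. by rewrite /mink; ring. Qed.
Lemma minkDl u v w : mink (u + v) w = mink u w + mink v w.
Proof. by rewrite /mink !mxE; ring. Qed.
Lemma minkZl a u v : mink (a *: u) v = a * mink u v.
Proof. by rewrite /mink !mxE; ring. Qed.
Lemma minkNl u v : mink (- u) v = - mink u v.
Proof. by rewrite /mink !mxE; ring. Qed.
Lemma minkDr u v w : mink w (u + v) = mink w u + mink w v.
Proof. by rewrite /mink !mxE; ring. Qed.
Lemma minkZr a u v : mink v (a *: u) = a * mink v u.
Proof. by rewrite /mink !mxE; ring. Qed.
Lemma minkNr u v : mink v (- u) = - mink v u.
Proof. by rewrite /mink !mxE; ring. Qed.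
Definition minkE := (minkDl, minkDr, minkZl, minkZr, minkNl, minkNr).

Lemma mink_row3 a b d a' b' d' :
  mink (row3 a b d) (row3 a' b' d') = - (a * a') + b * b' + d * d'.
Proof. by rewrite /mink !mxE. Qed.

Lemma mink_reflection n u v :
  mink n n = 1 -> mink (reflection n u) (reflection n v) = mink u v.
Proof.
move=> n1; rewrite /reflection !minkE n1 (minkC n v); ring.
Qed.

Definition nrm (k : nat) : vec :=
  row3 s (c * cos (2 * pi * k%:R / 7)) (c * sin (2 * pi * k%:R / 7)).

Lemma regular_normalsE (k : 'I_7) : regular_normals R k = nrm k.
Proof. by []. Qed.

Definition rho : 'M[R]_3 :=
  mx3 (row3 1 0 0) (row3 0 (cos angle) (sin angle)) (row3 0 (- sin angle) (cos angle)).

Definition flip v : vec := row3 (v 0 x0) (v 0 x1) (- v 0 x2).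
Definition flipm : 'M[R]_3 := mx3 (row3 1 0 0) (row3 0 1 0) (row3 0 0 (-1)).
Definition refl0 : 'M[R]_3 :=
  mx3 (reflection (nrm 0) (row3 1 0 0)) (reflection (nrm 0) (row3 0 1 0))
      (reflection (nrm 0) (row3 0 0 1)).
(** The half-turn about the midpoint of side 0, as the product of the reflections in two
    perpendicular lines through it: the axis from the centre, then the side. A dart is represented
    by the isometry sending edge 0 of the regular heptagon to it; left multiplication by [rho] and
    [tau] plays the roles of [r] and [t]. *)
Definition tau : 'M[R]_3 := flipm *m refl0.

Lemma act_rho v : v *m rho =
  row3 (v 0 x0) (cos angle * v 0 x1 - sin angle * v 0 x2)
                (sin angle * v 0 x1 + cos angle * v 0 x2).
Proof.
rewrite mul_mx3; apply/rowP; apply: I3_case; rewrite !mxE /=; ring.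
Qed.

Lemma act_flipm v : v *m flipm = flip v.
Proof.
rewrite mul_mx3; apply/rowP; apply: I3_case; rewrite !mxE /=; ring.
Qed.

Lemma act_refl0 v : v *m refl0 = reflection (nrm 0) v.
Proof.
rewrite mul_mx3 [RHS]/reflection {2 3}(row3E v) /reflection /mink !row3_0 !row3_1 !row3_2.
apply/rowP; apply: I3_case; rewrite !mxE /=; ring.
Qed.

Lemma act_tau v : v *m tau = reflection (nrm 0) (flip v).
Proof. by rewrite mulmxA act_flipm act_refl0. Qed.

Lemma mink_flip u v : mink (flip u) (flip v) = mink u v.
Proof. by rewrite mink_row3 /mink; ring. Qed.

Lemma nrmS k : nrm k *m rho = nrm k.+1.
Proof.
rewrite act_rho !row3_0 !row3_1 !row3_2 /nrm.
have -> : 2 * pi * k.+1%:R / 7 = 2 * pi * k%:R / 7 + angle :> R.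
  by rewrite /central_angle -natr1; field.
rewrite cosD sinD; congr row3; ring.
Qed.

Lemma nrm7 k : nrm (k + 7) = nrm k.
Proof.
rewrite /nrm.
have -> : 2 * pi * (k + 7)%:R / 7 = 2 * pi * k%:R / 7 + pi *+ 2 :> R.
  by rewrite natrD mulr2n; field.
by rewrite cosD2pi sinD2pi.
Qed.

Lemma nrm_mod k : nrm (k %% 7)%N = nrm k.
Proof.
rewrite {2}(divn_eq k 7) addnC; elim: (k %/ 7)%N => [|q IH].
  by rewrite mul0n addn0.
by rewrite mulSn addnA addnAC nrm7.
Qed.

Lemma flip_nrm k : (k <= 7)%N -> flip (nrm k) = nrm (7 - k).
Proof.
move=> k7; rewrite /flip /nrm !row3_0 !row3_1 !row3_2.
have -> : 2 * pi * (7 - k)%:R / 7 = - (2 * pi * k%:R / 7) + pi *+ 2 :> R.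
  by rewrite natrB// mulr2n; field.
by rewrite cosD2pi sinD2pi cosN sinN mulrN.
Qed.

Lemma nrm_unit k : mink (nrm k) (nrm k) = 1.
Proof.
rewrite mink_row3.
have := cos2Dsin2 (2 * pi * k%:R / 7 : R).
set x := cos _; set y := sin _ => e.
have := sinh_inradius_sq R; move: e; rewrite !expr2 => e e2.
transitivity (- (s * s) + (c * c) * (x * x + y * y)); first by ring.
by rewrite e e2; ring.
Qed.

Lemma mink_rho u v : mink (u *m rho) (v *m rho) = mink u v.
Proof.
rewrite !act_rho mink_row3 /mink.
have := cos2Dsin2 angle; rewrite !expr2.
set x := cos _; set y := sin _ => e.
transitivity (- (u 0 x0 * v 0 x0) + (x * x + y * y) * (u 0 x1 * v 0 x1) +
  (x * x + y * y) * (u 0 x2 * v 0 x2)); first by ring.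
by rewrite e; ring.
Qed.

Lemma mink_tau u v : mink (u *m tau) (v *m tau) = mink u v.
Proof. by rewrite !act_tau mink_reflection ?nrm_unit// mink_flip. Qed.

Lemma nrm0 : nrm 0 = row3 s c 0.
Proof. by rewrite /nrm mulr0 mul0r cos0 sin0 mulr1 mulr0. Qed.

Lemma nrm1 : nrm 1 = row3 s (c * cos angle) (c * sin angle).
Proof. by rewrite /nrm mulr1. Qed.

Lemma nrm6E : nrm 6 = row3 s (c * cos angle) (- (c * sin angle)).
Proof.
have := @flip_nrm 1 isT; rewrite nrm1 /flip !row3_0 !row3_1 !row3_2 => ->.
by congr nrm.
Qed.

(** The recurrence of the characteristic polynomial of [rho], [(X - 1) (X^2 - lam X + 1)]. It
    expresses all the normals in [nrm 0], [nrm 1] and [nrm 6], with coefficients that are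
    polynomials in [lam]. *)
Lemma nrm_rec k : nrm k.+3 = nrm k + (1 + lam) *: (nrm k.+2 - nrm k.+1).
Proof.
elim: k => [|k IH]; last first.
  by rewrite -[LHS]nrmS [in LHS]IH mulmxDl -scalemxAl mulmxBl !nrmS.
have e2 : 2 * pi * 2%:R / 7 = angle + angle :> R.
  by rewrite /central_angle; field.
have e3 : 2 * pi * 3%:R / 7 = angle + angle + angle :> R.
  by rewrite /central_angle; field.
rewrite nrm0 nrm1 /nrm e3 e2 !(cosD, sinD) /two_cos.
have := cos2Dsin2 angle; set x := cos _; set y := sin _ => e.
have e1 : y ^+ 2 = 1 - x ^+ 2 by rewrite -e; ring.
apply/rowP; apply: I3_case; rewrite !mxE /=.
- by ring.
- have -> : c * ((x * x - y * y) * x - (y * x + x * y) * y) =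
    c * ((x ^+ 2 - y ^+ 2) * x - 2 * x * y ^+ 2) by ring.
  have -> : c * (x * x - y * y) = c * (x ^+ 2 - y ^+ 2) by ring.
  by rewrite e1; ring.
- have -> : c * ((y * x + x * y) * x + (x * x - y * y) * y) =
    c * y * (3 * x ^+ 2 - y ^+ 2) by ring.
  by rewrite e1; ring.
Qed.

Lemma mink_nrm01 : mink (nrm 0) (nrm 1) = 1 / 2.
Proof.
have := mink_regular_normals R ord0 (ordS ord0).
rewrite !regular_normalsE /= => ->.
have -> : 2 * pi * 0%:R / 7 - 2 * pi * 1%:R / 7 = - angle :> R.
  by rewrite /central_angle; field.
have := cosh_inradius_lam R; rewrite cosN /two_cos; lra.
Qed.

Lemma mink_nrmS j k : mink (nrm j.+1) (nrm k.+1) = mink (nrm j) (nrm k).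
Proof. by rewrite -!nrmS mink_rho. Qed.

Definition gram (k : nat) : R :=
  match k with
  | 0 => 1 | 1 => 1 / 2 | 2 => - lam / 2 | 3 => 1 - (1 + lam) ^+ 2 / 2
  | 4 => 1 - (1 + lam) ^+ 2 / 2 | 5 => - lam / 2 | _ => 1 / 2
  end.

Lemma mink_nrm0 k : (k < 7)%N -> mink (nrm k) (nrm 0) = gram k.
Proof.
have g0 : mink (nrm 0) (nrm 0) = 1 := nrm_unit 0.
have g1 : mink (nrm 1) (nrm 0) = 1 / 2 by rewrite minkC mink_nrm01.
have g6 : mink (nrm 6) (nrm 0) = 1 / 2 by rewrite (esym (nrm7 0) : nrm 0 = nrm 7) !mink_nrmS mink_nrm01.
have n2 : nrm 2 = nrm 6 + (1 + lam) *: (nrm 1 - nrm 0).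
  by have := nrm_rec 6; rewrite (nrm7 0) (nrm7 1) (nrm7 2).
have g2 : mink (nrm 2) (nrm 0) = - lam / 2.
  by rewrite n2 minkE g6 minkE minkDl minkNl g0 g1; field.
have g3 : mink (nrm 3) (nrm 0) = 1 - (1 + lam) ^+ 2 / 2.
  by rewrite nrm_rec minkE minkZl minkDl minkNl g0 g1 g2; field.
have g j : (j <= 7)%N -> mink (nrm (7 - j)) (nrm 0) = mink (nrm j) (nrm 0).
  move=> j7; rewrite -flip_nrm//.
  have e : nrm 0 = flip (nrm 0) by rewrite flip_nrm// (nrm7 0).
  by rewrite {1}e mink_flip.
case: k => [|[|[|[|[|[|[|//]]]]]]] _ /=.
- by rewrite g0. - by rewrite g1. - by rewrite g2. - by rewrite g3.
- exact: etrans (g 3%N isT) g3.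
- exact: etrans (g 2%N isT) g2.
- by rewrite g6.
Qed.

Lemma nrm_tau k : (k < 7)%N -> nrm k *m tau = nrm (7 - k) - (2 * gram k) *: nrm 0.
Proof.
move=> k7; rewrite act_tau /reflection; congr (_ - (2 * _) *: _).
  by rewrite flip_nrm// ltnW.
rewrite -mink_nrm0//.
have e : nrm 0 = flip (nrm 0) by rewrite flip_nrm// (nrm7 0).
by rewrite {1}e mink_flip.
Qed.

Lemma cos_angle : cos angle = lam / 2.
Proof. by rewrite /two_cos; field. Qed.

(** These three normals form a basis. Checking matrix identities on it replaces trigonometry by
    algebra in [lam]. *)
Lemma nrm_ext A B : nrm 0 *m A = nrm 0 *m B -> nrm 1 *m A = nrm 1 *m B ->
  nrm 6 *m A = nrm 6 *m B -> A = B.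
Proof.
have y0 := sin_angle_gt0 R; have c0 := cosh_inradius_gt0 R.
have s0 := sinh_inradius_gt0 R; have /andP[l1 l2] := lam_bounds R.
have xE := cos_angle.
move=> h0 h1 h6.
have h (v w : vec) (a b : R) : v *m A = v *m B -> w *m A = w *m B ->
    (a *: v + b *: w) *m A = (a *: v + b *: w) *m B.
  by move=> e1 e2; rewrite !mulmxDl -!scalemxAl e1 e2.
have k2 : row3 0 0 1 *m A = row3 0 0 1 *m B.
  have -> : row3 0 0 1 = (2 * c * sin angle)^-1 *: nrm 1 + (- (2 * c * sin angle)^-1) *: nrm 6.
    rewrite nrm6E nrm1; apply/rowP; apply: I3_case; rewrite !mxE /=; field;
    by rewrite ?gt_eqF//.
  exact: (h _ _ _ _ h1 h6).
have k1 : row3 0 1 0 *m A = row3 0 1 0 *m B.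
  have d0 : cos angle - 1 != 0 by rewrite xE; apply: ltr0_neq0; lra.
  have -> : row3 0 1 0 = (2 * c * (cos angle - 1))^-1 *: (1 *: nrm 1 + 1 *: nrm 6) +
      (- 2 * (2 * c * (cos angle - 1))^-1) *: nrm 0.
    rewrite nrm6E nrm0 nrm1; apply/rowP; apply: I3_case; rewrite !mxE /=; field;
    by rewrite d0 gt_eqF.
  by apply: (h _ _ _ _ _ h0); apply: h.
apply: act_inj_mx => v.
have -> : v = (v 0 x0 / s) *: (1 *: nrm 0 + (- c) *: row3 0 1 0) +
   1 *: (v 0 x1 *: row3 0 1 0 + v 0 x2 *: row3 0 0 1).
  rewrite nrm0 {1}(row3E v); apply/rowP; apply: I3_case; rewrite !mxE /=; field;
  by rewrite gt_eqF.
by apply: (h _ _ _ _); apply: (h _ _ _ _).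
Qed.

Lemma nrm0_tau : nrm 0 *m tau = - nrm 0.
Proof.
rewrite nrm_tau//= (nrm7 0 : nrm (7 - 0) = nrm 0).
by apply/rowP => j; rewrite !mxE; ring.
Qed.
Lemma nrm1_tau : nrm 1 *m tau = nrm 6 - nrm 0.
Proof.
by rewrite nrm_tau//= (_ : 2 * (1 / 2) = 1) ?scale1r//; field.
Qed.
Lemma nrm2_tau : nrm 2 *m tau = nrm 5 + lam *: nrm 0.
Proof.
by rewrite nrm_tau//= (_ : 2 * (- lam / 2) = - lam) ?scaleNr ?opprK//; field.
Qed.
Lemma nrm6_tau : nrm 6 *m tau = nrm 1 - nrm 0.
Proof.
by rewrite nrm_tau//= (_ : 2 * (1 / 2) = 1) ?scale1r//; field.
Qed.

Lemma tau_tau : tau *m tau = 1%:M.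
Proof.
apply: nrm_ext; rewrite mulmxA mulmx1.
- by rewrite nrm0_tau mulNmx nrm0_tau opprK.
- by rewrite nrm1_tau mulmxBl nrm0_tau nrm6_tau opprK subrK.
- by rewrite nrm6_tau mulmxBl nrm0_tau nrm1_tau opprK subrK.
Qed.

(** Three heptagons around a vertex: the product [tau *m rho] is the rotation about a vertex of the
    heptagon. The vertex angle enters through the product [1 / 2] of adjacent normals. *)
Lemma tau_rho3 : tau *m rho *m (tau *m rho) *m (tau *m rho) = 1%:M.
Proof.
have p0 : nrm 0 *m (tau *m rho) = - nrm 1.
  by rewrite mulmxA nrm0_tau mulNmx nrmS.
have p1 : nrm 1 *m (tau *m rho) = nrm 0 - nrm 1.
  by rewrite mulmxA nrm1_tau mulmxBl !nrmS (nrm7 0 : nrm 7 = nrm 0).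
have p2 : nrm 2 *m (tau *m rho) = nrm 6 + lam *: nrm 1.
  by rewrite mulmxA nrm2_tau mulmxDl -scalemxAl !nrmS.
have p6 : nrm 6 *m (tau *m rho) = nrm 2 - nrm 1.
  by rewrite mulmxA nrm6_tau mulmxBl !nrmS.
have n2 : nrm 2 = nrm 6 + (1 + lam) *: (nrm 1 - nrm 0).
  by have := nrm_rec 6; rewrite (nrm7 0 : nrm 7 = nrm 0) (nrm7 1 : nrm 8 = nrm 1) (nrm7 2 : nrm 9 = nrm 2).
move: (tau *m rho) p0 p1 p2 p6 => P p0 p1 p2 p6.
apply: nrm_ext; rewrite !mulmxA mulmx1.
- rewrite p0 !mulNmx p1 mulmxBl p0 p1.
  by apply/rowP => j; rewrite !mxE; ring.
- rewrite p1 !mulmxBl p0 p1 !mulNmx p1 mulmxBl p0 p1.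
  by apply/rowP => j; rewrite !mxE; ring.
- rewrite p6 !mulmxBl p2 p1 mulmxDl mulmxBl -scalemxAl p0 p1 p6 n2.
  by apply/rowP => j; rewrite !mxE; ring.
Qed.

End Vectors.

(** * Direct isometries *)

Section Group.
Local Open Scope ring_scope.
Local Open Scope classical_set_scope.
Variable R : realType.
Local Notation vec := 'rV[R]_3.
Local Notation x0 := (0 : 'I_3).
Local Notation x1 := (1 : 'I_3).
Local Notation x2 := (2%:R : 'I_3).
Local Notation c := (cosh_inradius R).
Local Notation s := (sinh_inradius R).
Local Notation angle := (central_angle R).
Local Notation lam := (two_cos R).
Local Notation nrm := (nrm R).
Local Notation rho := (rho R).
Local Notation tau := (tau R).
Implicit Types (n u v w : vec) (A B a b : 'M[R]_3).

Lemma det_mx3 u v w : \det (mx3 u v w) =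
  u 0 x0 * (v 0 x1 * w 0 x2 - v 0 x2 * w 0 x1)
  - u 0 x1 * (v 0 x0 * w 0 x2 - v 0 x2 * w 0 x0)
  + u 0 x2 * (v 0 x0 * w 0 x1 - v 0 x1 * w 0 x0).
Proof.
rewrite (expand_det_row _ x0) sum3 /cofactor !(expand_det_row _ (0 : 'I_2)).
rewrite !big_ord_recl !big_ord0 /cofactor !det_mx11 !mxE /=.
rewrite /bump /= !addr0 !expr0 !expr1 !mul1r.
have l1 (i : 'I_3) (j : 'I_2) : lift i j = inord (bump i j).
  by apply/val_inj; rewrite /= inordK//; apply: (valP (lift i j)).
have i0 : inord 0 = x0 by apply/val_inj; rewrite /= inordK.
have i1 : inord 1 = x1 by apply/val_inj; rewrite /= inordK.
have i2 : inord 2 = x2 by apply/val_inj; rewrite /= inordK.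
rewrite !l1 /bump /= /bump /= ?i0 ?i1 ?i2.
rewrite (_ : (0 + (1 %% 3 + 1 %% 3) %% 3)%N = 2%N)//.
ring.
Qed.

Lemma det_rho : \det rho = 1.
Proof.
rewrite det_mx3 !row3_0 !row3_1 !row3_2.
transitivity (cos angle ^+ 2 + sin angle ^+ 2); first by ring.
exact: cos2Dsin2.
Qed.

Lemma det_flipm : \det (flipm R) = -1.
Proof. by rewrite det_mx3 !row3_0 !row3_1 !row3_2; ring. Qed.

Lemma det_refl0 : \det (refl0 R) = -1.
Proof.
rewrite det_mx3 /reflection nrm0 !mink_row3 !mxE /=.
transitivity (1 - 2 * (c ^+ 2 - s ^+ 2)); first by ring.
by rewrite sinh_inradius_sq; ring.
Qed.

Lemma det_tau : \det tau = 1.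
Proof. by rewrite det_mulmx det_flipm det_refl0 mulrNN mulr1. Qed.

Lemma hplane_lt v : hplane v -> v 0 x1 ^+ 2 < v 0 x0 ^+ 2.
Proof.
by move=> [e _]; move: e; rewrite /mink -!expr2 => e; have := sqr_ge0 (v 0 x2); lra.
Qed.

Lemma hplane_rho v : hplane v -> hplane (v *m rho).
Proof.
by move=> [e p]; split; rewrite /= ?mink_rho// act_rho row3_0.
Qed.

Lemma hplane_tau v : hplane v -> hplane (v *m tau).
Proof.
move=> hv; have [e p] := hv; split; rewrite /= ?mink_tau// act_tau.
have h := hplane_lt hv.
rewrite /reflection nrm0 /flip mink_row3 !mxE /=.
have c0 := cosh_inradius_gt0 R; have s0 := sinh_inradius_gt0 R.
have e2 := sinh_inradius_sq R.
set x := v 0 x0 in p h *; set y := v 0 x1 in h *.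
have [yx1 yx2] : - x < y /\ y < x by split; nra.
have -> : x - 2 * (- (x * s) + y * c + - v 0 x2 * 0) * s =
  x * (1 + 2 * s ^+ 2) - 2 * s * c * y by ring.
have h1 : 0 < s * c * (x - y) by apply: mulr_gt0; [exact: mulr_gt0|lra].
have h2 : 0 <= (c - s) ^+ 2 by rewrite sqr_ge0.
have : 0 <= x * (c - s) ^+ 2 by rewrite mulr_ge0// ltW.
have -> : x * (c - s) ^+ 2 = x * (c ^+ 2 + s ^+ 2) - 2 * s * c * x by ring.
have -> : c ^+ 2 = 1 + s ^+ 2 by lra.
lra.
Qed.

(** The darts of the heptagrid. Inverses need no constructor, because [rho] and [tau] have finite
    order. *)
Inductive frame_mx : 'M[R]_3 -> Prop :=
| frame_mx1 : frame_mx 1%:M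
| frame_mx_rho a : frame_mx a -> frame_mx (rho *m a)
| frame_mx_tau a : frame_mx a -> frame_mx (tau *m a).

Lemma direct_isometry1 : direct_isometry (1%:M : 'M[R]_3).
Proof. by split=> [u v|x|]; rewrite /act ?mulmx1// det1. Qed.

Lemma direct_isometryM a b : direct_isometry a -> direct_isometry b ->
  direct_isometry (a *m b).
Proof.
move=> [a1 a2 a3] [b1 b2 b3]; split=> [u v|x hx|].
- by rewrite /act !mulmxA b1 a1.
- by rewrite /act mulmxA; apply: b2; apply: a2.
- by rewrite det_mulmx a3 b3 mulr1.
Qed.

Lemma direct_isometry_rho : direct_isometry rho.
Proof. by split; [exact: mink_rho|exact: hplane_rho|exact: det_rho]. Qed.

Lemma direct_isometry_tau : direct_isometry tau.
Proof. by split; [exact: mink_tau|exact: hplane_tau|exact: det_tau]. Qed.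

Lemma frame_mx_direct a : frame_mx a -> direct_isometry a.
Proof.
elim=> [|b _ IH|b _ IH]; first exact: direct_isometry1.
  exact: direct_isometryM direct_isometry_rho IH.
exact: direct_isometryM direct_isometry_tau IH.
Qed.

Lemma direct_isometry_unit a : direct_isometry a -> a \in unitmx.
Proof. by move=> [_ _ d]; rewrite unitmxE d unitr1. Qed.

Lemma direct_isometryV a : direct_isometry a -> direct_isometry (invmx a).
Proof.
move=> da; have ua := direct_isometry_unit da; have [a1 a2 a3] := da.
have i1 u v : mink (act (invmx a) u) (act (invmx a) v) = mink u v.
  by rewrite -a1 /act !mulmxKV.
split=> // [x hx|]; last by rewrite det_inv a3 invr1.
have [e p] := hx; split; first by rewrite /= i1.
rewrite /= ltNge; apply/negP => h.
(* If the preimage of [x] were on the lower sheet, its opposite would be on the upper one, and [a]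
   would send it to [- x], on the lower sheet. *)
have : hplane (- act (invmx a) x).
  split; rewrite /= ?minkNl ?minkNr ?opprK ?i1//.
  rewrite mxE oppr_gt0 lt_neqAle h andbT; apply/eqP => h0.
  have := e; rewrite -i1 /mink -!expr2 /act h0 expr0n /= oppr0.
  by move: (sqr_ge0 ((x *m invmx a) 0 x1)) (sqr_ge0 ((x *m invmx a) 0 x2)); lra.
move=> /a2 [_]; rewrite /act mulNmx mulmxKV//= !mxE oppr_gt0.
by move: p; lra.
Qed.

Lemma act_polygon a (n : normals R) : direct_isometry a ->
  act a @` polygon n = polygon (act a \o n).
Proof.
move=> da; have ua := direct_isometry_unit da; have [a1 a2 _] := da.
apply/seteqP; split=> x /=.
  by move=> [y [hy h] <-]; split; [exact: a2|move=> k /=; rewrite a1].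
move=> [hx h]; exists (act (invmx a) x); last by rewrite /act mulmxKV.
have [_ hV _] := direct_isometryV da.
split=> [|k]; first exact: hV.
by have := h k; rewrite /= -{1}(mulmxKV ua x) a1.
Qed.

End Group.

(** * The heptagrid as an orbit of direct isometries *)

Section Heptagons.
Local Open Scope ring_scope.
Local Open Scope classical_set_scope.
Variable R : realType.
Local Notation vec := 'rV[R]_3.
Local Notation x0 := (0 : 'I_3).
Local Notation x1 := (1 : 'I_3).
Local Notation x2 := (2%:R : 'I_3).
Local Notation c := (cosh_inradius R).
Local Notation s := (sinh_inradius R).
Local Notation angle := (central_angle R).
Local Notation lam := (two_cos R).
Local Notation nrm := (nrm R).
Local Notation rho := (rho R).
Local Notation tau := (tau R).
Implicit Types (n : normals R) (u v w x y : vec) (A B a b g : 'M[R]_3).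

Definition rpow k : 'M[R]_3 := iter k (mulmx rho) 1%:M.

Lemma nrm_rpow j k : nrm j *m rpow k = nrm (j + k).
Proof.
elim: k j => [|k IH] j; first by rewrite mulmx1 addn0.
by rewrite /= mulmxA nrmS IH addSnnS.
Qed.

Lemma rpowD j k : rpow (j + k) = rpow j *m rpow k.
Proof. by apply: nrm_ext; rewrite mulmxA !nrm_rpow addnA. Qed.

Lemma rpow7 : rpow 7 = 1%:M.
Proof. by apply: nrm_ext; rewrite mulmx1 nrm_rpow nrm7. Qed.

Lemma rpow_mod k : rpow (k %% 7)%N = rpow k.
Proof. by apply: nrm_ext; rewrite !nrm_rpow -nrm_mod modnDmr nrm_mod. Qed.

Lemma direct_isometry_rpow k : direct_isometry (rpow k).
Proof.
elim: k => [|k IH]; first exact: direct_isometry1.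
exact: direct_isometryM (direct_isometry_rho R) IH.
Qed.

Lemma frame_mx_rpow k a : frame_mx a -> frame_mx (rpow k *m a).
Proof.
move=> fa; elim: k => [|k IH]; first by rewrite mul1mx.
by rewrite /= -mulmxA; apply: frame_mx_rho.
Qed.

Lemma act_reflection a u v : direct_isometry a ->
  reflection (u *m a) (v *m a) = reflection u v *m a.
Proof.
by move=> [a1 _ _]; rewrite /reflection mulmxBl -scalemxAl; congr (_ - (2 * _) *: _); exact: a1.
Qed.

Lemma nrm_tau_rpow j k : (j <= 7)%N ->
  nrm j *m (tau *m rpow k) = reflection (nrm k) (nrm (7 - j + k)).
Proof.
move=> j7; rewrite mulmxA act_tau -act_reflection; last exact: direct_isometry_rpow.
by rewrite flip_nrm// !nrm_rpow.
Qed.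

(* The normals [n] are those of the image by [a], possibly in another order. *)
Definition matches n a :=
  (forall k, exists j, n k = nrm j *m a) /\ (forall j, exists k, n k = nrm j *m a).

Lemma matches1 : matches (regular_normals R) 1%:M.
Proof.
split=> [k|j]; first by exists k; rewrite mulmx1.
have j7 : (j %% 7 < 7)%N by rewrite ltn_mod.
by exists (Ordinal j7); rewrite mulmx1 regular_normalsE /= nrm_mod.
Qed.

Lemma matches_rho n a : matches n a -> matches n (rho *m a).
Proof.
move=> [h1 h2]; split=> [k|j]; last first.
  by have [k e] := h2 j.+1; exists k; rewrite e mulmxA nrmS.
have [j e] := h1 k; exists (j + 6)%N.
by rewrite mulmxA nrmS -addnS nrm7.
Qed.

(** The reflection in a side and the half-turn about its midpoint differ by [flip], a symmetry of
    the heptagon that only reorders the normals. Hence reflections and direct isometries generate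
    the same heptagons. *)
Lemma matches_reflect n a k i : direct_isometry a -> matches n a ->
  n k = nrm i *m a ->
  matches (fun j => reflection (n k) (n j)) (tau *m (rpow i *m a)).
Proof.
move=> da [h1 h2] e; split=> [l|j].
  have [m em] := h1 l; rewrite e em act_reflection//.
  have j7 : ((i + (7 - m %% 7)) %% 7 <= 7)%N by rewrite ltnW// ltn_mod.
  exists ((i + (7 - m %% 7)) %% 7)%N; rewrite (mulmxA tau) mulmxA nrm_tau_rpow//.
  congr (reflection _ _ *m _); rewrite -nrm_mod -[RHS]nrm_mod; congr nrm.
  have := ltn_mod m 7; have := divn_eq m 7; lia.
have [l el] := h2 (7 - j %% 7 + i)%N.
exists l; rewrite e el act_reflection// (mulmxA tau) mulmxA.
by rewrite -[nrm j]nrm_mod nrm_tau_rpow// ltnW// ltn_mod.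
Qed.

Lemma matches_polygon n a : direct_isometry a -> matches n a ->
  act a @` @regular_heptagon R = polygon n.
Proof.
move=> da [h1 h2]; rewrite act_polygon//.
apply/seteqP; split=> x [hx h]; split=> // k.
  have [j ->] := h1 k; have j7 : (j %% 7 < 7)%N by rewrite ltn_mod.
  by have := h (Ordinal j7); rewrite /= regular_normalsE /= nrm_mod.
have [l e] := h2 k; rewrite /= regular_normalsE /act -e; exact: h.
Qed.

Lemma heptagridP (h : set vec) :
  heptagrid h <-> exists2 a, frame_mx a & act a @` @regular_heptagon R = h.
Proof.
split.
  move=> [n gn ->].
  suff [a fa m] : exists2 a, frame_mx a & matches n a.
    by exists a => //; apply: matches_polygon => //; apply: frame_mx_direct.
  elim: gn => [|{}n k _ [a fa m]].
    by exists 1%:M; [exact: frame_mx1|exact: matches1].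
  have [i e] := m.1 k; exists (tau *m (rpow i *m a)).
    by apply/frame_mx_tau/frame_mx_rpow.
  by apply: matches_reflect => //; apply: frame_mx_direct.
move=> [a fa <-].
suff [n gn m] : exists2 n, generated n & matches n a.
  by exists n => //; apply: matches_polygon => //; apply: frame_mx_direct.
elim: fa => [|{}a _ [n gn m]|{}a fa [n gn m]].
- by exists (regular_normals R); [exact: generated_base|exact: matches1].
- by exists n => //; apply: matches_rho.
- have [k e] := m.2 0%N; exists (fun j => reflection (n k) (n j)).
    exact: generated_reflect.
  have := matches_reflect (frame_mx_direct fa) m e.
  by rewrite mul1mx.
Qed.

Lemma mink_rec x k : mink x (nrm k.+3) =
  mink x (nrm k) + (1 + lam) * (mink x (nrm k.+2) - mink x (nrm k.+1)).
Proof. by rewrite nrm_rec minkDr minkZr minkDr minkNr. Qed.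

Lemma mink_ext x : mink x (nrm 0) = 0 -> mink x (nrm 1) = 0 ->
  mink x (nrm 6) = 0 -> x = 0.
Proof.
have y0 := sin_angle_gt0 R; have c0 := cosh_inradius_gt0 R.
have s0 := sinh_inradius_gt0 R; have /andP[l1 l2] := lam_bounds R.
rewrite nrm0 nrm1 nrm6E (row3E x) !mink_row3 cos_angle.
move: (x 0 x0) (x 0 x1) (x 0 x2) => p q r.
move: c c0 s s0 (sin angle) y0 => C c0 S s0 y y0 h0 h1 h6.
have /eqP : C * y * r = 0 by lra.
rewrite !mulf_eq0 (gt_eqF c0) (gt_eqF y0) /= => /eqP r0.
have : C * q * (2 - lam) = 0 by lra.
move/eqP; rewrite !mulf_eq0 (gt_eqF c0) /= => /orP[/eqP q0|/eqP h]; last by exfalso; lra.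
have /eqP : p * S = 0 by rewrite q0 r0 in h0; lra.
rewrite mulf_eq0 (gt_eqF s0) orbF => /eqP p0.
by rewrite p0 q0 r0; apply/rowP; apply: I3_case; rewrite !mxE.
Qed.

(* [vtx] and [vtx'] are the endpoints of the edge 0, and [mid] is its midpoint. *)
Definition vp : R := Num.sqrt ((2 + lam) / 3).
Definition vq : R := Num.sqrt ((lam - 1) / 3).
Definition vtx : vec := row3 (c * vp) (s * vp) vq.
Definition vtx' : vec := row3 (c * vp) (s * vp) (- vq).
Definition mid : vec := row3 c s 0.
Definition ctr : vec := row3 1 0 0.

Lemma vp_gt0 : 0 < vp.
Proof. by have /andP[l1 l2] := lam_bounds R; rewrite sqrtr_gt0; lra. Qed.
Lemma vq_gt0 : 0 < vq.
Proof. by have /andP[l1 l2] := lam_bounds R; rewrite sqrtr_gt0; lra. Qed.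
Lemma vp_sq : vp ^+ 2 = (2 + lam) / 3.
Proof. by have /andP[l1 l2] := lam_bounds R; rewrite sqr_sqrtr//; lra. Qed.
Lemma vq_sq : vq ^+ 2 = (lam - 1) / 3.
Proof. by have /andP[l1 l2] := lam_bounds R; rewrite sqr_sqrtr//; lra. Qed.

(** The condition for [vtx] to lie on side 1 too. Here [vp] and [vq] are the hyperbolic cosine and
    sine of half the side length; both members being nonnegative, their squares are compared. *)
Lemma vtx_rel : vq * sin angle = s * vp * (1 - cos angle).
Proof.
have y0 := sin_angle_gt0 R; have c0 := cosh_inradius_gt0 R.
have s0 := sinh_inradius_gt0 R; have /andP[l1 l2] := lam_bounds R.
have p0 := vp_gt0; have q0 := vq_gt0.
apply/eqP; rewrite -(@eqrXn2 _ 2)//; last 2 first.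
- by rewrite mulr_ge0// ltW.
- by rewrite !mulr_ge0 ?ltW// cos_angle; lra.
apply/eqP; rewrite !exprMn vp_sq vq_sq sinh_inradius_sq.
have e : sin angle ^+ 2 = 1 - cos angle ^+ 2 :> R.
  by have := cos2Dsin2 angle; lra.
rewrite e cos_angle.
have h := cosh_inradius_lam R.
have -> : (lam - 1) / 3 * (1 - (lam / 2) ^+ 2) =
  (lam - 1) * (2 + lam) * (2 - lam) / 12 by field.
have -> : (c ^+ 2 - 1) * ((2 + lam) / 3) * (1 - lam / 2) ^+ 2 =
  (c ^+ 2 * (2 - lam) - (2 - lam)) * (2 + lam) * (2 - lam) / 12 by field.
by rewrite h; field.
Qed.

Lemma mink_vtx : [/\ mink vtx (nrm 0) = 0, mink vtx (nrm 1) = 0,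
  mink vtx (nrm 6) < 0 & mink vtx vtx = -1].
Proof.
have y0 := sin_angle_gt0 R; have c0 := cosh_inradius_gt0 R; have q0 := vq_gt0.
have e := vtx_rel.
rewrite nrm0 nrm1 nrm6E !mink_row3; split; first by ring.
- transitivity (c * (vq * sin angle - s * vp * (1 - cos angle))); first by ring.
  by rewrite e; ring.
- have -> : - (c * vp * s) + s * vp * (c * cos angle) + vq * - (c * sin angle)
    = - c * (s * vp * (1 - cos angle) + vq * sin angle) by ring.
  rewrite -e mulNr oppr_lt0 mulr_gt0// addr_gt0// mulr_gt0//.
- transitivity (- (c ^+ 2 - s ^+ 2) * vp ^+ 2 + vq ^+ 2); first by ring.
  by rewrite sinh_inradius_sq vp_sq vq_sq; field.
Qed.

Lemma flip_vtx : flip vtx = vtx'.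
Proof. by rewrite /flip !row3_0 !row3_1 !row3_2. Qed.
Lemma flip_vtx' : flip vtx' = vtx.
Proof. by rewrite /flip !row3_0 !row3_1 !row3_2 opprK. Qed.

Lemma mink_vtx' : [/\ mink vtx' (nrm 0) = 0, mink vtx' (nrm 1) < 0,
  mink vtx' (nrm 6) = 0 & mink vtx' vtx' = -1].
Proof.
have [h0 h1 h6 h] := mink_vtx.
rewrite -flip_vtx mink_flip.
have e0 : nrm 0 = flip (nrm 0) by rewrite flip_nrm// (nrm7 R 0).
have e1 : nrm 1 = flip (nrm 6) by rewrite flip_nrm.
have e6 : nrm 6 = flip (nrm 1) by rewrite flip_nrm.
by rewrite e0 e1 {2}e6 !mink_flip.
Qed.

Lemma heptagonP x : @regular_heptagon R x <-> hplane x /\ forall k, mink x (nrm k) <= 0.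
Proof.
split=> -[hx h]; split=> // k; last exact: h.
have k7 : (k %% 7 < 7)%N by rewrite ltn_mod.
by have := h (Ordinal k7); rewrite regular_normalsE /= nrm_mod.
Qed.

End Heptagons.

(** * Direct isometries preserving an edge or the heptagon *)

Section Stabilizer.
Local Open Scope ring_scope.
Local Open Scope classical_set_scope.
Variable R : realType.
Local Notation vec := 'rV[R]_3.
Local Notation x0 := (0 : 'I_3).
Local Notation x1 := (1 : 'I_3).
Local Notation x2 := (2%:R : 'I_3).
Local Notation c := (cosh_inradius R).
Local Notation s := (sinh_inradius R).
Local Notation angle := (central_angle R).
Local Notation lam := (two_cos R).
Local Notation nrm := (nrm R).
Local Notation rho := (rho R).
Local Notation tau := (tau R).
Local Notation vtx := (vtx R).
Local Notation vtx' := (vtx' R).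
Local Notation mid := (mid R).
Local Notation ctr := (ctr R).
Local Notation vp := (vp R).
Local Notation vq := (vq R).
Local Notation H := (@regular_heptagon R).
Local Notation rpow := (rpow R).
Implicit Types (n : normals R) (u v w x y : vec) (A B a b g : 'M[R]_3).

Lemma mink_isometry a u v : direct_isometry a -> mink (u *m a) (v *m a) = mink u v.
Proof. by move=> [h _ _]; exact: h. Qed.

Lemma mink_wrap x : [/\ mink x (nrm 7) = mink x (nrm 0) &
  mink x (nrm 8) = mink x (nrm 1)].
Proof. by rewrite (nrm7 R 0) (nrm7 R 1). Qed.

Lemma hplane_vtx : hplane vtx.
Proof.
have [_ _ _ e] := mink_vtx R; split=> //=.
by rewrite row3_0 mulr_gt0 ?cosh_inradius_gt0 ?vp_gt0.
Qed.

Lemma hplane_vtx' : hplane vtx'.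
Proof.
have [_ _ _ e] := mink_vtx' R; split=> //=.
by rewrite row3_0 mulr_gt0 ?cosh_inradius_gt0 ?vp_gt0.
Qed.

(** Once the product with normal 0 vanishes, [mink_rec] makes the products with normals 2 to 5
    nonnegative combinations of those with normals 1 and 6. *)
Lemma heptagon_suff x : hplane x -> mink x (nrm 0) = 0 ->
  mink x (nrm 1) <= 0 -> mink x (nrm 6) <= 0 -> H x.
Proof.
move=> hx h0 h1 h6; apply/heptagonP; split=> // k.
have [e7 e8] := mink_wrap x; have /andP[l1 l2] := lam_bounds R.
have n9 : mink x (nrm 9) = mink x (nrm 2) by rewrite (nrm7 R 2).
have r2 := mink_rec x 6; have r3 := mink_rec x 0; have r4 := mink_rec x 4.
have r5 := mink_rec x 5; rewrite n9 ?e7 ?e8 !h0 in r2 r3 r4 r5.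
rewrite -nrm_mod; have := ltn_mod k 7; move: (k %% 7)%N => {}k.
have hl (z t : R) : z <= 0 -> t <= 0 -> z + lam * t <= 0 /\ z + (1 + lam) * t <= 0.
  by move=> z0 t0; split; rewrite -oppr_ge0 opprD addr_ge0 ?oppr_ge0 ?mulr_ge0_le0//; lra.
have hk z : z <= 0 -> (1 + lam) * z <= 0.
  by move=> z0; rewrite mulr_ge0_le0//; lra.
have s2 : mink x (nrm 2) <= 0 by rewrite r2; have := (hl _ _ h6 h1).2; lra.
have s3 : mink x (nrm 3) <= 0.
  rewrite r3 r2; have := hk _ (hl _ _ h6 h1).1; lra.
have s5 : mink x (nrm 5) <= 0 by have := (hl _ _ h1 h6).2; lra.
have s4 : mink x (nrm 4) <= 0.
  have e5 : mink x (nrm 5) = mink x (nrm 1) + (1 + lam) * mink x (nrm 6) by lra.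
  by rewrite e5 in r4; have := hk _ (hl _ _ h1 h6).1; lra.
case: k => [|[|[|[|[|[|[|//]]]]]]] _; rewrite ?h0//.
Qed.

Lemma heptagon_vtx : H vtx.
Proof.
have [h0 h1 h6 _] := mink_vtx R.
by apply: heptagon_suff; rewrite ?h0 ?h1 ?(ltW h6)//; exact: hplane_vtx.
Qed.

Lemma heptagon_vtx' : H vtx'.
Proof.
have [h0 h1 h6 _] := mink_vtx' R.
by apply: heptagon_suff; rewrite ?h0 ?h6 ?(ltW h1)//; exact: hplane_vtx'.
Qed.

Definition edge0 : set vec := @regular_edge R ord0.

Lemma edge0P x : edge0 x <-> H x /\ mink x (nrm 0) = 0.
Proof. by []. Qed.

(** Normal 1 vanishes at [vtx] and normal 6 at [vtx'], so the products of [x] with them, suitably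
    normalised, are its coefficients. The last clause recognises the endpoints. *)
Lemma edge0_comb x : edge0 x -> exists p q : R,
  [/\ 0 <= p, 0 <= q, x = p *: vtx' + q *: vtx &
      (mink x (nrm 1) = 0 -> p = 0) /\ (mink x (nrm 6) = 0 -> q = 0)].
Proof.
move=> [/heptagonP[hx h] h0]; rewrite /= regular_normalsE in h0.
have [v0 v1 v6 _] := mink_vtx R; have [w0 w1 w6 _] := mink_vtx' R.
exists (mink x (nrm 1) / mink vtx' (nrm 1)), (mink x (nrm 6) / mink vtx (nrm 6)).
have div0 (y z : R) : y <= 0 -> z < 0 -> 0 <= y / z.
  by move=> y0 z0; rewrite -mulrNN mulr_ge0 ?oppr_ge0// invr_le0 ltW.
split; [exact: div0|exact: div0| |by split=> ->; rewrite mul0r].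
apply/eqP; rewrite -subr_eq0; apply/eqP; apply: mink_ext.
- by rewrite minkDl minkNl minkDl !minkZl h0 v0 w0; ring.
- rewrite minkDl minkNl minkDl !minkZl v1; field.
  by rewrite !lt_eqF.
- rewrite minkDl minkNl minkDl !minkZl w6; field.
  by rewrite !lt_eqF.
Qed.

Lemma vtx_neq : vtx <> vtx'.
Proof.
move=> /(congr1 (fun v : vec => v 0 x2)); rewrite !row3_2.
by have := vq_gt0 R; lra.
Qed.

Lemma vtx_ext A B : nrm 0 *m A = nrm 0 *m B -> vtx *m A = vtx *m B ->
  vtx' *m A = vtx' *m B -> A = B.
Proof.
have p0 := vp_gt0 R; have q0 := vq_gt0 R; have e2 := sinh_inradius_sq R.
move=> h0 h1 h2; apply: act_inj_mx => v.
have -> : v = (v 0 x1 * c - v 0 x0 * s) *: nrm 0 +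
   ((v 0 x0 * c - v 0 x1 * s) / (2 * vp) + v 0 x2 / (2 * vq)) *: vtx +
   ((v 0 x0 * c - v 0 x1 * s) / (2 * vp) - v 0 x2 / (2 * vq)) *: vtx'.
  have e1 : c ^+ 2 - s ^+ 2 = 1 by rewrite e2; ring.
  rewrite nrm0; apply/rowP; apply: I3_case; rewrite !mxE /=.
  - transitivity ((c ^+ 2 - s ^+ 2) * v 0 x0); first by rewrite e1 mul1r.
    by field; rewrite !gt_eqF.
  - transitivity ((c ^+ 2 - s ^+ 2) * v 0 x1); first by rewrite e1 mul1r.
    by field; rewrite !gt_eqF.
  - field; by rewrite !gt_eqF.
by rewrite !mulmxDl -!scalemxAl h0 h1 h2.
Qed.

Lemma nrm0_unique w : mink vtx w = 0 -> mink vtx' w = 0 -> mink w w = 1 ->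
  w = nrm 0 \/ w = - nrm 0.
Proof.
have p0 := vp_gt0 R; have q0 := vq_gt0 R; have e2 := sinh_inradius_sq R.
rewrite nrm0 (row3E w) !mink_row3.
move: (w 0 x0) (w 0 x1) (w 0 x2) => a b d h1 h2 h3.
have d0 : d = 0.
  have /eqP : vq * d = 0 by lra.
  by rewrite mulf_eq0 gt_eqF// => /eqP.
have h : c * a = s * b.
  have /eqP : vp * (c * a - s * b) = 0 by rewrite d0 in h1; lra.
  by rewrite mulf_eq0 gt_eqF//= subr_eq0 => /eqP.
have h4 : b * b - a * a = 1 by rewrite d0 in h3; lra.
pose t := c * b - s * a.
have ea : a = s * t.
  transitivity ((c ^+ 2 - s ^+ 2) * a); first by rewrite e2; ring.
  rewrite /t; transitivity (c * (c * a) - s ^+ 2 * a); first by ring.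
  by rewrite h; ring.
have eb : b = c * t.
  transitivity ((c ^+ 2 - s ^+ 2) * b); first by rewrite e2; ring.
  rewrite /t; transitivity (c ^+ 2 * b - s * (s * b)); first by ring.
  by rewrite -h; ring.
have : (t - 1) * (t + 1) = 0.
  transitivity ((c ^+ 2 - s ^+ 2) * t ^+ 2 - 1); first by rewrite e2; ring.
  transitivity (c * t * (c * t) - s * t * (s * t) - 1); first by ring.
  by rewrite -ea -eb h4 subrr.
move/eqP; rewrite mulf_eq0 subr_eq0 addr_eq0 => /orP[/eqP et|/eqP et].
  by left; rewrite d0 ea eb et !mulr1.
by right; rewrite d0 ea eb et; apply/rowP; apply: I3_case; rewrite !mxE /=; ring.
Qed.

Lemma hplane_scale v p : hplane v -> 0 <= p -> hplane (p *: v) -> p = 1.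
Proof.
move=> [e _] p0 [e' _]; move: e'; rewrite /= minkZl minkZr e => h.
by apply/eqP; rewrite -(@eqrXn2 _ 2)// expr1n; apply/eqP; lra.
Qed.

(** The normal of the edge is preserved up to sign and the endpoints are permuted. This leaves the
    identity, [flip], the reflection in the side and [tau]; the determinant rules out the second and
    the third. *)
Lemma edge0_stab g : direct_isometry g -> act g @` edge0 = edge0 ->
  g = 1%:M \/ g = tau.
Proof.
move=> dg hg; have [_ g2 g3] := dg; have g1 u v := mink_isometry u v dg.
have ug := direct_isometry_unit dg.
have E v : edge0 v -> edge0 (v *m g) by move=> ev; rewrite -hg; exists v.
have V v : edge0 v -> exists2 y, edge0 y & y *m g = v.
  by rewrite -{1}hg => -[y ey <-]; exists y.
have [v0 v1 v6 vv] := mink_vtx R; have [w0 w1 w6 ww] := mink_vtx' R.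
have ev : edge0 vtx by apply/edge0P; split=> //; exact: heptagon_vtx.
have ew : edge0 vtx' by apply/edge0P; split=> //; exact: heptagon_vtx'.
have orth v : edge0 v -> mink v (nrm 0 *m g) = 0.
  move=> /V[y /edge0P[_ y0] <-]; by rewrite g1.
have n0 := nrm0_unique (orth _ ev) (orth _ ew) (etrans (g1 _ _) (nrm_unit R 0)).
have endpoint v : edge0 v -> mink v (nrm 6) = 0 -> v = vtx'.
  move=> /[dup] ev' /edge0_comb[p [q [p0 _ e [_ q0]]]] v60.
  have hp : hplane v by case: ev' => -[].
  rewrite q0// scale0r addr0 in e; rewrite e in hp *.
  by rewrite (hplane_scale hplane_vtx' p0 hp) scale1r.
have endpoint' v : edge0 v -> mink v (nrm 1) = 0 -> v = vtx.
  move=> /[dup] ev' /edge0_comb[p [q [_ q0 e [p0 _]]]] v60.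
  have hp : hplane v by case: ev' => -[].
  rewrite p0// scale0r add0r in e; rewrite e in hp *.
  by rewrite (hplane_scale hplane_vtx q0 hp) scale1r.
have le0 v k : edge0 v -> mink v (nrm k) <= 0.
  by move=> /edge0P[/heptagonP[_ h] _].
(* Endpoints are extreme. If the image of [w] were strictly between the endpoints, [w] would be a
   positive combination of their preimages [Y] and [Z]; then [nrm k] vanishes on both, which makes
   both equal to [w], although their images differ. *)
have ends k w : (forall v, edge0 v -> mink v (nrm k) = 0 -> v = w) ->
    edge0 w -> mink w (nrm k) = 0 -> w *m g = vtx \/ w *m g = vtx'.
  move=> uni ew0 wk; have [p [q [p0 q0 e _]]] := edge0_comb (E _ ew0).
  have hp : hplane (w *m g) by case: (E _ ew0) => -[].
  have [Y eY Yg] := V _ ew; have [Z eZ Zg] := V _ ev.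
  have wE : w = p *: Y + q *: Z.
    by rewrite -(mulmxK ug w) e -Yg -Zg !scalemxAl -mulmxDl mulmxK.
  have h : p * mink Y (nrm k) + q * mink Z (nrm k) = 0.
    by rewrite -!minkZl -minkDl -wE.
  have Y0 := le0 _ k eY; have Z0 := le0 _ k eZ.
  have [pe|p1] := eqVneq p 0.
    left; rewrite pe scale0r add0r in e; rewrite e in hp *.
    by rewrite (hplane_scale hplane_vtx q0 hp) scale1r.
  have [qe|q1] := eqVneq q 0.
    right; rewrite qe scale0r addr0 in e; rewrite e in hp *.
    by rewrite (hplane_scale hplane_vtx' p0 hp) scale1r.
  have pY : p * mink Y (nrm k) <= 0 by rewrite mulr_ge0_le0.
  have qZ : q * mink Z (nrm k) <= 0 by rewrite mulr_ge0_le0.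
  have /eqP : p * mink Y (nrm k) = 0 by lra.
  rewrite mulf_eq0 (negPf p1) => /eqP Yk.
  have /eqP : q * mink Z (nrm k) = 0 by lra.
  rewrite mulf_eq0 (negPf q1) => /eqP Zk.
  by case: vtx_neq; rewrite -Yg -Zg (uni _ eY Yk) (uni _ eZ Zk).
have neq : vtx *m g <> vtx' *m g.
  by move=> /(congr1 (mulmxr (invmx g))); rewrite /= !mulmxK//; exact: vtx_neq.
have fl v : mink v (nrm 0) = 0 -> v *m tau = flip v.
  move=> h; rewrite act_tau /reflection.
  rewrite (_ : mink (flip v) (nrm 0) = 0) ?mulr0 ?scale0r ?subr0//.
  by rewrite -h -mink_flip; congr mink;
    [rewrite /flip; apply/rowP; apply: I3_case; rewrite !mxE //= opprK|rewrite flip_nrm// (nrm7 R 0)].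
have rf v : mink v (nrm 0) = 0 -> v *m refl0 R = v.
  by move=> h; rewrite act_refl0 /reflection h mulr0 scale0r subr0.
have rf0 : nrm 0 *m refl0 R = - nrm 0.
  rewrite act_refl0 /reflection nrm_unit; apply/rowP => j; rewrite !mxE; ring.
have ff0 : nrm 0 *m flipm R = nrm 0 by rewrite act_flipm flip_nrm// (nrm7 R 0).
have c1 := ends 1%N _ endpoint' ev v1; have c6 := ends 6%N _ endpoint ew w6.
have n1 : 1 <> -1 :> R by lra.
case: n0 => n0; case: c1 => c1; case: c6 => c6.
- by case: neq; rewrite c1 c6.
- by left; apply: vtx_ext; rewrite mulmx1.
- case: n1; transitivity (\det g) => //; rewrite -(det_flipm R); congr determinant.
  by apply: vtx_ext; rewrite ?act_flipm ?flip_vtx ?flip_vtx' -?act_flipm ?ff0.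
- by case: neq; rewrite c1 c6.
- by case: neq; rewrite c1 c6.
- case: n1; transitivity (\det g) => //; rewrite -(det_refl0 R); congr determinant.
  by apply: vtx_ext; rewrite ?rf0 ?rf.
- right; apply: vtx_ext; [by rewrite n0 nrm0_tau|by rewrite fl// flip_vtx|].
  by rewrite fl// flip_vtx'.
- by case: neq; rewrite c1 c6.
Qed.

Lemma heptagon_rpow k : act (rpow k) @` H = H.
Proof.
have dk := direct_isometry_rpow R k; have [_ k2 _] := dk.
have k1 u v := mink_isometry u v dk.
have [_ k3 _] := direct_isometryV dk; have uk := direct_isometry_unit dk.
have sub x : H x -> H (x *m rpow k).
  move=> /heptagonP[hx h]; apply/heptagonP; split=> [|j]; first exact: k2.
  rewrite -nrm_mod (_ : j %% 7 = (j + (7 - k %% 7) + k) %% 7)%N.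
    by rewrite nrm_mod -nrm_rpow k1.
  by have := divn_eq k 7; have := ltn_mod k 7; lia.
apply/seteqP; split=> x; first by move=> [y hy <-]; apply: sub.
move=> /heptagonP[hx h]; exists (x *m invmx (rpow k)); last by rewrite /act mulmxKV.
apply/heptagonP; split=> [|j]; first exact: k3.
by rewrite -k1 mulmxKV// nrm_rpow.
Qed.

Lemma edge_rpow (k : 'I_7) : act (rpow k) @` edge0 = regular_edge k.
Proof.
have k1 u v := mink_isometry u v (direct_isometry_rpow R k).
have hk := heptagon_rpow k.
have nk : nrm k = nrm 0 *m rpow k by rewrite nrm_rpow.
apply/seteqP; split=> x.
  move=> [y /edge0P[hy y0] <-]; split.
    by rewrite -[polygon _]hk; exists y.
  by rewrite /= regular_normalsE nk /act k1.
move=> [hx x0]; move: (hx); rewrite -[polygon _]hk => -[y hy e]; exists y => //.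
split=> //; move: x0; rewrite /= !regular_normalsE -e.
by rewrite nk /act k1.
Qed.

Lemma image_act a b (X : set vec) : act (a *m b) @` X = act b @` (act a @` X).
Proof.
apply/seteqP; split=> x.
  by move=> [y hy <-]; exists (y *m a); [exists y|rewrite /act mulmxA].
by move=> [_ [y hy <-] <-]; exists y; rewrite // /act mulmxA.
Qed.

Lemma image_actV a (X Y : set vec) : a \in unitmx ->
  (act a @` X = act a @` Y) -> X = Y.
Proof.
move=> ua h; have : act (invmx a) @` (act a @` X) = act (invmx a) @` (act a @` Y).
  by rewrite h.
rewrite -!image_act mulmxV//.
have i1 (Z : set vec) : act 1%:M @` Z = Z.
  apply/seteqP; split=> x; first by move=> [y hy <-]; rewrite /act mulmx1.
  by move=> hx; exists x; rewrite // /act mulmx1.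
by rewrite !i1.
Qed.

Lemma heptagon_mid : H mid.
Proof.
have c0 := cosh_inradius_gt0 R; have s0 := sinh_inradius_gt0 R.
have /andP[l1 l2] := lam_bounds R; have e2 := sinh_inradius_sq R.
have cs : 0 < c * s by rewrite mulr_gt0.
apply: heptagon_suff.
- split; last by rewrite /= row3_0.
  rewrite /= mink_row3; move: e2; rewrite !expr2 => ->; ring.
- by rewrite nrm0 mink_row3; ring.
- rewrite nrm1 mink_row3 cos_angle.
  have -> : - (c * s) + s * (c * (lam / 2)) + 0 * (c * sin angle) =
    - (c * s * (2 - lam) / 2) by field.
  by rewrite oppr_le0 divr_ge0// mulr_ge0// ?ltW//; lra.
- rewrite nrm6E mink_row3 cos_angle.
  have -> : - (c * s) + s * (c * (lam / 2)) + 0 * - (c * sin angle) =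
    - (c * s * (2 - lam) / 2) by field.
  by rewrite oppr_le0 divr_ge0// mulr_ge0// ?ltW//; lra.
Qed.

Lemma mink_ctr k : mink ctr (nrm k) = - s.
Proof. by rewrite mink_row3; ring. Qed.

Lemma heptagon_ctr : H ctr.
Proof.
apply/heptagonP; split=> [|k]; last first.
  by rewrite mink_ctr oppr_le0 ltW// sinh_inradius_gt0.
by split; rewrite /= ?row3_0// mink_row3; ring.
Qed.

Lemma small_perturbation (y v : nat -> R) N : (forall k, (k < N)%N -> y k < 0) ->
  exists2 e : R, 0 < e < 1 & forall k, (k < N)%N -> y k + e * v k <= 0.
Proof.
elim: N => [_|N IH h]; first by exists (1/2) => //; apply/andP; split; lra.
have [|e /andP[e0 e1] he] := IH; first by move=> k kN; apply: h; rewrite ltnW.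
have yN := h N (ltnSn N); have yk k kN := h k (ltnW kN : (k < N.+1)%N).
have w0 : 0 <= `|v N| by [].
have d0 : 0 < `|v N| - y N by lra.
pose e' := Num.min e (- y N / (`|v N| - y N)).
have f0 : 0 < - y N / (`|v N| - y N) by rewrite divr_gt0// oppr_gt0.
have e'0 : 0 < e' by rewrite lt_min e0.
exists e'; first by rewrite e'0 gt_min e1.
move=> k; rewrite ltnS leq_eqVlt => /orP[/eqP->|kN].
  have : e' <= - y N / (`|v N| - y N) by rewrite ge_min lexx orbT.
  rewrite ler_pdivlMr// mulrBr => h1.
  have h2 : e' * v N <= e' * `|v N| by rewrite ler_pM2l// ler_norm.
  have h3 : 0 <= e' * - y N by rewrite mulr_ge0 ?ltW// oppr_gt0.
  by rewrite mulrN in h3; lra.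
have [vk|vk] := leP (v k) 0.
  by have := yk k kN; have := mulr_ge0_le0 (ltW e'0) vk; lra.
have : e' * v k <= e * v k by rewrite ler_pM2r// ge_min lexx.
by have := he k kN; lra.
Qed.

Lemma heptagon_stab g : direct_isometry g -> act g @` H = H ->
  exists2 k, (k < 7)%N & g = rpow k.
Proof.
move=> dg hg; have [_ g2 g3] := dg; have g1 u v := mink_isometry u v dg.
have ug := direct_isometry_unit dg.
have c0 := cosh_inradius_gt0 R; have s0 := sinh_inradius_gt0 R.
have e2 := sinh_inradius_sq R; have p0 := vp_gt0 R.
have E v : H v -> H (v *m g) by move=> ev; rewrite -hg; exists v.
have m0 : mink mid (nrm 0) = 0 by rewrite nrm0 mink_row3; ring.
(* If the image of [mid] were strictly inside all seven sides, a point slightly beyond side 0 would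
   still be sent into the heptagon. *)
have [j j7 yj] : exists2 j, (j < 7)%N & mink (mid *m g) (nrm j) = 0.
  apply: contrapT => nj.
  have [k k7|e /andP[e0 e1] he] :=
    @small_perturbation (fun k => mink (mid *m g) (nrm k))
      (fun k => mink (nrm 0 *m g) (nrm k)) 7.
    have /heptagonP[_ h] := E _ heptagon_mid.
    by rewrite lt_neqAle h andbT; apply/eqP => z; apply: nj; exists k.
  have q0 : 0 < 1 - e ^+ 2 by nra.
  (* [mid + e *: nrm 0] has square [e ^+ 2 - 1]; the factor [t] brings it back to the
     hyperboloid. *)
  pose t := (Num.sqrt (1 - e ^+ 2))^-1.
  have t0 : 0 < t by rewrite invr_gt0 sqrtr_gt0.
  have t2 : t ^+ 2 * (1 - e ^+ 2) = 1.
    by rewrite exprVn sqr_sqrtr ?ltW// mulVf ?gt_eqF.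
  pose x := t *: (mid + e *: nrm 0).
  have hx : hplane x.
    split; last by rewrite /= /x nrm0 !mxE /= mulr_gt0// addr_gt0// mulr_gt0.
    rewrite /= /x !minkE m0 (minkC (nrm 0)) m0 nrm_unit mink_row3.
    transitivity (- (t ^+ 2 * ((c ^+ 2 - s ^+ 2) - e ^+ 2))); first by ring.
    by rewrite e2 opprB addrCA subrr addr0 t2.
  have : H (x *m g).
    apply/heptagonP; split=> [|k]; first exact: g2.
    have k7 : (k %% 7 < 7)%N by rewrite ltn_mod.
    rewrite -nrm_mod /x -scalemxAl mulmxDl -scalemxAl minkZl minkDl minkZl.
    by rewrite pmulr_rle0// he.
  rewrite -{1}hg => -[z /heptagonP[_ hz] ez].
  have zx : z = x by rewrite -(mulmxK ug x) -ez /act mulmxK.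
  have := hz 0%N; rewrite zx /x minkZl minkDl minkZl m0 nrm_unit mulr1 add0r.
  by rewrite leNgt mulr_gt0.
have gV : direct_isometry (invmx g) by exact: direct_isometryV.
pose w := nrm j *m invmx g.
have gw v : mink v w = mink (v *m g) (nrm j) by rewrite -[LHS]g1 mulmxKV.
have [_ hv] := (heptagonP _).1 (E _ heptagon_vtx).
have [_ hv'] := (heptagonP _).1 (E _ heptagon_vtx').
(* [mid] is a positive multiple of [vtx + vtx']. The product with [w] is nonpositive at both
   endpoints and vanishes at [mid], so it vanishes at both. *)
have sum : mink vtx w + mink vtx' w = 0.
  have -> : mink vtx w + mink vtx' w = 2 * vp * mink mid w.
    rewrite -minkDl -minkZl; congr mink.
    by apply/rowP; apply: I3_case; rewrite !mxE /=; ring.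
  by rewrite gw yj mulr0.
have vw : mink vtx w = 0 by move: (hv j) (hv' j) sum; rewrite -!gw; lra.
have v'w : mink vtx' w = 0 by move: (hv j) (hv' j) sum; rewrite -!gw; lra.
have ww : mink w w = 1.
  by rewrite /w mink_isometry// nrm_unit.
have wE : w = nrm 0.
  have [//|wN] := nrm0_unique vw v'w ww.
  have [_ h] := (heptagonP _).1 (E _ heptagon_ctr).
  by have := h j; rewrite -gw wN minkNr mink_ctr opprK leNgt s0.
have nj : nrm 0 *m g = nrm j by rewrite -wE /w mulmxKV.
(* Rotating side [j] back to side 0 reduces the claim to [edge0_stab]; [tau] is impossible there
   because it reverses [nrm 0]. *)
pose g' := g *m rpow (7 - j).
have dg' : direct_isometry g'.
  exact: direct_isometryM dg (direct_isometry_rpow _ _).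
have n0' : nrm 0 *m g' = nrm 0.
  by rewrite mulmxA nj nrm_rpow subnKC ?(ltnW j7)// (nrm7 R 0).
have hg' : act g' @` H = H by rewrite image_act hg heptagon_rpow.
have g'1 u v := mink_isometry u v dg'.
have eg' : act g' @` edge0 = edge0.
  apply/seteqP; split=> x.
    move=> [y /edge0P[hy y0] <-]; apply/edge0P; split.
      by rewrite -hg'; exists y.
    by rewrite /act -n0' g'1.
  move=> /edge0P[]; rewrite -{1}hg' => -[y hy <-] h; exists y => //.
  by apply/edge0P; split=> //; rewrite -h /act -{2}n0' g'1.
have g'E : g' = 1%:M.
  have [//|gt] := edge0_stab dg' eg'.
  move: n0'; rewrite gt nrm0_tau => /(congr1 (fun v : vec => v 0 x0)).
  by rewrite nrm0 mxE row3_0 => h; have := s0; rewrite -h oppr_gt0 ltNge (ltW s0).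
exists j => //; have : g' *m rpow j = rpow j by rewrite g'E mul1mx.
by rewrite -mulmxA -rpowD subnK ?(ltnW j7)// rpow7 mulmx1.
Qed.

Lemma shared_edge a b (i j : 'I_7) : direct_isometry a -> direct_isometry b ->
  act a @` @regular_edge R i = act b @` regular_edge j ->
  rpow i *m a = rpow j *m b \/ rpow i *m a = tau *m (rpow j *m b).
Proof.
move=> da db; rewrite -!edge_rpow -!image_act => h.
have dA := direct_isometryM (direct_isometry_rpow R i) da.
have dB := direct_isometryM (direct_isometry_rpow R j) db.
move: (rpow i *m a) (rpow j *m b) dA dB h => A B dA dB h.
have uB := direct_isometry_unit dB.
have dg := direct_isometryM dA (direct_isometryV dB).
have [|e|e] := @edge0_stab (A *m invmx B) dg.
- apply: (image_actV uB); rewrite -image_act -mulmxA mulVmx// mulmx1; exact: h.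
- by left; rewrite -(mulmxKV uB A) e mul1mx.
- by right; rewrite -(mulmxKV uB A) e.
Qed.

End Stabilizer.

(** * Distinct words reach distinct heptagons *)

Section Cones.
Local Open Scope ring_scope.
Local Open Scope classical_set_scope.
Variable R : realType.
(* The arguments are [l], with [l = 2 cos (2 pi / 7)], and the products [p], [q], [r]
   of a vector with the normals 0, 1 and 6.  The heptagons below a heptagon with
   one parent lie in the cone [formF, formG > 0], those below a heptagon with two
   parents in the cone [formF, formE, formH > 0]; [formZ > 0] on the whole plane.
   The identities between these forms hold modulo the minimal polynomial of [l];
   the argument of [root_mul] is the quotient. *)
Definition formF (l p q r : R) := (l ^+ 2 + l - 2) * p + (- 2 * l ^+ 2 - l + 3) * q + (- l + 1) * r.
Definition formG (l p q r : R) := (- l ^+ 2 - l + 2) * p + (l - 1) * q + (- l + 1) * r.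
Definition formE (l p q r : R) := (l ^+ 2 + l - 2) * p + (- l + 1) * q + (- 2 * l ^+ 2 - l + 3) * r.
Definition formH (l p q r : R) := - p.
Definition formZ (l p q r : R) := l * p + - q + - r.
Definition u2 l p q r : R := r + (1 + l) * (q - p).
Definition u5 l p q r : R := q + (1 + l) * (r - p).
Definition u3 l p q r : R := p + (1 + l) * (u2 l p q r - q).
Definition u4 l p q r : R := p + (1 + l) * (u5 l p q r - r).
(* [ak], [bk], [dk] are the products with the normals 0, 1 and 6 after pulling the
   vector back through the [k]-th edge. *)
Definition a3 l p q r : R := - u3 l p q r.
Definition b3 l p q r : R := u2 l p q r - u3 l p q r.
Definition d3 l p q r : R := u4 l p q r - u3 l p q r.
Definition a4 l p q r : R := - u4 l p q r.
Definition b4 l p q r : R := u3 l p q r - u4 l p q r.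
Definition d4 l p q r : R := u5 l p q r - u4 l p q r.
Definition a5 l p q r : R := - u5 l p q r.
Definition b5 l p q r : R := u4 l p q r - u5 l p q r.
Definition d5 l p q r : R := r - u5 l p q r.

Variables (l p q r : R).
Hypothesis l_root : l ^+ 3 + l ^+ 2 - 2 * l - 1 = 0.
Lemma root_mul (t : R) : (l ^+ 3 + l ^+ 2 - 2 * l - 1) * t = 0.
Proof. by rewrite l_root mul0r. Qed.

(** In these names [W] and [B] stand for a parent heptagon with one and with two parents, followed
    by the branch and the form. With [p], [q], [r] the products of the image, each form of the
    parent's cone is a combination of forms positive on the branch's own cone, with coefficients
    positive in the range of [lam_bounds]. *)
Lemma cone_W3F : formF l p q r =
  formF l (a3 l p q r) (b3 l p q r) (d3 l p q r).
Proof.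
rewrite /formF /formG /formE /formH /formZ /a3 /b3 /d3 /u3 /u4 /u2 /u5.
by have := root_mul ((l - 1) * p + (- l + 1) * q); lra.
Qed.

Lemma cone_W3G : formG l p q r =
  formF l (a3 l p q r) (b3 l p q r) (d3 l p q r) +
  (l + 1) * formG l (a3 l p q r) (b3 l p q r) (d3 l p q r) +
  (- l ^+ 2 + 3) * formZ l (a3 l p q r) (b3 l p q r) (d3 l p q r).
Proof.
rewrite /formF /formG /formE /formH /formZ /a3 /b3 /d3 /u3 /u4 /u2 /u5.
by have := root_mul ((2 * l ^+ 2 + 3 * l - 1) * p + (- 2 * l ^+ 2 - l - 1) * q +
  (- 2 * l) * r); lra.
Qed.

Lemma cone_W4F : formF l p q r =
  (- l ^+ 2 + 3) * formF l (a4 l p q r) (b4 l p q r) (d4 l p q r) +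
  (- l ^+ 2 + 3) * formG l (a4 l p q r) (b4 l p q r) (d4 l p q r) +
  (- 2 * l ^+ 2 - l + 5) * formZ l (a4 l p q r) (b4 l p q r) (d4 l p q r).
Proof.
rewrite /formF /formG /formE /formH /formZ /a4 /b4 /d4 /u3 /u4 /u2 /u5.
by have := root_mul ((3 * l + 1) * p + (- 2 * l ^+ 3 + 2 * l ^+ 2 + 2 * l - 4) * q +
  (2 * l ^+ 3 - 2 * l ^+ 2 - 5 * l + 1) * r); lra.
Qed.

Lemma cone_W4G : formG l p q r =
  (l ^+ 2 + l - 1) * formG l (a4 l p q r) (b4 l p q r) (d4 l p q r) +
  (l ^+ 2 + l - 1) * formZ l (a4 l p q r) (b4 l p q r) (d4 l p q r).
Proof.
rewrite /formF /formG /formE /formH /formZ /a4 /b4 /d4 /u3 /u4 /u2 /u5.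
by have := root_mul ((l ^+ 3 + 3 * l ^+ 2 - 2) * p + (- 2 * l ^+ 2 + 1) * q +
  (- l ^+ 3 - l ^+ 2 - l + 1) * r); lra.
Qed.

Lemma cone_W5F : formF l p q r =
  ((1/2) * l ^+ 2 + (1/2) * l) * formF l (a5 l p q r) (b5 l p q r) (d5 l p q r) +
  ((1/2) * l ^+ 2 + (1/2) * l) * formE l (a5 l p q r) (b5 l p q r) (d5 l p q r) +
  (- l ^+ 2 + 3) * formH l (a5 l p q r) (b5 l p q r) (d5 l p q r).
Proof.
rewrite /formF /formG /formE /formH /formZ /a5 /b5 /d5 /u3 /u4 /u2 /u5.
by have := root_mul ((- l ^+ 3 - 2 * l ^+ 2 - 1) * p + (l ^+ 2 + l) * q +
  (l ^+ 3 + l ^+ 2 + 2) * r); lra.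
Qed.

Lemma cone_W5G : formG l p q r =
  formE l (a5 l p q r) (b5 l p q r) (d5 l p q r).
Proof.
rewrite /formF /formG /formE /formH /formZ /a5 /b5 /d5 /u3 /u4 /u2 /u5.
by have := root_mul (0); lra.
Qed.

Lemma cone_B3F : formF l p q r =
  formF l (a3 l p q r) (b3 l p q r) (d3 l p q r).
Proof.
rewrite /formF /formG /formE /formH /formZ /a3 /b3 /d3 /u3 /u4 /u2 /u5.
by have := root_mul ((l - 1) * p + (- l + 1) * q); lra.
Qed.

Lemma cone_B3E : formE l p q r =
  (l ^+ 2 + l - 1) * formG l (a3 l p q r) (b3 l p q r) (d3 l p q r) +
  (l ^+ 2 + l - 1) * formZ l (a3 l p q r) (b3 l p q r) (d3 l p q r).
Proof.
rewrite /formF /formG /formE /formH /formZ /a3 /b3 /d3 /u3 /u4 /u2 /u5.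
by have := root_mul ((l ^+ 3 + l ^+ 2) * p + (- l ^+ 3 - l ^+ 2 - l + 1) * q + - r); lra.
Qed.

Lemma cone_B3h : formH l p q r =
  ((1/2) * l ^+ 2 + l - (1/2)) * formF l (a3 l p q r) (b3 l p q r) (d3 l p q r) +
  (l ^+ 2 + l - (1/2)) * formG l (a3 l p q r) (b3 l p q r) (d3 l p q r) +
  (l ^+ 2 + l - (3/2)) * formZ l (a3 l p q r) (b3 l p q r) (d3 l p q r).
Proof.
rewrite /formF /formG /formE /formH /formZ /a3 /b3 /d3 /u3 /u4 /u2 /u5.
by have := root_mul (((3/2) * l ^+ 3 + (3/2) * l ^+ 2 - (3/2) * l + (1/2)) * p +
  (- (3/2) * l ^+ 3 - (3/2) * l ^+ 2 + l + 1) * q +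
  (- (1/2)) * r); lra.
Qed.

Lemma cone_B4F : formF l p q r =
  ((1/2) * l ^+ 2 + l - (1/2)) * formF l (a4 l p q r) (b4 l p q r) (d4 l p q r) +
  (- (1/2) * l ^+ 2 + (3/2)) * formE l (a4 l p q r) (b4 l p q r) (d4 l p q r) +
  formH l (a4 l p q r) (b4 l p q r) (d4 l p q r).
Proof.
rewrite /formF /formG /formE /formH /formZ /a4 /b4 /d4 /u3 /u4 /u2 /u5.
by have := root_mul ((- l ^+ 3 - l ^+ 2 + l - 2) * p + (l ^+ 3 + 2 * l ^+ 2 - l) * q +
  (- l ^+ 2 + 3) * r); lra.
Qed.

Lemma cone_B4E : formE l p q r =
  formE l (a4 l p q r) (b4 l p q r) (d4 l p q r).
Proof.
rewrite /formF /formG /formE /formH /formZ /a4 /b4 /d4 /u3 /u4 /u2 /u5.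
by have := root_mul ((l - 1) * p + (- l + 1) * r); lra.
Qed.

Lemma cone_B4h : formH l p q r =
  ((1/4) * l ^+ 2 + (3/4) * l) * formF l (a4 l p q r) (b4 l p q r) (d4 l p q r) +
  ((1/4) * l ^+ 2 + (3/4) * l + (1/2)) * formE l (a4 l p q r) (b4 l p q r) (d4 l p q r) +
  ((1/2) * l ^+ 2 + l - (1/2)) * formH l (a4 l p q r) (b4 l p q r) (d4 l p q r).
Proof.
rewrite /formF /formG /formE /formH /formZ /a4 /b4 /d4 /u3 /u4 /u2 /u5.
by have := root_mul ((- (1/2) * l ^+ 2 - l - (1/2)) * p +
  ((1/2) * l ^+ 3 + (3/2) * l ^+ 2) * q +
  (- (1/2) * l ^+ 3 - l ^+ 2 + (3/2) * l + 2) * r); lra.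
Qed.

(** A form positive on one branch is the opposite of a form positive on the next one: a line through
    the origin of the hyperbolic plane's vector space, or rather a plane, separates the two
    images. *)
Lemma sep34 : formG l (a3 l p q r) (b3 l p q r) (d3 l p q r) =
  - formF l (a4 l p q r) (b4 l p q r) (d4 l p q r).
Proof.
rewrite /formF /formG /formE /formH /formZ /a3 /b3 /d3 /a4 /b4 /d4 /u3 /u4 /u2 /u5.
by have := root_mul ((- l + 1) * q + (l - 1) * r); lra.
Qed.

Lemma sep45 : formG l (a4 l p q r) (b4 l p q r) (d4 l p q r) =
  - formF l (a5 l p q r) (b5 l p q r) (d5 l p q r).
Proof.
rewrite /formF /formG /formE /formH /formZ /a4 /b4 /d4 /a5 /b5 /d5 /u3 /u4 /u2 /u5.
by have := root_mul ((l - 1) * p + (- l + 1) * r); lra.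
Qed.

(** Branches 3 and 5 have no common separating form of this kind; [formF] on branch 5 would be minus
    a positive combination of forms positive on branch 3, on branch 5 and on the whole plane. *)
Lemma sep35 : formF l (a5 l p q r) (b5 l p q r) (d5 l p q r) =
  - (l * formG l (a3 l p q r) (b3 l p q r) (d3 l p q r) +
  (- 2 * l ^+ 2 + 4) * formH l (a5 l p q r) (b5 l p q r) (d5 l p q r) +
  (- l ^+ 2 + 3) * formZ l p q r).
Proof.
rewrite /formF /formG /formE /formH /formZ /a3 /b3 /d3 /a5 /b5 /d5 /u3 /u4 /u2 /u5.
by have := root_mul ((- l ^+ 2 + l + 2) * p + (l ^+ 2 + l - 2) * q + (- 2 * l) * r); lra.
Qed.

End Cones.

(** * Ping-pong on the cones *)

Section PingPong.
Local Open Scope ring_scope.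
Local Open Scope classical_set_scope.
Variable R : realType.
Local Notation vec := 'rV[R]_3.
Local Notation x0 := (0 : 'I_3).
Local Notation s := (sinh_inradius R).
Local Notation lam := (two_cos R).
Local Notation nrm := (nrm R).
Local Notation tau := (tau R).
Local Notation ctr := (ctr R).
Local Notation rpow := (rpow R).
Implicit Types (x y : vec) (a : 'M[R]_3).

Lemma lam_sq_bounds : 15 / 10 < lam ^+ 2 < 16 / 10.
Proof.
have /andP[l1 l2] := lam_bounds R.
have h1 : (1246 / 1000) ^+ 2 < lam ^+ 2 by rewrite !expr2; nra.
have h2 : lam ^+ 2 < (1248 / 1000) ^+ 2 by rewrite !expr2; nra.
by apply/andP; split; lra.
Qed.

Definition onform (f : R -> R -> R -> R -> R) x :=
  f lam (mink x (nrm 0)) (mink x (nrm 1)) (mink x (nrm 6)).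

Definition wedge (b : bool) x : Prop :=
  [/\ hplane x, 0 < onform (@formF R) x &
    if b then 0 < onform (@formE R) x /\ 0 < onform (@formH R) x
    else 0 < onform (@formG R) x].

(* Words of branches; [b] tells whether the starting heptagon has two parents. *)
Fixpoint valid (b : bool) (w : seq nat) : bool :=
  match w with
  | 3 :: w' => valid false w'
  | 4 :: w' => valid b w'
  | 5 :: w' => ~~ b && valid true w'
  | [::] => true
  | _ => false
  end.

Definition advance k a : 'M[R]_3 := tau *m (rpow k *m a).
Definition walk w : 'M[R]_3 := foldl (fun a k => advance k a) 1%:M w.
Definition place x k : vec := x *m (tau *m rpow k).

Lemma foldl_advance a w : foldl (fun a k => advance k a) a w = walk w *m a.
Proof.
rewrite /walk; elim: w a => [|k w IH] a; first by rewrite mul1mx.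
by rewrite /= IH [in RHS]IH /advance mulmx1 !mulmxA.
Qed.

(** Acting on points, the first letter of the word comes last, so it alone decides which of the
    disjoint cones contains the image. *)
Lemma walk_cons k w : walk (k :: w) = walk w *m (tau *m rpow k).
Proof. by rewrite {1}/walk /= foldl_advance /advance mulmx1. Qed.

Lemma direct_isometry_advance k : direct_isometry (tau *m rpow k).
Proof.
exact: direct_isometryM (direct_isometry_tau R) (direct_isometry_rpow R k).
Qed.

Lemma hplane_place x k : hplane x -> hplane (place x k).
Proof. by have [_ h _] := direct_isometry_advance k; exact: h. Qed.

Lemma mink_place x k :
  [/\ mink x (nrm 0) = - mink (place x k) (nrm k),
      mink x (nrm 1) = mink (place x k) (nrm (k + 6)) - mink (place x k) (nrm k) &
      mink x (nrm 6) = mink (place x k) (nrm k.+1) - mink (place x k) (nrm k)].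
Proof.
have h j : mink x (nrm j) = mink (place x k) (nrm j *m (tau *m rpow k)).
  by rewrite mink_isometry//; exact: direct_isometry_advance.
split; rewrite h mulmxA.
- by rewrite nrm0_tau mulNmx nrm_rpow minkNr.
- by rewrite nrm1_tau mulmxBl !nrm_rpow minkDr minkNr addnC.
- by rewrite nrm6_tau mulmxBl !nrm_rpow minkDr minkNr add1n.
Qed.

Lemma mink_u x : let p := mink x (nrm 0) in let q := mink x (nrm 1) in
  let r := mink x (nrm 6) in
  [/\ mink x (nrm 2) = u2 lam p q r, mink x (nrm 3) = u3 lam p q r,
      mink x (nrm 4) = u4 lam p q r & mink x (nrm 5) = u5 lam p q r].
Proof.
move=> p q r.
have e7 : mink x (nrm 7) = p by rewrite (nrm7 R 0).
have e8 : mink x (nrm 8) = q by rewrite (nrm7 R 1).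
have e9 : mink x (nrm 9) = mink x (nrm 2) by rewrite (nrm7 R 2).
have r2 := mink_rec x 6; have r3 := mink_rec x 0; have r4 := mink_rec x 4.
have r5 := mink_rec x 5; rewrite e9 ?e7 ?e8 -/p -/q -/r in r2 r3 r4 r5.
have h2 : mink x (nrm 2) = u2 lam p q r by rewrite r2 /u2; ring.
have h5 : mink x (nrm 5) = u5 lam p q r by rewrite /u5; lra.
split=> //; first by rewrite r3 h2 /u3; ring.
by rewrite h5 in r4; rewrite /u4; lra.
Qed.

Lemma place_u x k f : (3 <= k <= 5)%N -> onform f x =
  let y := place x k in
  let p := mink y (nrm 0) in let q := mink y (nrm 1) in let r := mink y (nrm 6) in
  match k with
  | 3 => f lam (a3 lam p q r) (b3 lam p q r) (d3 lam p q r)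
  | 4 => f lam (a4 lam p q r) (b4 lam p q r) (d4 lam p q r)
  | _ => f lam (a5 lam p q r) (b5 lam p q r) (d5 lam p q r)
  end.
Proof.
case: k => [|[|[|[|[|[|//]]]]]] // _; rewrite /onform;
  [have [-> -> ->] := mink_place x 3|have [-> -> ->] := mink_place x 4|
   have [-> -> ->] := mink_place x 5];
  rewrite ?(nrm7 R 2) ?(nrm7 R 3) ?(nrm7 R 4); move: (place x _) => y /=;
  by have [e2 e3 e4 e5] := mink_u y; rewrite ?e2 ?e3 ?e4 ?e5.
Qed.

Lemma formZ_gt0 x : hplane x -> 0 < onform (@formZ R) x.
Proof.
move=> [_ h]; have /andP[l1 l2] := lam_bounds R.
rewrite /onform /formZ nrm0 nrm1 nrm6E (row3E x) !mink_row3 cos_angle.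
have s0 := sinh_inradius_gt0 R.
have := h; rewrite /= => {}h.
have : 0 < (2 - lam) * s * x 0 x0 by rewrite !mulr_gt0//; lra.
lra.
Qed.

Lemma wedge_ctr b : wedge b ctr.
Proof.
have /andP[l1 l2] := lam_bounds R; have s0 := sinh_inradius_gt0 R.
have [hc _] := (heptagonP _).1 (heptagon_ctr R).
have h : 0 < s * (lam ^+ 2 + lam - 2) by rewrite mulr_gt0//; nra.
rewrite /wedge /onform /formF /formG /formE /formH !mink_ctr; split=> //; first by lra.
case: b; last by lra.
by split; lra.
Qed.

Ltac positive_sum :=
  repeat first [assumption | apply: mulr_gt0; [lra|assumption] | apply: addr_gt0].

Definition child_type (b : bool) k := if k is 3 then false else if k is 4 then b else true.

Lemma wedge_child b k x : (3 <= k <= 5)%N -> ~~ (b && (k == 5)) ->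
  wedge (child_type b k) x -> wedge b (place x k).
Proof.
have /andP[l1 l2] := lam_bounds R; have lr := lam_root R.
have /andP[l3 l4] := lam_sq_bounds.
move=> k35 bk [hx]; have := formZ_gt0 hx; rewrite !(place_u x _ k35).
have := hplane_place k hx; move: (place x k) => y hy.
case: k k35 bk => [|[|[|[|[|[|//]]]]]] // _; case: b => //= _ Z F G;
  try (have [{}G G'] := G);
  split=> //; rewrite /onform; (try split).
- by rewrite cone_B3F.
- by rewrite cone_B3E//; positive_sum.
- by rewrite cone_B3h//; positive_sum.
- by rewrite cone_W3F.
- by rewrite cone_W3G//; positive_sum.
- by rewrite cone_B4F//; positive_sum.
- by rewrite cone_B4E.
- by rewrite cone_B4h//; positive_sum.
- by rewrite cone_W4F//; positive_sum.
- by rewrite cone_W4G//; positive_sum.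
- by rewrite cone_W5F//; positive_sum.
- by rewrite cone_W5G.
Qed.

Lemma wedge_disjoint b k k' x x' : (3 <= k < k')%N -> (k' <= 5)%N ->
  wedge (child_type b k) x -> wedge (child_type b k') x' -> ~~ (b && (k' == 5)) ->
  place x k <> place x' k'.
Proof.
have /andP[l1 l2] := lam_bounds R; have lr := lam_root R.
have /andP[l3 l4] := lam_sq_bounds.
move=> /andP[k3 kk'] k'5.
have k35 : (3 <= k <= 5)%N by lia.
have k'35 : (3 <= k' <= 5)%N by lia.
move=> [hx F G] [hx' F' G'] bk e.
have := formZ_gt0 hx; have := formZ_gt0 hx'; move: F G F' G'.
have := formZ_gt0 (hplane_place k hx).
rewrite !(place_u x _ k35) !(place_u x' _ k'35) -e.
move: (place x k) => y.
case: k k' k3 kk' k'5 {k35 k'35 e} bk => [|[|[|[|[|k]]]]] [|[|[|[|[|[|k']]]]]] // _ _ _.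
- move=> _ Z /= F G F' _ _ _.
  by rewrite sep34// oppr_gt0 in G; have := lt_trans F' G; rewrite ltxx.
- case: b => //= _ Z F G F' [_ H] _ _.
  rewrite sep35// oppr_gt0 in F'; have : 0 < (0 : R); last by rewrite ltxx.
  by apply: lt_trans F'; positive_sum.
- case: b => //= _ Z F G F' [_ H] _ _.
  by rewrite sep45// oppr_gt0 in G; have := lt_trans F' G; rewrite ltxx.
Qed.

(** Distinguishes the empty word from all the others. *)
Lemma ctr_notin b k x : (3 <= k <= 5)%N -> ~~ (b && (k == 5)) ->
  wedge (child_type b k) x -> place x k <> ctr.
Proof.
have /andP[l1 l2] := lam_bounds R; have s0 := sinh_inradius_gt0 R.
have lr := lam_root R; have lr' := root_mul lr s.
move=> k35 bk [hx]; rewrite !(place_u x _ k35) => F G e.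
move: F G; rewrite e /= !mink_ctr.
have h : 0 < s * (lam ^+ 2 + lam - 2) by rewrite mulr_gt0//; nra.
case: k k35 bk {e} => [|[|[|[|[|[|//]]]]]] // _; case: b => //= _.
- by move=> _; rewrite /formG /a3 /b3 /d3 /u3 /u4 /u2 /u5; lra.
- by move=> _; rewrite /formG /a3 /b3 /d3 /u3 /u4 /u2 /u5; lra.
- by move=> _ [_]; rewrite /formH /a4 /u4 /u5; lra.
- by move=> _; rewrite /formG /a4 /b4 /d4 /u3 /u4 /u2 /u5; lra.
- by move=> _ [_]; rewrite /formH /a5 /u5; lra.
Qed.

Lemma walk_wedge b w : valid b w -> wedge b (ctr *m walk w).
Proof.
elim: w b => [|k w IH] b; first by rewrite mulmx1 => _; exact: wedge_ctr.
case: k => [|[|[|[|[|[|//]]]]]] //= v; rewrite walk_cons mulmxA.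
- by apply: (@wedge_child b 3) => //; [rewrite andbF|exact: IH].
- by apply: (@wedge_child b 4) => //; [rewrite andbF|exact: IH].
- by case/andP: v => nb v; apply: (@wedge_child b 5) => //; [rewrite andbT|exact: IH].
Qed.

Lemma valid_cons b k w : valid b (k :: w) ->
  [/\ (3 <= k <= 5)%N, ~~ (b && (k == 5)) & valid (child_type b k) w].
Proof.
case: k => [|[|[|[|[|[|//]]]]]] //= v; rewrite ?andbF ?andbT//.
by case/andP: v => -> ->.
Qed.

Lemma walk_inj b w w' : valid b w -> valid b w' ->
  ctr *m walk w = ctr *m walk w' -> w = w'.
Proof.
elim: w b w' => [|k w IH] b [|k' w'] //.
- move=> _ /valid_cons[k35 bk v]; rewrite walk_cons mulmx1 mulmxA => e.
  by case: (ctr_notin k35 bk (walk_wedge v)).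
- move=> /valid_cons[k35 bk v] _; rewrite walk_cons mulmx1 mulmxA => e.
  by case: (ctr_notin k35 bk (walk_wedge v)).
move=> /valid_cons[k35 bk v] /valid_cons[k35' bk' v'].
rewrite !walk_cons !(mulmxA ctr) => e.
have [lt|lt|ek] := ltngtP k k'.
- have := @wedge_disjoint b k k' _ _ _ _ (walk_wedge v) (walk_wedge v') bk'.
  by case=> //; lia.
- have := @wedge_disjoint b k' k _ _ _ _ (walk_wedge v') (walk_wedge v) bk.
  by case=> //; lia.
rewrite -{}ek in v' e *; congr cons; apply: (IH _ _ v v').
by apply: (can_inj (mulmxK (direct_isometry_unit (direct_isometry_advance k)))).
Qed.

(** Among the seven normals only [nrm 0] itself has product 1 with [nrm 0]. *)
Lemma rpow_inj e e' : (e < 7)%N -> (e' < 7)%N -> rpow e = rpow e' -> e = e'.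
Proof.
have /andP[l1 l2] := lam_bounds R.
wlog le : e e' / (e <= e')%N.
  move=> h e7 e'7 ee; have [le|/ltnW le] := leqP e e'; first exact: h.
  by apply/esym/h.
move=> e7 e'7 ee.
have nE : nrm 0 = nrm (e' - e).
  have : nrm 0 *m rpow (7 - e + e) = nrm 0 *m rpow (7 - e + e').
    by rewrite !rpowD ee.
  rewrite subnK ?(ltnW e7)// rpow7 mulmx1 nrm_rpow => ->.
  by rewrite -(nrm7 R (e' - e)); congr nrm; lia.
have g : gram R (e' - e) = 1.
  rewrite -mink_nrm0; last by lia.
  by rewrite -nE nrm_unit.
have /andP[l3 l4] := lam_sq_bounds.
case E: (e' - e)%N g => [|[|[|[|[|[|[|k]]]]]]] /=; try (by lia); move=> g; exfalso; lra.
Qed.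

Lemma ctr_rpow k : ctr *m rpow k = ctr.
Proof.
elim: k => [|k IH]; first by rewrite mulmx1.
rewrite /= mulmxA act_rho !row3_0 !row3_1 !row3_2.
by rewrite -[RHS]IH; congr (_ *m _); congr row3; ring.
Qed.

(** Rotations fix [ctr], so the image of the centre determines the word, after which the rotations
    can be compared. *)
Lemma frames_inj w w' e e' : valid false w -> valid false w' -> (e < 7)%N -> (e' < 7)%N ->
  rpow e *m walk w = rpow e' *m walk w' -> w = w' /\ e = e'.
Proof.
move=> v v' e7 e'7 h.
have ww : w = w'.
  by apply: (walk_inj v v'); rewrite -{1}(ctr_rpow e) -{2}(ctr_rpow e') -!mulmxA h.
split=> //; apply: rpow_inj => //.
have uw : walk w \in unitmx.
  elim: w {v h ww} => [|k w IH]; first exact: unitmx1.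
  by rewrite walk_cons unitmx_mul IH direct_isometry_unit//; exact: direct_isometry_advance.
by rewrite -(mulmxK uw (rpow e)) h -ww mulmxK.
Qed.

End PingPong.

(** * Words leading to the nodes of the seed trees *)

Section NodeWords.
Local Open Scope ring_scope.
Local Open Scope classical_set_scope.
Local Open Scope nat_scope.
Variable R : realType.
Local Notation rpow := (rpow R).
Local Notation r := (mulmx (rho R)).
Local Notation t := (mulmx (tau R)).
Implicit Types (a : 'M[R]_3).

Lemma iter_rho d a : iter d r a = rpow d *m a.
Proof. by elim: d => [|d IH]; [rewrite mul1mx|rewrite /= IH mulmxA]. Qed.

Lemma rho7 a : iter 7 r a = a.
Proof. by rewrite iter_rho rpow7 mul1mx. Qed.

Lemma tauK : involutive (t : 'M[R]_3 -> 'M[R]_3).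
Proof. by move=> a; rewrite mulmxA tau_tau mul1mx. Qed.

Lemma rho_tau3 a : t (r (t (r (t (r a))))) = a.
Proof. by have := tau_rho3 R; rewrite !mulmxA => ->; rewrite mul1mx. Qed.

(** Recovers the kind of a node from its word. [None] stands for the heptagon above level 1, whose
    branches 3 and 4 are the two heptagons of that level. *)
Fixpoint kpath (n : nat) (k : option kind) (w : seq nat) : option kind :=
  if w is d :: w' then
    kpath n.+1 (if k is Some k' then child n k' d
                else if d == 3 then Some KL else Some KR) w'
  else k.

Lemma kpath_rcons n k w d k' : kpath n k w = Some k' ->
  kpath n k (rcons w d) = child (n + size w) k' d.
Proof.
elim: w n k => [|d' w IH] n k /=; first by move=> ->; rewrite addn0.
by move=> h; rewrite (IH _ _ h) addSnnS.
Qed.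

(* The trees of the seeds branch off a common ray. *)
Definition root_word i := rcons (nseq i 4) 3.
Definition seed_word i := rcons (root_word i) 3.

Definition end_type (b : bool) w := foldl child_type b w.

Lemma valid_rcons b w d : valid b (rcons w d) = valid b w && valid (end_type b w) [:: d].
Proof.
elim: w b => [//|d' w IH] b.
by case: d' => [|[|[|[|[|[|d']]]]]] //=; rewrite IH//= andbA.
Qed.

Lemma end_type_rcons b w d : end_type b (rcons w d) = child_type (end_type b w) d.
Proof. by rewrite /end_type -cats1 foldl_cat. Qed.

Lemma walk_rcons w d : walk R (rcons w d) = mv r t d (walk R w).
Proof. by rewrite /walk -cats1 foldl_cat /= /mv iter_rho. Qed.

Lemma child_isB_type n k d k' : child n k d = Some k' ->
  valid (isB k) [:: d] /\ child_type (isB k) d = isB k'.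
Proof. by case: k => [||x|x|x]; case: d => [|[|[|[|[|[|d]]]]]] //= [<-]. Qed.

Lemma valid_root i : valid false (root_word i) /\ end_type false (root_word i) = false.
Proof.
rewrite /root_word valid_rcons end_type_rcons /=; elim: i => [//|i [IH1 IH2]] /=.
by split.
Qed.

(** The seed and its right neighbour are branches 3 and 4 of one heptagon, so the whole tree lies
    below [root_word i]. No root word is a prefix of another, which keeps the trees apart. *)
Lemma node_word i n a k : node r t (walk R (seed_word i)) n a k ->
  exists w, [/\ a = walk R (root_word i ++ w), valid false (root_word i ++ w),
     end_type false (root_word i ++ w) = isB k, size w = n & kpath 0 None w = Some k].
Proof.
have [vr er] := valid_root i.
elim=> [||{}n {}a {}k d k' h [w [-> v e s kp]] hc].
- exists [:: 3]; rewrite cats1; split=> //; first by rewrite valid_rcons vr er.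
  by rewrite end_type_rcons.
- exists [:: 4]; rewrite cats1; split=> //; last 2 first.
  + by rewrite valid_rcons vr er.
  + by rewrite end_type_rcons /= er.
  by rewrite /seed_word !walk_rcons (rgt_mv3 rho7 tauK rho_tau3).
have [vd ed] := child_isB_type hc.
exists (rcons w d); rewrite -rcons_cat; split.
- by rewrite walk_rcons.
- by rewrite valid_rcons v e.
- by rewrite end_type_rcons e.
- by rewrite size_rcons s.
- by rewrite (kpath_rcons _ kp) s.
Qed.

Lemma root_word_inj i i' w w' : root_word i ++ w = root_word i' ++ w' -> i = i' /\ w = w'.
Proof.
elim: i i' => [|i IH] [|i'] //=; first by case=> ->.
by case=> /IH[-> ->].
Qed.

Lemma node_inj_mx i i' n n' a a' k k' e e' :
  node r t (walk R (seed_word i)) n a k -> node r t (walk R (seed_word i')) n' a' k' ->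
  (e < 7)%N -> (e' < 7)%N -> iter e r a = iter e' r a' -> [/\ n = n', k = k' & e = e'].
Proof.
move=> /node_word[w [-> v _ s kp]] /node_word[w' [-> v' _ s' kp']] e7 e'7.
rewrite !iter_rho => /(frames_inj v v' e7 e'7)[/root_word_inj[_ ww] ->].
by split=> //; [rewrite -s -s' ww|move: kp'; rewrite -ww kp => -[]].
Qed.

Lemma seed_inj i i' : ctr R *m walk R (seed_word i) = ctr R *m walk R (seed_word i') -> i = i'.
Proof.
have [v e] := valid_root i; have [v' e'] := valid_root i'.
move=> /(@walk_inj R false) h; have : seed_word i = seed_word i'.
  by apply: h; rewrite /seed_word valid_rcons ?v ?e ?v' ?e'.
by rewrite /seed_word -!cats1 => /root_word_inj[].
Qed.

Lemma frame_mx_mv d a : frame_mx a -> frame_mx (mv r t d a).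
Proof. by move=> fa; rewrite /mv iter_rho; apply/frame_mx_tau/frame_mx_rpow. Qed.

Lemma frame_mx_walk w : frame_mx (walk R w).
Proof.
elim/last_ind: w => [|w d IH]; first exact: frame_mx1.
by rewrite walk_rcons; apply: frame_mx_mv.
Qed.

End NodeWords.

(** * Tilings as colourings of darts *)

Section TilingColouring.
Local Open Scope ring_scope.
Local Open Scope classical_set_scope.
Variable R : realType.
Local Notation H := (@regular_heptagon R).
Local Notation rpow := (rpow R).
Local Notation r := (mulmx (rho R)).
Local Notation t := (mulmx (tau R)).
Local Notation edge0 := (@edge0 R).
Implicit Types (a b g : 'M[R]_3).

Lemma edge0_tau : act (tau R) @` edge0 = edge0.
Proof.
have sub x : edge0 x -> edge0 (act (tau R) x).
  move=> /edge0P[/heptagonP[hx h] h0].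
  have hf k : (k <= 7)%N -> mink (flip x) (nrm R k) = mink x (nrm R (7 - k)).
    by move=> k7; rewrite -[in LHS](subKn k7) -flip_nrm ?leq_subr// mink_flip.
  have e : act (tau R) x = flip x.
    rewrite /act act_tau /reflection hf// (nrm7 R 0 : nrm R (7 - 0) = nrm R 0) h0.
    by rewrite mulr0 scale0r subr0.
  apply/edge0P; split.
    have hp : hplane (act (tau R) x) by exact: hplane_tau.
    rewrite e in hp *; apply: heptagon_suff => //; rewrite hf//.
    by rewrite (nrm7 R 0 : nrm R (7 - 0) = nrm R 0).
  by rewrite e hf// (nrm7 R 0 : nrm R (7 - 0) = nrm R 0).
apply/seteqP; split=> x; first by move=> [y hy <-]; exact: sub.
move=> hx; exists (act (tau R) x); first exact: sub.
by rewrite /act -mulmxA tau_tau mulmx1.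
Qed.

Definition hept a : set 'rV[R]_3 := act a @` H.
Definition dart_edge a : set 'rV[R]_3 := act a @` edge0.

Lemma hept_rpow k a : hept (rpow k *m a) = hept a.
Proof. by rewrite /hept image_act heptagon_rpow. Qed.

Lemma dart_edge_tau a : dart_edge (tau R *m a) = dart_edge a.
Proof. by rewrite /dart_edge image_act edge0_tau. Qed.

Lemma place_edge a (i : 'I_7) : act a @` @regular_edge R i = dart_edge (rpow i *m a).
Proof. by rewrite /dart_edge image_act edge_rpow. Qed.

Lemma hept_eq a b : direct_isometry a -> direct_isometry b -> hept a = hept b ->
  exists2 e, (e < 7)%N & b = rpow e *m a.
Proof.
move=> da db h; have ua := direct_isometry_unit da.
have dg := direct_isometryM db (direct_isometryV da).
have [e e7 eE] : exists2 e, (e < 7)%N & b *m invmx a = rpow e.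
  apply: heptagon_stab => //; apply: (image_actV ua).
  by rewrite -image_act -mulmxA mulVmx// mulmx1 [RHS]h.
by exists e => //; rewrite -eE mulmxKV.
Qed.

Lemma heptagrid_hept a : frame_mx a -> heptagrid (hept a).
Proof. by move=> fa; apply/heptagridP; exists a. Qed.

Lemma frame_mx_rhoV a : frame_mx (rho R *m a) -> frame_mx a.
Proof.
move=> /(frame_mx_rpow 6); rewrite -iter_rho -iterSr rho7; exact.
Qed.

Lemma frame_mx_tauV a : frame_mx (tau R *m a) -> frame_mx a.
Proof. by move=> /frame_mx_tau; rewrite tauK. Qed.

Lemma frame_mx_rpowV k a : frame_mx (rpow k *m a) -> frame_mx a.
Proof.
elim: k => [|k IH]; first by rewrite mul1mx.
by rewrite /= -mulmxA => /frame_mx_rhoV.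
Qed.

Section Instance.
Variables (S : Type) (f : option S -> S -> option S -> S) (ok : S -> bool).
Variables (bl : S) (init : nat -> S) (N : nat).
Hypothesis init_bl : forall j, (N < j)%N -> init j = bl.
Variable st : nat -> int -> S.
Hypothesis st_right : forall n, st n.+2 n%:Z = init n.
Hypothesis st_left : forall n, st n.+2 (- (n.+1)%:Z) = bl.
Hypothesis st_step : forall n (x : int), - n.+2%:Z < x < n.+1%:Z ->
  st n.+3 x = f (est st n.+2 (x - 1)) (st n.+2 x) (est st n.+2 (x + 1)).
Variable code : colour S -> nat.
Hypothesis code_inj : injective code.
Variable I : instance.
Local Notation tileP := (tileP f ok bl init N).
Local Notation seed_tile := [:: Blank; Blank; Blank; LC; Vc bl; VB; Seam].
Hypothesis tilesE : forall u : prototile,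
  u \in tiles I <-> exists2 l, tileP l & tval u = map code l.
Hypothesis skeletonE : forall u : prototile,
  u \in skeleton I <-> tval u = map code seed_tile.

Lemma tileP_size l : tileP l -> size l = 7%N.
Proof. by case. Qed.

Section FromTiling.
Variables (tile : set 'rV[R]_3 -> prototile) (place : set 'rV[R]_3 -> 'M[R]_3).
Hypothesis tiling : is_tiling (tiles I) tile place.

(** Phrased with the edge as a set of points, as in [is_tiling]: the matching condition then gives
    at once the uniqueness of [c] and its invariance under crossing the edge. *)
Definition shade a (c : colour S) := frame_mx a /\ exists i : 'I_7,
  act (place (hept a)) @` @regular_edge R i = dart_edge a /\
  tnth (tile (hept a)) i = code c.

Definition tcol a : colour S :=
  if pselect (exists c, shade a c) is left h then projT1 (cid h) else Blank.

Lemma shade_edge a b c c' : shade a c -> shade b c' -> dart_edge a = dart_edge b -> c = c'.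
Proof.
move=> [fa [i [ei ci]]] [fb [j [ej cj]]] e; apply: code_inj; rewrite -ci -cj.
apply: tiling.2; [exact: heptagrid_hept|exact: heptagrid_hept|].
by rewrite ei ej.
Qed.

Lemma tcol_shade a c : shade a c -> tcol a = c.
Proof.
move=> h; rewrite /tcol; case: pselect => [h'|[]]; last by exists c.
by case: (cid h') => c' /= h2; apply: shade_edge h2 h _.
Qed.

Lemma place_rpow a : frame_mx a -> exists2 e, (e < 7)%N & place (hept a) = rpow e *m a.
Proof.
move=> fa; have [_ dp hp] := tiling.1 _ (heptagrid_hept fa).
by apply: hept_eq => //; exact: frame_mx_direct.
Qed.

Lemma frame_tile a : frame_mx a -> exists l e, [/\ tileP l, (e < 7)%N &
  forall i, shade (rpow i *m a) (nth Blank l ((i + e) %% 7))].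
Proof.
move=> fa; have [tT dp hp] := tiling.1 _ (heptagrid_hept fa).
have [l tl lE] := (tilesE _).1 tT; have [e e7 pE] := place_rpow fa.
have ltm k : (k %% 7 < 7)%N by rewrite ltn_mod.
(* Edge 0 of the prototile lies on the dart [rpow e *m a], so edge [i] counted from [a] is edge
   [i - e] of the prototile, modulo 7. *)
exists l, ((7 - e) %% 7)%N; split=> // i; split; first exact: frame_mx_rpow.
have j7 := ltm (i + (7 - e) %% 7)%N.
exists (Ordinal j7); rewrite hept_rpow; split; last first.
  by rewrite (tnth_nth 0%N) lE (nth_map Blank) ?tileP_size.
rewrite place_edge pE mulmxA -rpowD; congr (dart_edge (_ *m _)).
rewrite -rpow_mod -[RHS]rpow_mod; congr rpow => /=; lia.
Qed.

Lemma tcol_frame_out a : ~ frame_mx a -> tcol a = Blank.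
Proof. by move=> na; rewrite /tcol; case: pselect => [[c []]|]. Qed.

Lemma tcol_t a : tcol (t a) = tcol a.
Proof.
have [fa|na] := pselect (frame_mx a); last first.
  by rewrite !tcol_frame_out// => /frame_mx_tauV.
have ex b : frame_mx b -> exists c, shade b c.
  move=> /frame_tile[l [e [_ _ h]]]; have := h 0%N; rewrite mul1mx.
  by exists (nth Blank l ((0 + e) %% 7)).
have [c hc] := ex _ fa; have [c' hc'] := ex _ (frame_mx_tau fa).
rewrite (tcol_shade hc) (tcol_shade hc'); apply: shade_edge hc' hc _.
exact: dart_edge_tau.
Qed.

Lemma tcol_tile a : exists l e, [/\ tileP l, (e < 7)%N &
  forall i, (i < 7)%N -> tcol (iter i r a) = nth Blank l ((i + e) %% 7)].
Proof.
have [fa|na] := pselect (frame_mx a).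
  have [l [e [tl e7 h]]] := frame_tile fa; exists l, e; split=> // i _.
  by rewrite iter_rho; exact: tcol_shade.
(* Matrices that are not darts of the heptagrid count as blank, since [forced_all_ok] speaks of all
   elements of the type. *)
exists (nseq 7 Blank), 0%N; split=> // [|i _]; first exact: TBlank.
by rewrite nth_nseq if_same tcol_frame_out// iter_rho => /frame_mx_rpowV.
Qed.

Lemma tcol_seed h : heptagrid h -> tval (tile h) = map code seed_tile ->
  forall i, (i < 7)%N -> tcol (iter i r (place h)) = nth Blank seed_tile i.
Proof.
move=> hh th i i7; have [a fa ha] := (heptagridP h).1 hh.
have [e e7 pE] := place_rpow fa; rewrite [hept a]ha in pE.
have hp : hept (place h) = h by rewrite pE hept_rpow.
apply: tcol_shade; rewrite iter_rho; split; first by rewrite pE; do 2 apply: frame_mx_rpow.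
exists (Ordinal i7); rewrite hept_rpow hp place_edge; split=> //.
by rewrite (tnth_nth 0%N) th (nth_map Blank).
Qed.

End FromTiling.

Theorem tileable_ok : tileable_with_skeleton R I ->
  forall n (x : int), - n.+2%:Z < x < n.+1%:Z -> ok (st n.+2 x).
Proof.
move=> [tile [place [tiling skel]]].
have t0s : size (map code seed_tile) == 7%N by [].
pose t0 : prototile := Tuple t0s.
have t0I : t0 \in skeleton I by apply/skeletonE.
have [h [hh th]] := infinite_setN0 (skel t0 t0I).
apply: (@forced_all_ok S f ok bl init N init_bl st st_right st_left st_step _ r t
   (@rho7 R) (@tauK R) (@rho_tau3 R) (tcol tile place) (tcol_t tiling)
   (tcol_tile tiling) (place h)).
by apply: tcol_seed => //; rewrite th.
Qed.

Theorem ok_tileable : (forall n (x : int), - n.+2%:Z < x < n.+1%:Z -> ok (st n.+2 x)) ->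
  tileable_with_skeleton R I.
Proof.
move=> ok_st.
pose seeds i := walk R (seed_word i).
have inj := node_inj_mx (R := R) : forall i i' n n' a a' k k' e e',
  node r t (seeds i) n a k -> node r t (seeds i') n' a' k' -> (e < 7)%N -> (e' < 7)%N ->
  iter e r a = iter e' r a' -> [/\ n = n', k = k' & e = e'].
pose col := colouring bl init N st r t seeds.
have col_t := colouring_t N st_right st_left (@rho7 R) (@tauK R) (@rho_tau3 R) inj.
have col_tile := colouring_tile init_bl st_step (@rho7 R) inj ok_st.
have col_seed := colouring_seed bl init N st inj.
rewrite -/col in col_t col_tile col_seed.
pose fits h (al : 'M[R]_3 * seq (colour S)) := [/\ frame_mx al.1, hept al.1 = h,
  tileP al.2 & forall i, (i < 7)%N -> col (iter i r al.1) = nth Blank al.2 i].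
have fit h : heptagrid h -> exists al, fits h al.
  move=> /heptagridP[a fa ha]; have [l [e [tl e7 hl]]] := col_tile a.
  exists (rpow (7 - e) *m a, l); split=> //=; first exact: frame_mx_rpow.
    by rewrite hept_rpow.
  have rr (x : 'M[R]_3) : iter 7 r x = x by exact: rho7.
  by rewrite -iter_rho; exact: (shows_rot rr e7 hl).
pose al h := if pselect (exists al, fits h al) is left hal then projT1 (cid hal)
  else (1%:M, nseq 7 Blank).
have alP h : heptagrid h -> fits h (al h).
  by move=> /fit hal; rewrite /al; case: pselect => // ?; case: cid.
have t0s l : tileP l -> size (map code l) == 7%N by move=> /tileP_size s; rewrite size_map s.
pose tile h : prototile := insubd (nseq_tuple 7 0%N) (map code (al h).2).
pose place h := (al h).1.
have tileE h : heptagrid h -> tval (tile h) = map code (al h).2.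
  by move=> /alP[_ _ tl _]; rewrite /tile val_insubd t0s.
have nthE h (i : 'I_7) : heptagrid h -> tnth (tile h) i = code (col (rpow i *m place h)).
  move=> hh; have [_ _ tl hl] := alP _ hh.
  by rewrite (tnth_nth 0%N) tileE// (nth_map Blank) ?tileP_size// -iter_rho hl.
exists tile, place; split; first split.
- move=> h hh; have [fa ha tl _] := alP _ hh; split=> //.
    by apply/tilesE; exists (al h).2 => //; exact: tileE.
  exact: frame_mx_direct.
- move=> h h' i j hh hh' e; rewrite !nthE//.
  have [fa _ _ _] := alP _ hh; have [fb _ _ _] := alP _ hh'.
  have [->//|->] := shared_edge (frame_mx_direct fa) (frame_mx_direct fb) e.
  by rewrite col_t.
move=> u /skeletonE ut.
have seed_frame j : frame_mx (seeds j) by exact: frame_mx_walk.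
have seedT j : tile (hept (seeds j)) = u.
  have hh := heptagrid_hept (seed_frame j); apply/val_inj; rewrite /= ut tileE//.
  have [fa ha tl hl] := alP _ hh; congr map.
  have [e e7 pE] := hept_eq (frame_mx_direct (seed_frame j)) (frame_mx_direct fa) (esym ha).
  have hs i : (i < 7)%N -> nth Blank (al (hept (seeds j))).2 i = nth Blank seed_tile ((i + e) %% 7).
    move=> i7; rewrite -hl// pE -iter_rho -iterD.
    by rewrite -(iter_r_mod (@rho7 R)) col_seed// ltn_mod.
  move: (al _).2 tl hs => l tl hs.
  (* These are the indices at which [l] shows positions 6 and 0 of the seed. Only the seed has
     [Seam] followed by [Blank], and at position 6, whence [e = 0] and [l] is the seed. *)
  have k7 : ((13 - e) %% 7 < 7)%N by rewrite ltn_mod.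
  have k7' : ((14 - e) %% 7 < 7)%N by rewrite ltn_mod.
  have h6 := hs _ k7; have h0 := hs _ k7'.
  case: e e7 {pE hs k7 k7'} h6 h0 => [|[|[|[|[|[|[|//]]]]]]] _; case: tl => //=.
move=> fin; apply: infinite_nat.
have -> : [set: nat] = (fun j => hept (seeds j)) @^-1` [set h | heptagrid h /\ tile h = u].
  by apply/seteqP; split=> // j _; split; [exact: heptagrid_hept|exact: seedT].
(* Equal heptagons have equal centres, and [seed_inj] separates the centres of the seeds. *)
apply: finite_preimage fin => i j _ _ e; apply: (@seed_inj R).
have [k k7 eE] := hept_eq (frame_mx_direct (seed_frame i)) (frame_mx_direct (seed_frame j)) e.
by rewrite -/(seeds i) -/(seeds j) eE mulmxA ctr_rpow.
Qed.

End Instance.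
End TilingColouring.

(** * The self-referential instance *)

Definition colour_code (S : Type) (k : colour S) : nat + S + option S * S + nat :=
  match k with
  | Blank => inr 0 | LC => inr 1 | REnd => inr 2 | VW => inr 3
  | VB => inr 4 | VL => inr 5 | Seam => inr 6 | HR => inr 7
  | Vc s => inl (inl (inr s)) | Hh u v => inl (inr (u, v)) | Ch j => inl (inl (inl j))
  end.
Definition colour_decode (S : Type) (c : nat + S + option S * S + nat) : colour S :=
  match c with
  | inr 0 => Blank | inr 1 => LC | inr 2 => REnd | inr 3 => VW
  | inr 4 => VB | inr 5 => VL | inr 6 => Seam | inr _ => HR
  | inl (inl (inr s)) => Vc s | inl (inr (u, v)) => Hh u v | inl (inl (inl j)) => Ch j
  end.
Lemma colour_codeK (S : Type) : cancel (@colour_code S) (@colour_decode S).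
Proof. by case. Qed.
HB.instance Definition _ (S : eqType) := Equality.copy (colour S) (can_type (@colour_codeK S)).

Section SpaceTime.
Variables (S : finType) (M : turing_machine S) (c0 : config M).
Hypothesis head0 : chead c0 = 0%R.
Hypothesis head1 : chead (step c0) = 0%R.
Local Notation space_time := (space_time c0).

Lemma est_some n (x : int) : est space_time n x = Some (space_time n x) \/
  est space_time n x = None /\ (x = - n%:Z \/ x = n%:Z - 1)%R.
Proof.
rewrite /est; case: ifP => [/orP[]/eqP|_]; last by left.
  by right; split=> //; left.
by right; split=> //; right.
Qed.

Lemma space_time_est n (x : int) : (- n.+2%:Z < x < n.+1%:Z)%R ->
  space_time n.+3 x =
  next_cell (est space_time n.+2 (x - 1)%R) (space_time n.+2 x) (est space_time n.+2 (x + 1)%R).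
Proof.
move=> xn; apply: space_time_step => //.
  by case: (est_some n.+2 (x - 1)%R) => [->|[-> h]]; [left|right; split=> //; lia].
by case: (est_some n.+2 (x + 1)%R) => [->|[-> h]]; [left|right; split=> //; lia].
Qed.

End SpaceTime.

(** * The instance, its encoding and the contradiction *)

Section Instance.
Variable M : turing_machine letter.

(* The states of the preparing machine must not depend on the colours, which
   depend on the states, but only on a bound for the length of the words below. *)
Variable bound : nat.
Hypothesis bound_large : 400 <= bound.
Local Notation sym := (psym M).
Local Notation st := (pstate M bound).
Local Notation cell_t := (sym * option st)%type.
Local Notation colour := (colour cell_t).

Definition letter_cell l : cell_t := (@Cell M l MU, None).
Definition blank_cell : cell_t := (pblank M, None).
Definition first_cell : cell_t := (@Edge M, Some (@Wait M bound)).

(* The colours of the tiles depending on the hard-wired word come first, so that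
   their codes do not depend on [M]. *)
Definition special_colours : seq colour :=
  [:: Blank; LC; REnd; VW; VB; VL; Seam; HR; Vc blank_cell;
      Vc (letter_cell tally); Vc (letter_cell comma); Vc (letter_cell bar)].

Definition base_colours : seq colour :=
  special_colours ++ [seq Vc s | s <- enum {: cell_t}] ++
  [seq Hh u v | u <- enum {: option cell_t}, v <- enum {: cell_t}].

(** Parity separates the chain colours from the others. Two tallies per letter then write the code
    of [Ch j] exactly, whatever the number of base colours. *)
Definition code (k : colour) : nat :=
  if k is Ch j then 2 * j else (2 * index k base_colours).+1.

Lemma code_chain j : code (Ch j) = 2 * j.
Proof. by []. Qed.

Definition is_chain (k : colour) := if k is Ch _ then true else false.

Lemma code_base k : ~~ is_chain k -> code k = (2 * index k base_colours).+1.
Proof. by case: k. Qed.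

Lemma mem_base k : ~~ is_chain k -> k \in base_colours.
Proof.
rewrite /base_colours !mem_cat; case: k => // [s _|u v _].
  by rewrite (map_f _ (mem_enum _ s)) orbT.
by rewrite allpairs_f ?orbT// mem_enum.
Qed.

Lemma code_inj : injective code.
Proof.
move=> k k'; case ck : (is_chain k); case ck' : (is_chain k').
- case: k ck => // j _; case: k' ck' => // j' _; rewrite /code => e; congr Ch; lia.
- case: k ck => // j _; rewrite (code_base (negbT ck')) [code _]/=; lia.
- case: k' ck' => // j _; rewrite (code_base (negbT ck)) [code (Ch j)]/=; lia.
rewrite (code_base (negbT ck)) (code_base (negbT ck')) => e.
have ei : index k base_colours = index k' base_colours by lia.
by rewrite -(nth_index Blank (mem_base (negbT ck))) ei nth_index// mem_base// ck'.
Qed.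

Lemma code_special k : k \in special_colours -> code k < 24.
Proof.
move=> hk; have nk : ~~ is_chain k by case: k hk => // j; rewrite !inE.
have hi : index k special_colours < 12 by rewrite -[12]/(size special_colours) index_mem.
by rewrite (code_base nk) index_cat hk; lia.
Qed.

Opaque code.

(** The leading comma closes the unary code just counted by a sweep; what follows are the colours up
    to the next chain colour or the end of the tile. [Fin] completes the last chain tile and adds
    the bar and the skeleton. *)
Definition word (a : action) : seq letter :=
  match a with
  | Tick _ => [:: tally; tally]
  | Got l => comma :: encode_colour (code HR) ++ encode_colour (code VL) ++
                      encode_colour (code (Vc (letter_cell l)))
  | Again => comma :: encode_colour (code Blank) ++ encode_colour (code Blank)
  | Fin => comma :: encode_colour (code HR) ++ encode_colour (code VL) ++
      encode_colour (code (Vc blank_cell)) ++ encode_colour (code REnd) ++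
      encode_colour (code Blank) ++ encode_colour (code Blank) ++
      bar :: flatten (map encode_colour
        (map code [:: Blank; Blank; Blank; LC; Vc blank_cell; VB; Seam]))
  end.

Lemma size_encode_special k : k \in special_colours ->
  size (encode_colour (code k)) <= 24.
Proof. by move=> /code_special; rewrite /encode_colour size_rcons size_nseq. Qed.

(** The longest word is that of [Fin]: thirteen codes of at most 24 letters and two further letters,
    at most 314 in all. *)
Lemma word_bound a : size (word a) < bound.
Proof.
apply: leq_trans bound_large.
have sz := size_encode_special.
have h1 : size (encode_colour (code Blank)) <= 24 by apply: sz; rewrite !inE.
have h2 : size (encode_colour (code LC)) <= 24 by apply: sz; rewrite !inE.
have h3 : size (encode_colour (code REnd)) <= 24 by apply: sz; rewrite !inE.
have h4 : size (encode_colour (code VB)) <= 24 by apply: sz; rewrite !inE.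
have h5 : size (encode_colour (code VL)) <= 24 by apply: sz; rewrite !inE.
have h6 : size (encode_colour (code Seam)) <= 24 by apply: sz; rewrite !inE.
have h7 : size (encode_colour (code HR)) <= 24 by apply: sz; rewrite !inE.
have h8 : size (encode_colour (code (Vc blank_cell))) <= 24.
  by apply: sz; rewrite !inE eqxx !orbT.
have h9 l : size (encode_colour (code (Vc (letter_cell l)))) <= 24.
  by apply: sz; case: l => [[]|]; rewrite !inE eqxx !orbT.
move: h1 h2 h3 h4 h5 h6 h7 h8 h9; rewrite /word; move: code => cd.
have szc (x : letter) u : size (x :: u) = (size u).+1 by [].
case: a => [b|l||] h1 h2 h3 h4 h5 h6 h7 h8 h9 //.
- by have := h9 l; rewrite szc !size_cat; lia.
- by rewrite szc !size_cat; lia.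
rewrite !map_cons -[flatten _]/(_ ++ _ ++ _ ++ _ ++ _ ++ _ ++ _ ++ [::]).
by rewrite ?(szc, size_cat) [size [::]]/=; lia.
Qed.

Definition machine := prep_machine M word_bound.

Lemma word_tick b : word (Tick b) = [:: tally; tally].
Proof. by []. Qed.

Definition next : option cell_t -> cell_t -> option cell_t -> cell_t := @next_cell letter machine.
Definition not_accepting (s : cell_t) : bool := s.2 != Some (accept machine).

Definition seed_tile : seq colour := [:: Blank; Blank; Blank; LC; Vc blank_cell; VB; Seam].
Definition tile_right1 : seq colour :=
  [:: Blank; Seam; VL; Vc first_cell; Ch 0; Blank; Blank].
Definition tile_right_end : seq colour :=
  [:: REnd; HR; VL; Vc blank_cell; REnd; Blank; Blank].
Definition tile_left g : seq colour :=
  [:: LC; Blank; Blank; LC; Vc blank_cell; VB; Hh None g].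
Definition tile_column u s v : seq colour :=
  [:: Vc s; Hh u s; VL; Vc (next u s v); VW; VB; Hc (Some s) v].
Definition tile_passive u v : seq colour := [:: VW; Hh u v; VL; VW; VW; VB; Hh u v].
Definition tile_passive2 u v : seq colour := [:: VB; Hh u v; VL; VW; VB; Hh u v; VL].
Definition tile_letter l j : seq colour :=
  [:: Ch j; HR; VL; Vc (letter_cell l); Ch j.+1; Blank; Blank].
Definition tile_last j : seq colour :=
  [:: Ch j; HR; VL; Vc blank_cell; REnd; Blank; Blank].

Definition proto (l : seq colour) : prototile := insubd (nseq_tuple 7 0) (map code l).

Lemma protoE l : size l = 7 -> tval (proto l) = map code l.
Proof. by move=> s; rewrite /proto val_insubd size_map s eqxx. Qed.

Definition base_list : seq (seq colour) :=
  [:: nseq 7 Blank; seed_tile; tile_right1; tile_right_end] ++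
  [seq tile_left g | g <- enum {: cell_t}] ++
  [seq tile_column uv.1 s uv.2 | uv <- enum {: option cell_t * option cell_t},
                                 s <- [seq s <- enum {: cell_t} | not_accepting s]] ++
  [seq tile_passive u v | u <- enum {: option cell_t}, v <- enum {: cell_t}] ++
  [seq tile_passive2 u v | u <- enum {: option cell_t}, v <- enum {: cell_t}].

Definition base_tiles : seq prototile := undup (map proto base_list).

Definition letters := encode_tiles base_tiles.

Definition chain (w : seq letter) : seq (seq colour) :=
  rcons [seq tile_letter (nth tally w j) j | j <- iota 0 (size w)] (tile_last (size w)).

Definition chain_list := chain letters.

Definition all_tiles := base_tiles ++ map proto chain_list.

Lemma base_list_size l : l \in base_list -> size l = 7.
Proof.
rewrite /base_list !mem_cat !inE => /or4P[/or4P[] /eqP->|/mapP[g _ ->]||] //.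
  by move=> /allpairsP[p [_ _ ->]].
by case/orP => /allpairsP[p [_ _ ->]].
Qed.

Lemma base_list_head l : l \in base_list -> ~~ is_chain (head Blank l).
Proof.
rewrite /base_list !mem_cat !inE => /or4P[/or4P[] /eqP->|/mapP[g _ ->]||] //.
  by move=> /allpairsP[p [_ _ ->]].
by case/orP => /allpairsP[p [_ _ ->]].
Qed.

Lemma chain_listP l : l \in chain_list ->
  l = tile_last (size letters) \/
  exists2 j, j < size letters & l = tile_letter (nth tally letters j) j.
Proof.
rewrite mem_rcons inE => /orP[/eqP->|/mapP[j]]; first by left.
by rewrite mem_iota => /andP[_ jN] ->; right; exists j.
Qed.

Lemma chain_list_size l : l \in chain_list -> size l = 7.
Proof. by case/chain_listP => [->|[j _ ->]]. Qed.

Lemma proto_inj l l' : size l = 7 -> size l' = 7 -> proto l = proto l' -> l = l'.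
Proof.
move=> s s' /(congr1 (@tval 7 nat)); rewrite !protoE// => /inj_map; apply.
exact: code_inj.
Qed.

(** Chain tiles start with a chain colour and base tiles do not; among themselves, chain tiles are
    told apart by the index of that colour. *)
Lemma all_tiles_uniq : uniq all_tiles.
Proof.
rewrite /all_tiles cat_uniq undup_uniq /=; apply/andP; split.
  apply/hasPn => _ /mapP[l lc ->]; rewrite mem_undup; apply/negP => /mapP[l' lb e].
  have := base_list_head lb.
  rewrite -(proto_inj (chain_list_size lc) (base_list_size lb) e).
  by case/chain_listP: lc => [->|[j _ ->]].
rewrite map_inj_in_uniq; last first.
  by move=> l l' lc lc'; apply: proto_inj; apply: chain_list_size.
rewrite /chain_list rcons_uniq; apply/andP; split.
  by apply/negP => /mapP[j]; rewrite mem_iota => /andP[_ jN] [e]; rewrite e ltnn in jN.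
rewrite map_inj_in_uniq ?iota_uniq// => j j' _ _; by case.
Qed.

Definition the_instance : instance.
Proof.
refine (@Instance all_tiles [:: proto seed_tile] all_tiles_uniq isT _).
move=> u; rewrite inE => /eqP->; rewrite /all_tiles mem_cat mem_undup.
by rewrite map_f// /base_list !inE eqxx orbT.
Defined.

Definition start_config : config machine := prep_start M word_bound letters.

Definition init (j : nat) : cell_t := cell start_config (Posz j).

Lemma init0 : init 0 = first_cell.
Proof. by []. Qed.

Lemma initS j : init j.+1 = if j < size letters then letter_cell (nth tally letters j) else blank_cell.
Proof.
rewrite /init /cell /start_config /=; case: ltnP => h.
  by rewrite (nth_map tally).
by rewrite nth_default// size_map.
Qed.

Lemma init_blank j : size letters < j -> init j = blank_cell.
Proof. by case: j => // j h; rewrite initS ltnNge -ltnS h. Qed.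

Lemma mem_tilesP u : u \in all_tiles <->
  exists2 l, tileP next not_accepting blank_cell init (size letters) l & tval u = map code l.
Proof.
rewrite /all_tiles mem_cat mem_undup; split.
  suff h l : (l \in base_list) || (l \in chain_list) ->
      size l = 7 /\ tileP next not_accepting blank_cell init (size letters) l.
    case/orP => /mapP[l hl ->]; have [|sl tl] := h l; rewrite ?hl ?orbT//;
      by exists l; rewrite ?protoE.
  case/orP => hl; (split; [try exact: base_list_size; exact: chain_list_size|]); last first.
    case/chain_listP: hl => [->|[j jN ->]]; first exact: TDN.
    by have := TD next not_accepting blank_cell init jN; rewrite initS jN.
  move: hl; rewrite /base_list !mem_cat !inE => /or4P[/or4P[] /eqP->|/mapP[g _ ->]||].
  - exact: TBlank.
  - exact: TL1.
  - by have := TR1 next not_accepting blank_cell init (size letters); rewrite init0.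
  - exact: TRE.
  - exact: TL.
  - move=> /allpairsP[[uv s] [_ /= hs ->]]; apply: TC.
    by move: hs; rewrite mem_filter => /andP[].
  - case/orP => /allpairsP[p [_ _ ->]]; [exact: TW|exact: TB].
move=> [l tl uE].
have uP : u = proto l by apply/val_inj; rewrite /= uE protoE//; case: tl.
suff : (l \in base_list) || (l \in chain_list).
  by rewrite uP => /orP[] /(map_f proto) ->; rewrite ?orbT.
rewrite /base_list !mem_cat !inE.
case: tl {uE uP} => [|g|||j jN|||v s w oks|v w|v w]; rewrite ?eqxx ?orbT//.
- by rewrite (map_f tile_left (mem_enum _ g)) !orbT.
- rewrite initS jN; apply/orP; right; rewrite mem_rcons inE; apply/orP; right.
  by apply/mapP; exists j => //; rewrite mem_iota.
- by rewrite mem_rcons inE eqxx orbT.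
- by rewrite (allpairs_f (fun uv s => tile_column uv.1 s uv.2)
       (mem_enum _ (v, w)) (_ : s \in _)) ?orbT// mem_filter oks mem_enum.
- by rewrite (allpairs_f tile_passive (mem_enum _ v) (mem_enum _ w)) ?orbT.
- by rewrite (allpairs_f tile_passive2 (mem_enum _ v) (mem_enum _ w)) ?orbT.
Qed.

Opaque proto.

Lemma encode_tile_proto l : size l = 7 ->
  encode_tile (proto l) = flatten (map encode_colour (map code l)).
Proof. by move=> s; rewrite /encode_tile protoE. Qed.

Lemma encode_colourE c : encode_colour c = nseq c tally ++ [:: comma].
Proof. by rewrite /encode_colour cats1. Qed.

Lemma encode_tile_letter l j : encode_tile (proto (tile_letter l j)) = round_word word j l.
Proof.
have ej : encode_colour (code (Ch j)) = nseq (2 * j) tally ++ [:: comma].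
  by rewrite code_chain encode_colourE.
have ej' : encode_colour (code (Ch j.+1)) = nseq (2 * j.+1) tally ++ [:: comma].
  by rewrite code_chain encode_colourE.
rewrite encode_tile_proto// /round_word /word; move: code ej ej' => cd ej ej'.
rewrite -[flatten _]/(_ ++ _ ++ _ ++ _ ++ _ ++ _ ++ _ ++ [::]) cats0 ej ej'.
by rewrite -?catA /= -?catA /=.
Qed.

Lemma rounds_wordE j w : rounds_word word j w =
  flatten [seq encode_tile (proto (tile_letter (nth tally w (i - j)) i)) | i <- iota j (size w)].
Proof.
have -> : [seq encode_tile (proto (tile_letter (nth tally w (i - j)) i)) | i <- iota j (size w)] =
    [seq round_word word i (nth tally w (i - j)) | i <- iota j (size w)].
  by apply: eq_map => i; rewrite encode_tile_letter.
move: word => wd; elim: w j => // l w IH j.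
rewrite [LHS]/= IH [RHS]/= subnn; congr (_ ++ flatten _).
by apply/eq_in_map => i; rewrite mem_iota => /andP[ji _]; rewrite -(subnSK ji).
Qed.

Lemma encode_last N : encode_tile (proto (tile_last N)) ++
  bar :: encode_tile (proto seed_tile) = nseq (2 * N) tally ++ word Fin.
Proof.
have e : encode_colour (code (Ch N)) = nseq (2 * N) tally ++ [:: comma].
  by rewrite code_chain encode_colourE.
apply: etrans (congr2 (fun u v => u ++ bar :: v) (@encode_tile_proto (tile_last N) erefl)
  (@encode_tile_proto seed_tile erefl)) _.
rewrite /word /seed_tile /tile_last; move: code e => cd e.
move: (flatten (map _ (map cd [:: Blank, _ & _]))) => s; rewrite !map_cons.
rewrite -[flatten _]/(_ ++ _ ++ _ ++ _ ++ _ ++ _ ++ _ ++ [::]) cats0 e.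
by rewrite -?catA /= -?catA /=.
Qed.

Lemma encode_tiles_cat u v : encode_tiles (u ++ v) = encode_tiles u ++ encode_tiles v.
Proof. by rewrite /encode_tiles map_cat flatten_cat. Qed.

Lemma encode_tiles1 u : encode_tiles [:: u] = encode_tile u.
Proof. by rewrite /encode_tiles /= cats0. Qed.

Lemma encode_chain w : encode_tiles (map proto (chain w)) =
  rounds_word word 0 w ++ encode_tile (proto (tile_last (size w))).
Proof.
rewrite /chain map_rcons -cats1 encode_tiles_cat encode_tiles1; congr cat.
rewrite rounds_wordE /encode_tiles.
rewrite -2!map_comp.
apply: congr1.
apply: eq_map => j.
rewrite (subn0 j).
by [].
Qed.

(** The fixed point. [letters] encodes the base tiles, and the rounds over [letters] write precisely
    the tiles that hard-wire [letters], so the machine hands [M] the encoding of the instance that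
    simulates it. *)
Lemma encode_instance : encode the_instance = output word letters.
Proof.
apply: etrans (congr1 (cat^~ _) (encode_tiles_cat _ _)) _; rewrite -catA.
apply: congr1; apply: etrans (congr1 (cat^~ _) (encode_chain letters)) _; rewrite -catA.
apply: congr1; rewrite -encode_last; apply: congr1; apply: congr1.
exact: encode_tiles1.
Qed.

Lemma head0 : chead start_config = 0%R.
Proof. by []. Qed.

(** The purpose of [Wait]: without it the head would leave [Edge] at once and be in column 1 at time
    1, where the right border still writes the initial content. *)
Lemma head1 : chead (step start_config) = 0%R.
Proof. by rewrite step_prep_start. Qed.

Lemma space_time_right n : space_time start_config n.+2 n%:Z = init n.
Proof.
case: n => [|n]; first by [].
by apply: space_time_frontier; [exact: head0|exact: head1|lia|lia].
Qed.

Lemma space_time_left n : space_time start_config n.+2 (- n.+1%:Z)%R = blank_cell.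
Proof.
apply: etrans (_ : cell start_config (Negz n) = _); last by [].
by rewrite NegzE; apply: space_time_frontier; [exact: head0|exact: head1|lia|lia].
Qed.

Lemma mem_skeleton (u : prototile) : u \in skeleton the_instance <-> tval u = map code seed_tile.
Proof.
rewrite -[skeleton _]/[:: proto seed_tile] inE; split=> [/eqP->|uE].
  exact: (@protoE seed_tile erefl).
by apply/eqP/val_inj; rewrite [RHS](@protoE seed_tile erefl).
Qed.

Lemma instance_tileable (R : realType) :
  tileable_with_skeleton R the_instance <->
  forall n x, (- n.+2%:Z < x < n.+1%:Z)%R -> not_accepting (space_time start_config n.+2 x).
Proof.
have hst := space_time_est head0 head1.
split.
  exact: (@tileable_ok R _ next not_accepting _ _ _ init_blank _ space_time_right
    space_time_left hst _ code_inj the_instance mem_tilesP mem_skeleton).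
exact: (@ok_tileable R _ next not_accepting _ _ _ init_blank _ space_time_right
  space_time_left hst _ the_instance mem_tilesP mem_skeleton).
Qed.

Lemma not_solves (R : realType) : ~ solves encode (@tileable_with_skeleton R) M.
Proof.
move=> /(_ the_instance)[yes no].
rewrite encode_instance in yes no.
(* Otherwise [M] rejects, hence so does the simulated machine, which therefore never accepts: no
   forbidden cell appears and the instance is tileable after all. *)
have til : tileable_with_skeleton R the_instance.
  apply: contrapT => ntil; apply: (ntil); apply/instance_tileable => n x _.
  have [m hm] := prep_rejects word_bound word_tick (no ntil).
  apply/negP; rewrite /not_accepting /space_time /cell; case: ifP => // _ /eqP e.
  exact: accept_not_reject (congr1 (odflt (accept machine)) e) hm.
have [n hn] := prep_accepts word_bound word_tick (yes til).
(* At the accepting time [n] the head is inside level [n.+2], so one of the forced columns shows the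
   accepting state, which no tile carries. *)
have hb := head_bound head0 head1 n.
have := (instance_tileable R).1 til n (chead (iter n (@step _ machine) start_config)).
rewrite /space_time /cell /not_accepting eqxx [(_, _).2]/= hn eqxx => h.
suff : false by []. apply: h.
by move: hb; move: (chead _) => y; lia.
Qed.

End Instance.

Theorem corollary1 (R : realType) :
  undecidable encode (@tileable_with_skeleton R).
Proof.
move=> [M sol]; have [bound large] : exists bound, 400 <= bound by exists 400.
exact: (not_solves large sol).
Qed.
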